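(* As $n \to \infty$, $$\sigma\mathrm{Mex}(n) \sim \frac{\sqrt{2}}{8}\, n^{-3/4}\, e^{\pi \sqrt{n}}.$$
   Context: An overpartition of a non-negative integer $n$ is a partition of $n$ (a finite non-increasing sequence of positive integers with sum $n$) in which the first occurrence of each distinct part may or may not be overlined. Let $\bar{P}(n)$ be the set of all overpartitions of $n$. For $\lambda\in\bar P(n)$, $\mathrm{Mex}(\lambda)$ is the smallest positive integer that does not occur as a part of $\lambda$, whether overlined or non-overlined. Define $\sigma\mathrm{Mex}(n)=\sum_{\lambda\in\bar P(n)}\mathrm{Mex}(\lambda)$. The notation $a(n)\sim b(n)$ means $a(n)/b(n)\to 1$. *)

(* Defs.v *)
From HB Require Import structures.
From mathcomp Require Import all_boot.

Set Implicit Arguments.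
Unset Strict Implicit.
Unset Printing Implicit Defensive.

Local Open Scope nat_scope.

(* A part of an overpartition is a pair (size, overlined?), so the underlying
   partition of [s : seq (nat * bool)] is [unzip1 s]. *)
Definition is_overpartition (n : nat) (s : seq (nat * bool)) : bool :=
  [&& sorted geq (unzip1 s),
      all (leq 1) (unzip1 s),
      sumn (unzip1 s) == n
    & [forall i : 'I_(size s),
         nth false (unzip2 s) i ==>
           (nth 0 (unzip1 s) i \notin take i (unzip1 s))]].

Record overpartition (n : nat) : predArgType := Overpartition {
  op_seq :> seq (nat * bool);
  _ : is_overpartition n op_seq }.

HB.instance Definition _ n := [isSub for @op_seq n].
HB.instance Definition _ n := [Countable of overpartition n by <:].

(* [overpartition n] is a finite type: an overpartition of n has at most n
   parts, all of them at most n. *)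
Definition op_encode n (l : overpartition n) : n.-bseq ('I_n.+1 * bool) :=
  insub_bseq n [seq (inord p.1, p.2) | p <- l].

Definition op_decode n (b : n.-bseq ('I_n.+1 * bool)) :
    option (overpartition n) :=
  insub [seq (val p.1, p.2) | p <- b].

Lemma mem_leq_sumn (s : seq nat) m : m \in s -> m <= sumn s.
Proof.
elim: s => //= k s IHs; rewrite inE => /orP[/eqP-> | /IHs le_s].
  exact: leq_addr.
exact: leq_trans le_s (leq_addl _ _).
Qed.

Lemma size_leq_sumn (s : seq nat) : all (leq 1) s -> size s <= sumn s.
Proof.
elim: s => //= k s IHs /andP[k_gt0 s_gt0].
by rewrite -add1n leq_add // IHs.
Qed.

Lemma op_encodeK n : pcancel (@op_encode n) (@op_decode n).
Proof.
move=> l; rewrite /op_decode /op_encode.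
have /and4P[_ pos /eqP sum_l _] := valP l.
have size_l : size (val l) <= n.
  by have := size_leq_sumn pos; rewrite sum_l size_map.
have le_n p : p \in val l -> p.1 <= n.
  by move=> /(map_f fst) /mem_leq_sumn; rewrite sum_l.
rewrite insubdK; last by rewrite -topredE /= size_map.
rewrite -map_comp map_id_in ?valK // => p p_l.
by rewrite /= inordK ?ltnS ?le_n //; case: (p).
Qed.

HB.instance Definition _ n : isFinite (overpartition n) :=
  PCanIsFinite (@op_encodeK n).

Lemma mex_exists (s : seq nat) : exists m, (0 < m) && (m \notin s).
Proof.
exists (sumn s).+1; apply/negP => /= /mem_leq_sumn.
by rewrite ltnn.
Qed.

Definition Mex n (l : overpartition n) : nat :=
  ex_minn (mex_exists (unzip1 l)).

Definition sigmaMex (n : nat) : nat := \sum_(l : overpartition n) Mex l.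

(* Main.v *)
Require Import Defs.
From mathcomp Require Import all_boot all_order all_algebra.
From mathcomp Require Import all_classical all_reals all_analysis.
From mathcomp Require Import measurable_realfun.
From mathcomp Require Import ring lra zify.

Import Order.TTheory GRing.Theory Num.Theory.
Import numFieldNormedType.Exports.
Local Open Scope classical_set_scope.
Local Open Scope ring_scope.

(* Since Mex l > m iff 1, ..., m all occur in l, sigmaMex n is the sum over m of
   the n-th coefficients of
     prod_(k <= m) 2 q^k / (1 - q^k) * prod_(k > m) (1 + q^k) / (1 - q^k).
   Each coefficient is a Fourier integral over the circle of radius q = e^(-t)
   with t = pi / (2 sqrt n). Relative to prod (1 + q^k) / (1 - q^k), the m-th
   integrand tends, after the rescalings m = 2 x / sqrt t and
   th = (2 / pi) t^(3/2) u, to e^(-x^2) e^(-u^2), so the sum over m and the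
   integral over th both become Gaussian integrals. The value
   prod (1 - q^k) / (1 + q^k) ~ 2 sqrt(pi / t) e^(- pi^2 / (4 t)) and its first
   two logarithmic derivatives follow from Gauss's identity with the theta
   series and from Polya's elementary proof of the theta transformation. *)

(** * Counting overpartitions *)

(** The saddle parameter solves pi^2 / (4 t^2) = n, the stationarity condition for t n + pi^2 / (4
    t); at that point both terms equal pi sqrt n / 2. Replacing a factor 1 + q^k by 2 q^k costs
    about e^(- k t / 2), which over k <= m accumulates to e^(- t m^2 / 4): hence m of order
    t^(-1/2). The second logarithmic derivative of the product grows like pi^2 / (2 t^3): hence
    angles of order t^(3/2). Two obstacles shape the proof. An asymptotic formula cannot be
    differentiated; here the logarithm is convex in t, so difference quotients bracket its
    derivatives, provided that it is known up to O(t), and the theta transformation gives that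
    precision. Exchanging limits with the sum over m and the integral requires a majorant in both
    variables on the whole circle, not only near the saddle. Products are cut at finitely many
    factors. This loses nothing on the coefficient of index n, which only sees parts up to n, and
    almost nothing on the size of the product, since n is of order t^(-2), far beyond 1 / t. *)

Section Combinatorics.
Local Open Scope nat_scope.

(* The number of overpartitions of n with all parts at most K and in which
   1, ..., min(m, K) all occur. *)
Fixpoint count_ovp (m K n : nat) : nat :=
  if K is k.+1 then
    (m <= k) * count_ovp m k n
    + 2 * \sum_(0 <= j < n | j.+1 * K <= n) count_ovp m k (n - j.+1 * K)
  else n == 0.

(* p = (j, b) encodes j.+1 copies of the part K, the first one overlined iff b. *)
Definition block (K : nat) (p : nat * bool) (s : seq (nat * bool)) :=
  (K, p.2) :: nseq p.1 (K, false) ++ s.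

Definition heads (K n : nat) : seq (nat * bool) :=
  [seq (j, b) | j <- [seq j <- iota 0 n | j.+1 * K <= n], b <- [:: true; false]].

Fixpoint ovps (K n : nat) : seq (seq (nat * bool)) :=
  if K is k.+1 then
    ovps k n ++
    [seq block K p s | p <- heads K n, s <- ovps k (n - p.1.+1 * K)]
  else if n == 0 then [:: [::]] else [::].

(** The overlining condition of [is_overpartition] read from the other end: rather than asking that
    an overlined part have no earlier copy, it forbids any part to be followed by an overlined copy
    of itself. In this form it recurses on the list. *)
Fixpoint first_overlined (s : seq (nat * bool)) : bool :=
  if s is p :: s' then ((p.1, true) \notin s') && first_overlined s' else true.

Lemma first_overlinedP (s : seq (nat * bool)) :
  [forall i : 'I_(size s),
     nth false (unzip2 s) i ==>
       (nth 0 (unzip1 s) i \notin take i (unzip1 s))] = first_overlined s.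
Proof.
elim: s => [|p s IHs]; first by apply/forallP => -[].
rewrite /= -IHs; apply/forallP/andP => [H | [p_s /forallP H] [[|i] lt_i //=]].
  split.
    apply/negP => /(nthP (0, false))[i lt_i def_i].
    have := H (lift ord0 (Ordinal lt_i)).
    by rewrite /= !(nth_map (0, false)) // def_i /= inE eqxx.
  apply/forallP => i; have := H (lift ord0 i).
  by rewrite /= inE negb_or; case: nth => //= /andP[].
  by case: p.2.
have := H (Ordinal (lt_i : i < size s)); rewrite /= inE negb_or.
case b_i: nth => //= ->; rewrite andbT; apply: contra p_s => /eqP def_p.
rewrite ltnS in lt_i.
apply/(nthP (0, false)); exists i => //; apply/eqP.
by rewrite -pair_eqE /pair_eq /= -def_p -b_i !(nth_map (0, false)) // !eqxx.
Qed.

Definition is_bounded_ovp (K n : nat) (s : seq (nat * bool)) : bool :=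
  [&& sorted geq (unzip1 s), all (leq 1) (unzip1 s), sumn (unzip1 s) == n,
      first_overlined s & all (geq K) (unzip1 s)].

(** Sortedness puts the copies of [K.+1] in front, and they are all plain because the overlined one
    is excluded. This recovers the shape of a [block] behind its first entry. *)
Lemma block_split (K : nat) (s : seq (nat * bool)) :
    sorted geq (unzip1 s) -> all (geq K.+1) (unzip1 s) ->
    (K.+1, true) \notin s ->
  exists j s', s = nseq j (K.+1, false) ++ s' /\ all (geq K) (unzip1 s').
Proof.
elim: s => [|[x b] s IHs] /=; first by exists 0, [::].
rewrite inE negb_or => s_sort /andP[/= le_x le_s] /andP[ne_x s_x].
have [eq_x|ne_xK] := eqVneq x K.+1.
  have [j [s' [-> ?]]] := IHs (path_sorted s_sort) le_s s_x.
  exists j.+1, s'; split=> //=; congr (_ :: _); rewrite eq_x; congr pair.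
  by move: ne_x; rewrite eq_x -pair_eqE /pair_eq /= eqxx /=; case: b.
exists 0, ((x, b) :: s); split=> //=.
have le_xK : x <= K by rewrite -ltnS ltn_neqAle ne_xK.
apply/andP; split=> //; apply/allP => y y_s.
have /allP/(_ y y_s) := order_path_min (rev_trans leq_trans) s_sort.
by move=> le_yx; apply: leq_trans le_xK.
Qed.

Lemma unzip1_block K p s : unzip1 (block K p s) = nseq p.1.+1 K ++ unzip1 s.
Proof. by rewrite /block /unzip1 /= map_cat map_nseq. Qed.

Lemma notin_gt K x (s : seq (nat * bool)) :
  all (geq K) (unzip1 s) -> K < x.1 -> x \notin s.
Proof.
move=> /allP le_s lt_x; apply/negP => /(map_f fst) /le_s.
by rewrite /= leqNgt lt_x.
Qed.

Lemma is_bounded_ovp_block k n p s : all (geq k) (unzip1 s) ->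
  is_bounded_ovp k.+1 n (block k.+1 p s)
    = (p.1.+1 * k.+1 <= n) && is_bounded_ovp k (n - p.1.+1 * k.+1) s.
Proof.
move=> le_s; rewrite /is_bounded_ovp unzip1_block le_s !andbT.
have -> : sorted geq (nseq p.1.+1 k.+1 ++ unzip1 s) = sorted geq (unzip1 s).
  elim: p.1 => [|j] /=.
    rewrite path_sortedE ?andb_idl //; last exact: (rev_trans leq_trans).
    by move=> _; apply: sub_all le_s => x /= /leqW.
  by move=> <-; rewrite leqnn.
rewrite !all_cat !all_nseq /= leqnn sumn_cat sumn_nseq mulnC.
have -> : all (geq k.+1) (unzip1 s) by apply: sub_all le_s => x /= /leqW.
rewrite (_ : _ && first_overlined _ = first_overlined s); last first.
  rewrite mem_cat mem_nseq negb_or.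
  rewrite (_ : (_ \notin s)); last exact: (notin_gt _ _ _ le_s).
  rewrite -pair_eqE /pair_eq /= andbF andbF /=.
  elim: p.1 => //= j ->; rewrite andb_idl // => _.
  rewrite mem_cat mem_nseq -pair_eqE /pair_eq /= !andbF /=.
  exact: (notin_gt _ _ _ le_s).
case: (leqP _ n) => [le_n | gt_n] /=; rewrite ?andbT.
  rewrite (_ : (_ + _ == n) = (sumn (unzip1 s) == n - p.1.+1 * k.+1)) //.
  by apply/eqP/eqP; lia.
by apply/negbTE; rewrite !negb_and; apply/orP; right; apply/orP; right; lia.
Qed.

Lemma is_bounded_ovp_le k K n s : k <= K -> is_bounded_ovp k n s -> is_bounded_ovp K n s.
Proof.
move=> le_k /and5P[? ? ? ? le_s]; rewrite /is_bounded_ovp; apply/and5P; split=> //.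
by apply: sub_all le_s => x /= /leq_trans; apply.
Qed.

Lemma mem_heads K n p : 0 < K -> (p \in heads K n) = (p.1.+1 * K <= n).
Proof.
move=> K_gt0; apply/allpairsP/idP => [[[j b] /= []] | le_p].
  by rewrite mem_filter => /andP[le_j _] _ ->.
exists p; split; [|by case: p.2|by case: (p)].
by rewrite mem_filter le_p mem_iota; nia.
Qed.

Lemma mem_ovps K n s : (s \in ovps K n) = is_bounded_ovp K n s.
Proof.
elim: K n s => [|k IHk] n s.
  case: s => [|[x b] s]; first by rewrite /is_bounded_ovp /= eq_sym andbT; case: eqP.
  rewrite /=.
  rewrite /is_bounded_ovp /=; case: x => [|x]; rewrite ?andbF //; by case: eqP.
rewrite /= mem_cat IHk; apply/orP/idP => [[/is_bounded_ovp_le|]|s_ov].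
- exact.
- case/allpairsPdep => p [s' [p_in s'_in ->]].
  rewrite IHk in s'_in; case/and5P: (s'_in) => _ _ _ _ le_s'.
  by rewrite is_bounded_ovp_block // s'_in -mem_heads // p_in.
case/and5P: (s_ov) => s_sort s_pos sum_s s_good le_s.
case: s => [|[x b] s] in s_ov s_sort s_pos sum_s s_good le_s *; first by left.
have [eq_x|ne_x] := eqVneq x k.+1; last first.
  left; rewrite /is_bounded_ovp s_sort s_pos sum_s s_good /=.
  case/andP: le_s => /= le_x le_s; have le_xk : x <= k by lia.
  rewrite le_xk /=; have := order_path_min (rev_trans leq_trans) s_sort.
  by apply: sub_all => y /= /leq_trans; apply.
case/andP: s_good => /= s_x _; rewrite eq_x in s_x *.
have [j [s' [def_s le_s']]] := block_split _ _ (path_sorted s_sort) (andP le_s).2 s_x.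
right; apply/allpairsPdep; exists (j, b), s'.
have def_bl : (k.+1, b) :: s = block k.+1 (j, b) s' by rewrite /block def_s.
move: s_ov; rewrite eq_x def_bl is_bounded_ovp_block // => /andP[le_j s'_ov].
by rewrite mem_heads //= IHk.
Qed.

Lemma block_inj k p p' s s' :
    all (geq k) (unzip1 s) -> all (geq k) (unzip1 s') ->
  block k.+1 p s = block k.+1 p' s' -> (p, s) = (p', s').
Proof.
have count_block q u : all (geq k) (unzip1 u) ->
    count (fun x => x.1 == k.+1) (block k.+1 q u) = q.1.+1.
  move=> le_u; rewrite /block /= eqxx count_cat count_nseq /= eqxx mul1n.
  rewrite (eqP (_ : count _ u == 0)) ?addn0 // -leqn0 leqNgt -has_count.
  by apply/hasPn => x /(map_f fst) /(allP le_u) /=; lia.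
move=> le_s le_s' eq_b; have := count_block p s le_s.
rewrite eq_b count_block // => -[eq_p1]; case: eq_b => eq_p2.
rewrite -eq_p1 => /eqP; rewrite eqseq_cat // eqxx /= => /eqP ->.
by case: p p' eq_p1 eq_p2 => [? ?] [? ?] /= -> ->.
Qed.

Lemma uniq_ovps K n : uniq (ovps K n).
Proof.
elim: K n => [|k IHk] n /=; first by case: ifP.
have le_ovps m s : s \in ovps k m -> all (geq k) (unzip1 s).
  by rewrite mem_ovps => /and5P[].
rewrite cat_uniq IHk /=; apply/andP; split.
  apply/hasPn => s /allpairsPdep[p [s' [_ s'_in ->]]]; rewrite mem_ovps.
  by apply/negP => /and5P[_ _ _ _]; rewrite unzip1_block /= ltnn.
apply: allpairs_uniq_dep => //.
- rewrite allpairs_uniq // ?filter_uniq ?iota_uniq //.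
  by move=> [? ?] [? ?].
- move=> [p s] [p' s'] /allpairsPdep[p0 [s0 [_ s0_in [-> ->]]]].
  move=> /allpairsPdep[p1 [s1 [_ s1_in [-> ->]]]] /= /block_inj.
  by move=> /(_ (le_ovps _ _ s0_in) (le_ovps _ _ s1_in)) [-> ->].
Qed.

Definition has_all (m : nat) (s : seq (nat * bool)) : bool :=
  all (mem (unzip1 s)) (iota 1 m).

Lemma has_all_block m k p s :
  has_all (minn m k.+1) (block k.+1 p s) = has_all (minn m k) s.
Proof.
rewrite /has_all unzip1_block; apply/allP/allP => H x; rewrite mem_iota => le_x.
  have /H : x \in iota 1 (minn m k.+1) by rewrite mem_iota; lia.
  rewrite inE mem_cat mem_nseq /= => /orP[/eqP def_x|//]; lia.
rewrite inE mem_cat mem_nseq /=; have [->//|ne_x] := eqVneq x k.+1.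
by apply: H; rewrite mem_iota; lia.
Qed.

Lemma count_ovpE m K n : count_ovp m K n = count (has_all (minn m K)) (ovps K n).
Proof.
elim: K n => [|k IHk] n /=.
  by rewrite minn0; case: eqP.
rewrite count_cat; congr (_ + _).
  rewrite IHk; case: (leqP m k) => [le_m|lt_m].
    by rewrite mul1n (minn_idPl (leqW le_m)).
  rewrite mul0n; apply/esym/eqP; rewrite -leqn0 leqNgt -has_count.
  apply/hasPn => s; rewrite mem_ovps => /and5P[_ _ _ _ le_s].
  rewrite (minn_idPr lt_m); apply/negP => /allP/(_ k.+1).
  by rewrite mem_iota ltnSn /= => /(_ isT) /(allP le_s) /=; rewrite ltnn.
rewrite count_flatten -map_comp sumnE big_map /heads big_allpairs_dep.
rewrite big_filter /index_iota subn0 big_distrr /=; apply: eq_bigr => j _.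
rewrite !big_cons big_nil addn0 mul2n -addnn IHk /= !count_map.
by congr (_ + _); apply: eq_count => s /=; rewrite has_all_block.
Qed.

(** * The mex in terms of the counts *)

Lemma MexE n (l : overpartition n) m : (m < Mex l) = has_all m l.
Proof.
rewrite /Mex; case: ex_minnP => x /andP[x_gt0 x_l] x_min.
apply/idP/allP => [lt_m y | H].
  rewrite mem_iota => /andP[y_gt0 lt_y]; apply: contraLR lt_m => y_l.
  by rewrite -leqNgt; apply: leq_trans (x_min y _) _; rewrite ?y_gt0 //; lia.
rewrite ltnNge; apply: contra x_l => le_x; apply: H.
by rewrite mem_iota x_gt0; lia.
Qed.

Lemma Mex_leS n (l : overpartition n) : Mex l <= n.+1.
Proof.
rewrite leqNgt MexE; apply/negP => /allP /(_ n.+1).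
rewrite mem_iota ltnSn /= => /(_ isT) /mem_leq_sumn.
by have /and4P[_ _ /eqP-> _] := valP l; rewrite ltnn.
Qed.

Lemma card_has_all n m : m <= n ->
  #|[pred l : overpartition n | has_all m l]| = count_ovp m n n.
Proof.
move=> le_m; rewrite count_ovpE (minn_idPl le_m) -size_filter cardE /enum_mem.
rewrite -(size_map val); apply: perm_size; apply: uniq_perm.
- rewrite map_inj_uniq ?filter_uniq -?enumT ?enum_uniq //; exact: val_inj.
- by rewrite filter_uniq ?uniq_ovps.
move=> s; rewrite mem_filter mem_ovps; apply/mapP/andP => [[l] | [s_m s_ov]].
  rewrite mem_filter => /andP[l_m _] ->; split=> //.
  have /and4P[l1 l2 l3] := valP l; rewrite first_overlinedP => l4.
  rewrite /is_bounded_ovp l1 l2 l3 l4 /=; apply/allP => x /mem_leq_sumn.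
  by rewrite (eqP l3).
have s_op : is_overpartition n s.
  by case/and5P: s_ov => s1 s2 s3 s4 _; rewrite /is_overpartition first_overlinedP s1 s2 s3.
exists (Overpartition s_op) => //; rewrite mem_filter -enumT mem_enum.
by rewrite inE andbT; apply: s_m.
Qed.

Lemma sum_ltn (N x : nat) : \sum_(m < N) (m < x : nat) = minn N x.
Proof.
elim: N => [|N IHN]; first by rewrite big_ord0 min0n.
by rewrite big_ord_recr /= IHN; case: (ltnP N x); lia.
Qed.

Lemma sigmaMexE n : sigmaMex n = \sum_(m < n.+1) count_ovp m n n.
Proof.
rewrite /sigmaMex.
under eq_bigr => l _ do rewrite -(minn_idPr (Mex_leS _ l)) -sum_ltn.
rewrite exchange_big /=; apply: eq_bigr => m _.
rewrite -card_has_all -1?ltnS // -sum1_card [RHS]big_mkcond /=.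
by apply: eq_bigr => l _; rewrite inE MexE; case: has_all.
Qed.

Lemma count_ovpS_lt m k n : n < k.+1 -> count_ovp m k.+1 n = (m <= k) * count_ovp m k n.
Proof.
move=> lt_n /=; rewrite big1 ?muln0 ?addn0 // => j le_j.
by have := leq_pmull k.+1 (ltn0Sn j); lia.
Qed.

(** With K = [k.+1] and F_K the generating function, this is the coefficient of q^n in (1 - q^K) F_K
    = ([m <= k] (1 - q^K) + 2 q^K) F_k, rearranged to avoid subtraction. The bracket is 1 + q^K or 2
    q^K. *)
Lemma count_ovpS_ge m k n : k.+1 <= n ->
  count_ovp m k.+1 n + (m <= k) * count_ovp m k (n - k.+1)
    = count_ovp m k.+1 (n - k.+1) + (m <= k) * count_ovp m k n + 2 * count_ovp m k (n - k.+1).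
Proof.
move=> le_n /=.
have -> : \sum_(0 <= j < n | j.+1 * k.+1 <= n) count_ovp m k (n - j.+1 * k.+1)
  = count_ovp m k (n - k.+1) + \sum_(0 <= j < n - k.+1 | j.+1 * k.+1 <= n - k.+1)
      count_ovp m k (n - k.+1 - j.+1 * k.+1).
  case: n le_n => // n le_n.
  rewrite big_mkcond big_nat_recl //= mul1n le_n; congr (_ + _).
  rewrite -big_mkcond /= (@big_nat_widen _ _ _ 0 (n.+1 - k.+1) n) /=; last by lia.
  apply: congr_big => // j; last by move=> _; rewrite mulSn subnDA.
  rewrite mulSn; apply/idP/andP => [le_j | [le_j _]]; last by lia.
  by split; [lia | nia].
lia.
Qed.

End Combinatorics.

(** * Elementary inequalities *)

Section Basic.
Context {R : realType}.
Implicit Types x y : R.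

Lemma le_of_derive_ge0 (f df : R -> R) (a b : R) : a <= b ->
    (forall x, a <= x <= b -> is_derive x 1 f (df x)) ->
    (forall x, a < x < b -> 0 <= df x) -> f a <= f b.
Proof.
move=> le_ab fd df0; have [lt_ab|/(conj le_ab)/andP/le_anti->//] := ltP a b.
have [||c c_ab] := @MVT R f df a b lt_ab.
- by move=> x; rewrite in_itv /= => /andP[? ?]; apply: fd; rewrite !ltW.
- apply: derivable_within_continuous => x.
  by rewrite in_itv /= => x_ab; have [] := fd x x_ab.
rewrite -subr_ge0 => ->; rewrite mulr_ge0 ?subr_ge0 // df0 //.
Qed.

(** Integrating cos <= 1 repeatedly from 0 gives this bound and the next three: each is the
    derivative inequality behind the following one. *)
Lemma sin_le x : 0 <= x -> sin x <= x.
Proof.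
move=> x0; rewrite -subr_ge0.
have := @le_of_derive_ge0 (fun x => x - sin x) (fun x => 1 - cos x) 0 x x0.
rewrite sin0 subr0; apply => y.
by move=> _; rewrite subr_ge0 cos_le1.
Qed.

Lemma cos_ge x : 1 - x ^+ 2 / 2 <= cos x.
Proof.
wlog x0 : x / 0 <= x => [H|].
  by case: (leP 0 x) => [/H //|x0]; rewrite -cosN -sqrrN; apply: H; lra.
rewrite -subr_ge0.
have := @le_of_derive_ge0 (fun x => cos x - (1 - x ^+ 2 / 2)) (fun x => x - sin x) 0 x x0.
rewrite cos0 expr0n /= mul0r subr0 subrr; apply => y.
  by move=> _; apply: is_derive_eq; rewrite /GRing.scale /=; field.
by move=> /andP[y0 _]; rewrite subr_ge0 sin_le // ltW.
Qed.

Lemma sin_ge x : 0 <= x -> x - x ^+ 3 / 6 <= sin x.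
Proof.
move=> x0; rewrite -subr_ge0.
have := @le_of_derive_ge0 (fun x => sin x - (x - x ^+ 3 / 6)) (fun x => cos x - (1 - x ^+ 2 / 2)) 0 x x0.
rewrite sin0 expr0n /= mul0r !subr0; apply => y.
  by move=> _; apply: is_derive_eq; rewrite /GRing.scale /=; field.
by move=> _; rewrite subr_ge0 cos_ge.
Qed.

Lemma cos_le x : cos x <= 1 - x ^+ 2 / 2 + x ^+ 4 / 24.
Proof.
wlog x0 : x / 0 <= x => [H|].
  case: (leP 0 x) => [/H //|x0]; have := H (- x); rewrite cosN sqrrN.
  by rewrite (exprM (- x) 2 2) sqrrN -exprM; apply; rewrite oppr_ge0 ltW.
rewrite -subr_ge0.
have := @le_of_derive_ge0 (fun x => 1 - x ^+ 2 / 2 + x ^+ 4 / 24 - cos x) (fun x => sin x - (x - x ^+ 3 / 6)) 0 x x0.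
rewrite cos0 !expr0n /= !mul0r subr0 addr0 subrr; apply => y.
  by move=> _; apply: is_derive_eq; rewrite /GRing.scale /=; field.
by move=> /andP[y0 _]; rewrite subr_ge0 sin_ge // ltW.
Qed.

Lemma sin_ge_mulcos x : 0 <= x <= pi -> x * cos x <= sin x.
Proof.
move=> /andP[x0 xpi]; rewrite -subr_ge0.
have := @le_of_derive_ge0 (fun x => sin x - x * cos x) (fun x => x * sin x) 0 x x0.
rewrite sin0 mul0r subrr; apply => y.
  by move=> _; apply: is_derive_eq; rewrite /GRing.scale /=; ring.
move=> /andP[y0 yx]; rewrite mulr_ge0 ?ltW // sin_gt0_pi // y0.
exact: lt_le_trans xpi.
Qed.

(** By [sin_ge_mulcos] the product cos x e^(x^2 / 2) decreases on [0, pi]. The bound is meant for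
    the high powers of cosines in Polya's sum. *)
Lemma cos_le_expR x : 0 <= x <= pi -> cos x <= expR (- (x ^+ 2 / 2)).
Proof.
move=> /andP[x0 xpi]; rewrite expRN -[leRHS]mul1r ler_pdivlMr ?expR_gt0 //.
have := @le_of_derive_ge0 (fun x => - (cos x * expR (x ^+ 2 / 2)))
  (fun x => (sin x - x * cos x) * expR (x ^+ 2 / 2)) 0 x x0.
rewrite cos0 expr0n /= mul0r expR0 mulr1 lerN2; apply => y.
  by move=> _; apply: is_derive_eq; rewrite /GRing.scale /=; field.
move=> /andP[y0 yx]; rewrite mulr_ge0 ?expR_ge0 // subr_ge0 sin_ge_mulcos //.
by rewrite ltW //= (le_trans (ltW yx)).
Qed.

Lemma norm_sin_le x : `|sin x| <= `|x|.
Proof.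
wlog x0 : x / 0 <= x => [H|].
  by case: (leP 0 x) => [/H //|x0]; rewrite -normrN -(normrN x) -sinN; apply: H; lra.
rewrite (ger0_norm x0); have [xpi|xpi] := leP x pi.
  by rewrite ger0_norm ?sin_le // sin_ge0_pi // x0.
apply: le_trans (ltW xpi); apply: (@le_trans _ _ 1).
  by rewrite ler_norml sin_geN1 sin_le1.
by have := pi_ge2 R; lra.
Qed.

Lemma is_derive_atan x : is_derive x 1 (@atan R) (1 + x ^+ 2)^-1.
Proof. by rewrite -derive1_atan derive1E; apply: derivableP; exact: derivable_atan. Qed.

Lemma atan_bounds x : 0 <= x -> x - x ^+ 3 / 3 <= atan x <= x.
Proof.
move=> x0; have da := is_derive_atan.
have n0 (y : R) : 1 + y ^+ 2 != 0 by rewrite gt_eqF // ltr_wpDr ?sqr_ge0.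
apply/andP; split; rewrite -subr_ge0.
  have := @le_of_derive_ge0 (fun x => atan x - (x - x ^+ 3 / 3)) (fun x => (1 + x ^+ 2)^-1 - (1 - x ^+ 2)) 0 x x0.
  rewrite atan0 expr0n /= mul0r !subr0; apply => y.
    by move=> _; apply: is_derive_eq; rewrite /GRing.scale /=; field.
  move=> _; rewrite subr_ge0 -[leRHS]mul1r ler_pdivlMr; last by nra.
  by nra.
have := @le_of_derive_ge0 (fun x => x - atan x) (fun x => 1 - (1 + x ^+ 2)^-1) 0 x x0.
rewrite atan0 subr0; apply => y.
by move=> _; rewrite subr_ge0 invf_le1; nra.
Qed.

Lemma norm_atan_le x : `|atan x| <= `|x|.
Proof.
wlog x0 : x / 0 <= x => [H|].
  by case: (leP 0 x) => [/H //|x0]; rewrite -normrN -(normrN x) -atanN; apply: H; lra.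
have /andP[_ ?] := atan_bounds x x0; rewrite !ger0_norm //.
by rewrite -atan0; exact: le_atan.
Qed.

Lemma atan_approx x : `|atan x - x| <= `|x| ^+ 3.
Proof.
wlog x0 : x / 0 <= x => [H|].
  case: (leP 0 x) => [/H //|x0]; have := H (- x); rewrite atanN normrN.
  by rewrite -opprD normrN => H'; apply: le_trans (H' _); lra.
have /andP[? ?] := atan_bounds x x0; rewrite (ger0_norm x0).
have : 0 <= x ^+ 3 by rewrite exprn_ge0.
by rewrite ler_norml => ?; lra.
Qed.

Lemma ln1D_bounds y : - 2^-1 <= y -> y - 2 * y ^+ 2 <= ln (1 + y) <= y.
Proof.
move=> y2; rewrite le_ln1Dx ?andbT; last by lra.
have y1 : 0 < 1 + y by lra.
have E : 1 + (- y / (1 + y)) = (1 + y)^-1 by field; rewrite gt_eqF.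
rewrite -[X in ln X]invrK -E lnV; last by rewrite posrE E invr_gt0.
rewrite lerNr; apply: le_trans (le_ln1Dx _ ) _.
  by rewrite ltr_pdivlMr //; lra.
rewrite ler_pdivrMr //; nra.
Qed.

Lemma expRN_le x : - 1 < x -> expR (- x) <= (1 + x)^-1.
Proof.
move=> x1; rewrite expRN lef_pV2 ?posrE ?expR_gt0 //; last by lra.
exact: expR_ge1Dx.
Qed.

Lemma expRN_ge y : y < 1 -> expR (- (y / (1 - y))) <= 1 - y.
Proof.
move=> y1; have y0 : 0 < 1 - y by lra.
have -> : 1 - y = (1 + y / (1 - y))^-1.
  have -> : 1 + y / (1 - y) = (1 - y)^-1 by field; rewrite gt_eqF.
  by rewrite invrK.
rewrite {1}(_ : 1 + y / (1 - y) = (1 - y)^-1) ?invrK; last by field; rewrite gt_eqF.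
apply: expRN_le; rewrite ltr_pdivlMr //; lra.
Qed.

End Basic.

(** * Coefficients as Fourier integrals *)

Section Polar.
Context {R : realType}.
Implicit Types (p a q : R) (m K : nat).

(* 1 - p e^(ia) = dmod p a * e^(- i darg p a), see [polar_sub]. *)
Definition dmod p a : R := Num.sqrt (1 - 2 * p * cos a + p ^+ 2).
Definition darg p a : R := atan (p * sin a / (1 - p * cos a)).

(** For |p| < 1 the number 1 - p e^(ia) stays in the right half-plane, so the arctangent in [darg]
    is its argument up to sign, with no branch correction. *)
Lemma den_gt0 p a : `|p| < 1 -> 0 < 1 - p * cos a.
Proof.
move=> p1; rewrite subr_gt0; apply: le_lt_trans p1.
apply: le_trans (ler_norm _) _; rewrite normrM ler_piMr //.
by rewrite ler_norml cos_geN1 cos_le1.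
Qed.

Lemma dmodE p a : `|p| < 1 ->
  dmod p a = (1 - p * cos a) * Num.sqrt (1 + (p * sin a / (1 - p * cos a)) ^+ 2).
Proof.
move=> p1; have d0 := den_gt0 p a p1.
rewrite -[X in X * _](ger0_norm (ltW d0)) -sqrtr_sqr -sqrtrM ?sqr_ge0 //.
congr Num.sqrt; rewrite mulrDr mulr1 exprMn exprVn mulrCA divff ?mulr1; last first.
  by rewrite expf_neq0 // gt_eqF.
by rewrite [(p * sin a) ^+ 2]exprMn sin2cos2; ring.
Qed.

Lemma dmod_gt0 p a : `|p| < 1 -> 0 < dmod p a.
Proof.
move=> p1; rewrite dmodE // mulr_gt0 ?den_gt0 // sqrtr_gt0.
by rewrite ltr_wpDr ?sqr_ge0.
Qed.

Lemma dmod_cos p a : `|p| < 1 -> dmod p a * cos (darg p a) = 1 - p * cos a.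
Proof.
move=> p1; rewrite dmodE // /darg cos_atan mulfK // gt_eqF // sqrtr_gt0.
by rewrite ltr_wpDr ?sqr_ge0.
Qed.

Lemma dmod_sin p a : `|p| < 1 -> dmod p a * sin (darg p a) = p * sin a.
Proof.
move=> p1; have cn0 : cos (darg p a) != 0.
  rewrite /darg cos_atan invr_eq0 gt_eqF // sqrtr_gt0.
  by rewrite ltr_wpDr ?sqr_ge0.
have tE : tan (darg p a) = p * sin a / (1 - p * cos a) by rewrite /darg atanK.
have -> : sin (darg p a) = tan (darg p a) * cos (darg p a) by rewrite /tan divfK.
by rewrite mulrCA dmod_cos // tE divfK // gt_eqF // den_gt0.
Qed.

(** Real part of e^(iy) (1 - p e^(ia)), computed in Cartesian and in polar form. *)
Lemma polar_sub p a y : `|p| < 1 ->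
  cos y - p * cos (y + a) = dmod p a * cos (y - darg p a).
Proof.
move=> p1; rewrite cosD cosB.
have -> : forall D, D * (cos y * cos (darg p a) + sin y * sin (darg p a))
    = cos y * (D * cos (darg p a)) + sin y * (D * sin (darg p a)) by move=> D; ring.
by rewrite dmod_cos // dmod_sin //; ring.
Qed.

Lemma continuous_dmod p (c : R) : continuous (fun x : R => dmod p (c * x)).
Proof.
move=> x; apply: (@continuous_comp _ _ _
  (fun x => 1 - 2 * p * cos (c * x) + p ^+ 2) Num.sqrt); last exact: sqrt_continuous.
apply: cvgD; last exact: cvg_cst.
apply: cvgB; first exact: cvg_cst.
apply: cvgM; first exact: cvg_cst.
by apply: continuous_comp; [exact: mulrl_continuous | exact: continuous_cos].
Qed.

Lemma continuous_darg p (c : R) : `|p| < 1 -> continuous (fun x : R => darg p (c * x)).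
Proof.
move=> p1 x; apply: (@continuous_comp _ _ _
  (fun x => p * sin (c * x) / (1 - p * cos (c * x))) atan); last exact: continuous_atan.
apply: cvgM.
  apply: cvgM; first exact: cvg_cst.
  by apply: continuous_comp; [exact: mulrl_continuous | exact: continuous_sin].
apply: cvgV; first by rewrite gt_eqF // den_gt0.
apply: cvgB; first exact: cvg_cst.
apply: cvgM; first exact: cvg_cst.
by apply: continuous_comp; [exact: mulrl_continuous | exact: continuous_cos].
Qed.

(* amp * e^(i phase) is the value at q e^(i th) of the generating function
   prod_(k <= m) 2 q^k / (1 - q^k) * prod_(m < k <= K) (1 + q^k) / (1 - q^k)
   of [count_ovp m K]; both are kept real to avoid complex logarithms. *)
Definition amp m q K (th : R) : R :=
  \prod_(k < K) ((if (m <= k)%N then dmod (- q ^+ k.+1) (k.+1%:R * th)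
                  else 2 * q ^+ k.+1) / dmod (q ^+ k.+1) (k.+1%:R * th)).

Definition phase m q K (th : R) : R :=
  \sum_(k < K) (darg (q ^+ k.+1) (k.+1%:R * th)
     + (if (m <= k)%N then - darg (- q ^+ k.+1) (k.+1%:R * th)
        else k.+1%:R * th)).

Lemma qk_lt1 q k : 0 < q < 1 -> `|q ^+ k.+1| < 1.
Proof.
case/andP=> q0 q1; rewrite ger0_norm ?exprn_ge0 ?ltW //.
by rewrite exprn_ilt1 // ltW.
Qed.

Lemma continuous_amp m q K : 0 < q < 1 -> continuous (amp m q K).
Proof.
move=> q01; elim: K => [|k IHk] x.
  rewrite (_ : amp m q 0 = fun=> 1); first exact: cvg_cst.
  by apply/funext => y; rewrite /amp big_ord0.
rewrite (_ : amp m q k.+1 = fun y => amp m q k y * ((if (m <= k)%N then dmod (- q ^+ k.+1) (k.+1%:R * y)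
                  else 2 * q ^+ k.+1) / dmod (q ^+ k.+1) (k.+1%:R * y))); last first.
  by apply/funext => y; rewrite /amp big_ord_recr.
apply: cvgM; first exact: IHk.
apply: cvgM.
  by case: (leqP m k) => _; [exact: continuous_dmod | exact: cvg_cst].
by apply: cvgV; [rewrite gt_eqF // dmod_gt0 // qk_lt1 | exact: continuous_dmod].
Qed.

Lemma continuous_phase m q K : 0 < q < 1 -> continuous (phase m q K).
Proof.
move=> q01; elim: K => [|k IHk] x.
  rewrite (_ : phase m q 0 = fun=> 0); first exact: cvg_cst.
  by apply/funext => y; rewrite /phase big_ord0.
rewrite (_ : phase m q k.+1 = fun y => phase m q k y + (darg (q ^+ k.+1) (k.+1%:R * y)
     + (if (m <= k)%N then - darg (- q ^+ k.+1) (k.+1%:R * y)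
        else k.+1%:R * y))); last first.
  by apply/funext => y; rewrite /phase big_ord_recr.
apply: cvgD; first exact: IHk.
apply: cvgD; first by apply: continuous_darg; exact: qk_lt1.
case: (leqP m k) => _; last exact: mulrl_continuous.
by apply: cvgN; apply: continuous_darg; rewrite normrN; exact: qk_lt1.
Qed.

(** Real part of F(q e^(i th)) e^(- i z th), with F the generating function described at [amp]. The
    index is an integer since the recurrence lowers it below 0. *)
Definition wave m q K (z : int) (th : R) : R :=
  amp m q K th * cos (phase m q K th - z%:~R * th).

Lemma continuous_wave m q K z : 0 < q < 1 -> continuous (wave m q K z).
Proof.
move=> q01 x; apply: cvgM; first exact: continuous_amp.
apply: (continuous_comp (f := fun x => phase m q K x - z%:~R * x)); last exact: continuous_cos.
by apply: cvgB; [exact: continuous_phase | exact: mulrl_continuous].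
Qed.

(** Clearing the denominator 1 - (q e^(i th))^(k+1) of the last factor gives the same functional
    equation as for the counts. Its real part, twisted by e^(- i z th), is expressed through
    [polar_sub]. *)
Lemma wave_rec m q k (z : int) th : 0 < q < 1 ->
  wave m q k.+1 z th = q ^+ k.+1 * wave m q k.+1 (z - k.+1%:Z) th +
    (if (m <= k)%N then wave m q k z th + q ^+ k.+1 * wave m q k (z - k.+1%:Z) th
     else 2 * q ^+ k.+1 * wave m q k (z - k.+1%:Z) th).
Proof.
move=> q01; have p1 := qk_lt1 q k q01.
rewrite /wave /amp /phase !big_ord_recr /= -/(amp m q k th) -/(phase m q k th).
set A := amp _ _ _ _; set P := phase _ _ _ _; set p := q ^+ k.+1.
set a := k.+1%:R * th; set D := dmod p a.
have D0 : D != 0 by rewrite gt_eqF // dmod_gt0.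
rewrite !rmorphB /= -!pmulrn !mulrBl -/a.
set y := z%:~R * th.
case: (leqP m k) => _.
  have := polar_sub p a (P + (darg p a - darg (- p) a) - y) p1.
  have := polar_sub (- p) a (P - y); rewrite normrN => /(_ p1).
  rewrite -/D (_ : P + (darg p a - darg (- p) a) - y - darg p a = P - y - darg (- p) a); last by ring.
  rewrite (_ : P - (y - a) = P - y + a); last by ring.
  rewrite (_ : P + (darg p a - darg (- p) a) - (y - a) = P + (darg p a - darg (- p) a) - y + a); last by ring.
  set c1 := cos (_ + a); set c2 := cos (_ + a); set c3 := cos (P - y - _).
  set c4 := cos (_ - y) => H1 H2.
  have -> : c4 = dmod (- p) a * c3 - p * c1 by rewrite -H1; ring.
  move/eqP: H2; rewrite subr_eq => /eqP ->.
  by field.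
have := polar_sub p a (P + (darg p a + a) - y) p1.
rewrite -/D (_ : P + (darg p a + a) - y - darg p a = P - (y - a)); last by ring.
rewrite (_ : P + (darg p a + a) - (y - a) = P + (darg p a + a) - y + a); last by ring.
move=> /eqP; rewrite subr_eq => /eqP ->.
by field.
Qed.


(** * Fourier coefficients *)

Local Notation mu := (@lebesgue_measure R).

(** The unnormalized Fourier coefficient over one period, in the variable u with th = s u. Building
    the scale in spares a change of variables when u becomes the variable of the limit. *)
Definition coef m q s K (z : int) : R :=
  \int[mu]_(u in `[- (pi / s), pi / s]) wave m q K z (s * u).

Lemma integrable_cont (f : R -> R) (a b : R) : continuous f ->
  mu.-integrable `[a, b] (EFin \o f).
Proof.
move=> cf; apply: continuous_compact_integrable; first exact: segment_compact.
exact: continuous_subspaceT.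
Qed.

Lemma continuous_scale (f : R -> R) (s : R) :
  continuous f -> continuous (fun u => f (s * u)).
Proof.
move=> cf x; apply: (@continuous_comp _ _ _ (fun u => s * u) f); last exact: cf.
exact: mulrl_continuous.
Qed.

Lemma coef_rec m q s k z : 0 < q < 1 ->
  coef m q s k.+1 z = q ^+ k.+1 * coef m q s k.+1 (z - k.+1%:Z) +
    (if (m <= k)%N then coef m q s k z + q ^+ k.+1 * coef m q s k (z - k.+1%:Z)
     else 2 * q ^+ k.+1 * coef m q s k (z - k.+1%:Z)).
Proof.
move=> q01; rewrite /coef.
under eq_Rintegral => u _ do rewrite wave_rec //.
have ci K (z' : int) (c : R) : mu.-integrable `[- (pi / s), pi / s]
    (EFin \o (fun u => c * wave m q K z' (s * u))).
  apply: integrable_cont => x; apply: cvgM; first exact: cvg_cst.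
  exact: (continuous_scale (wave m q K z') s (continuous_wave m q K z' q01)).
have ci1 K (z' : int) : mu.-integrable `[- (pi / s), pi / s]
    (EFin \o (fun u => wave m q K z' (s * u))).
  apply: integrable_cont.
  exact: (continuous_scale (wave m q K z') s (continuous_wave m q K z' q01)).
case: (leqP m k) => _; last by rewrite RintegralD // !RintegralZl.
rewrite RintegralD //.
  by rewrite RintegralD // !RintegralZl.
by apply: (integrableD _ (ci1 _ _) (ci _ _ _)).
Qed.

Lemma sin_intpi (z : int) : sin (z%:~R * pi) = 0 :> R.
Proof.
have sn (n : nat) : sin (n%:R * pi) = 0 :> R.
  elim: n => [|n IHn]; first by rewrite mul0r sin0.
  by rewrite -natr1 mulrDl mul1r sinDpi IHn oppr0.
case: z => n; first by rewrite -pmulrn sn.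
by rewrite NegzE mulrNz mulNr sinN -pmulrn sn oppr0.
Qed.

Lemma coef0 m q s (z : int) : 0 < s -> coef m q s 0 z = (z == 0)%:R * (2 * pi / s).
Proof.
move=> s0; rewrite /coef.
have p0 : 0 < pi / s by rewrite divr_gt0 // pi_gt0.
under eq_Rintegral => u _ do rewrite /wave /amp /phase !big_ord0 mul1r sub0r cosN mulrA.
have [->|z0] := eqVneq z 0.
  under eq_Rintegral => u _ do rewrite mul0r mul0r cos0.
  rewrite Rintegral_cst // mul1r /= lebesgue_measure_itv /= lte_fin.
  rewrite ifT; last by rewrite gtrN.
  by rewrite -EFinD /= opprK mul1r; field; rewrite gt_eqF.
rewrite mul0r; have zs0 : z%:~R * s != 0 by rewrite mulf_neq0 ?intr_eq0 // gt_eqF.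
set c := z%:~R * s in zs0 *.
have dF (u : R) : is_derive u 1 (fun u => c^-1 * sin (c * u)) (cos (c * u)).
  by apply: is_derive_eq; rewrite /GRing.scale /= mulr1; field.
have cF (u : R) : {for u, continuous (fun u => c^-1 * sin (c * u))}.
  by apply/differentiable_continuous/derivable1_diffP; have [] := dF u.
rewrite /Rintegral (@continuous_FTC2 _ _ (fun u => c^-1 * sin (c * u))).
- rewrite /= mulrN sinN /c -(mulrA z%:~R) (mulrC s) divfK ?gt_eqF // sin_intpi.
  by rewrite oppr0 mulr0 subrr.
- by rewrite gtrN.
- apply: continuous_subspaceT; apply: (continuous_scale cos); exact: continuous_cos.
- split; first by move=> u _; have [] := dF u.
    apply: cvg_at_right_filter; exact: cF.
  apply: cvg_at_left_filter; exact: cF.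
- by move=> u _; rewrite derive1E; have [_ ->] := dF u.
Qed.

Lemma coef_bounded m q s K : 0 < q < 1 -> exists B : R, forall z, `|coef m q s K z| <= B.
Proof.
move=> q01;
have ca := continuous_scale _ s (continuous_amp m q K q01).
exists (\int[mu]_(u in `[- (pi / s), pi / s]) `|amp m q K (s * u)|) => z.
have cw := continuous_scale _ s (continuous_wave m q K z q01).
apply: le_trans (le_normr_Rintegral _ (integrable_cont _ _ _ cw)) _ => //.
apply: le_Rintegral => //.
- apply: (integrable_cont (fun u => `|wave m q K z (s * u)|)) => u.
  by apply: cvg_norm; exact: cw.
- apply: (integrable_cont (fun u => `|amp m q K (s * u)|)) => u.
  by apply: cvg_norm; exact: ca.
move=> u _; rewrite normrM ler_piMr // ler_norml cos_geN1; exact: cos_le1.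
Qed.

(** This stands in for analyticity in the disc. At a negative index the terms with bound [k] vanish
    by induction, so iterating the recurrence j times leaves q^((k+1) j) times a coefficient that is
    bounded uniformly in the index. *)
Lemma coef_lt0 m q s K (n : nat) : 0 < q < 1 -> 0 < s -> coef m q s K (Negz n) = 0.
Proof.
move=> q01 s0; elim: K n => [|k IHk] n; first by rewrite coef0 // mul0r.
have [B leB] := coef_bounded m q s k.+1 q01.
have rec j : coef m q s k.+1 (Negz n) = (q ^+ k.+1) ^+ j * coef m q s k.+1 (Negz (n + j * k.+1)).
  elim: j => [|j ->]; first by rewrite mul0n addn0 mul1r.
  rewrite coef_rec // (_ : Negz _ - k.+1%:Z = Negz (n + j.+1 * k.+1)); last by lia.
  by rewrite !IHk !mulr0 addr0 if_same addr0 mulrA -exprSr.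
have qc : (fun j => (q ^+ k.+1) ^+ j * B) @ \oo --> (0 : R).
  rewrite -(mul0r B); apply: cvgMl; apply: cvg_expr; exact: qk_lt1.
apply/eqP; rewrite -normr_le0.
apply: (ler_cvg_to (cvg_cst `|coef m q s k.+1 (Negz n)|) qc); apply: nearW => j.
rewrite (rec j) normrM ger0_norm ?exprn_ge0 ?(ltW (proj1 (andP q01))) //.
by rewrite ler_wpM2l ?exprn_ge0 ?(ltW (proj1 (andP q01))).
Qed.

(** Both sides obey the same recurrence, by [coef_rec] and [count_ovpS_ge]. For n < K the shifted
    index is negative, and [coef_lt0] gives the boundary case. *)
Lemma coef_count_ovp m q s K (n : nat) : 0 < q < 1 -> 0 < s ->
  coef m q s K n = 2 * pi / s * ((count_ovp m K n)%:R * q ^+ n).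
Proof.
move=> q01 s0; elim: K n => [|k IHk] n.
  rewrite coef0 // /= eqz_nat; case: eqP => [->|_]; last by rewrite !mul0r mulr0.
  by rewrite expr0 mulr1 mulrC.
elim/ltn_ind: n => n IHn; rewrite coef_rec //.
have [lt_n|le_n] := ltnP n k.+1.
  have -> : n%:Z - k.+1%:Z = Negz (k - n) by lia.
  rewrite !coef_lt0 // !mulr0 add0r addr0 count_ovpS_lt //.
  by case: (m <= k)%N; rewrite ?mul1n ?mul0n ?IHk ?mul0r ?mulr0.
have -> : n%:Z - k.+1%:Z = (n - k.+1)%N%:Z by lia.
rewrite IHn; last by lia.
rewrite !IHk -[in RHS](subnK le_n) exprD.
have := count_ovpS_ge m k n le_n; rewrite subnK //.
have qn : q ^+ n = q ^+ (n - k.+1) * q ^+ k.+1 by rewrite -exprD subnK.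
rewrite qn.
move: (count_ovp m k.+1 n) (count_ovp m k.+1 (n - k.+1)) (count_ovp m k n) (count_ovp m k (n - k.+1)).
move=> A B C D /(congr1 (fun x => x%:R : R)); rewrite !natrD !natrM.
case: (m <= k)%N => /= H.
  have -> : A%:R = B%:R + C%:R + D%:R :> R by lra.
  by ring.
have -> : A%:R = B%:R + 2 * D%:R :> R by lra.
by ring.
Qed.

End Polar.

(** * Gauss's identity and Polya's filter *)

Section Theta.
Context {R : realType}.
Implicit Types (q t x y : R) (m n l : nat).

Definition Pb q n : R := \prod_(k < n) ((1 - q ^+ k.+1) / (1 + q ^+ k.+1)).

Definition theta q n : R := 1 + 2 * \sum_(s < n) (-1) ^+ s.+1 * q ^+ (s.+1 ^ 2).

Lemma PbS q n : Pb q n.+1 = Pb q n * ((1 - q ^+ n.+1) / (1 + q ^+ n.+1)).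
Proof. by rewrite /Pb big_ord_recr. Qed.

Lemma qn_lt1 q n : 0 < q < 1 -> q ^+ n.+1 < 1.
Proof. by case/andP => q0 q1; rewrite exprn_ilt1 // ltW. Qed.

Lemma Pb_gt0 q n : 0 < q < 1 -> 0 < Pb q n.
Proof.
move=> q01; apply: prodr_gt0 => k _; have := qn_lt1 q k q01.
have : 0 < q ^+ k.+1 by case/andP: q01 => q0 _; rewrite exprn_gt0.
by move=> ? ?; rewrite divr_gt0 //; lra.
Qed.

Lemma Pb_factor_le1 q n : 0 < q < 1 -> 0 < (1 - q ^+ n.+1) / (1 + q ^+ n.+1) <= 1.
Proof.
move=> q01; have := qn_lt1 q n q01.
have : 0 < q ^+ n.+1 by case/andP: q01 => q0 _; rewrite exprn_gt0.
move=> ? ?; rewrite divr_gt0 ?ler_pdivrMr //; lra.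
Qed.

Lemma le_Pb q n n' : 0 < q < 1 -> (n <= n')%N -> Pb q n' <= Pb q n.
Proof.
move=> q01 /subnK <-; elim: (n' - n)%N => // j IHj.
rewrite addSn PbS; apply: le_trans IHj; have /andP[? ?] := Pb_factor_le1 q (j + n) q01.
by rewrite ler_piMr // ltW // Pb_gt0.
Qed.

(* A finite form of Gauss's identity sum (-1)^j q^(j^2) = prod (1-q^k)/(1+q^k). *)
Lemma gauss_finite q n : 0 < q < 1 ->
  theta q n = \sum_(0 <= s < n.+1)
    (-1) ^+ s * (2 / (1 + q ^+ s)) * (Pb q n / Pb q s) * q ^+ (s * n.+1).
Proof.
move=> q01; elim: n => [|n IHn].
  rewrite /theta big_ord0 big_nat1 mulr0 addr0 /Pb !big_ord0 !expr0; by field.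
have P0 s : Pb q s != 0 by rewrite gt_eqF // Pb_gt0.
have q0 s : 0 < q ^+ s by case/andP: q01 => ? _; rewrite exprn_gt0.
have q1 s : 1 + q ^+ s != 0 by rewrite gt_eqF // addr_gt0.
(* A telescoping certificate: from n to n + 1, the s-th summand changes by exactly [U s.+1 - U s], a
   rational identity in the powers of q. Since [U 0] vanishes, the total change comes from the upper
   end. *)
pose U s := (-1) ^+ s * 2 * Pb q n / (1 + q ^+ n.+1) * q ^+ (s * n.+1) / Pb q s
   * ((1 - q ^+ s) / (1 + q ^+ s)).
have telU s : (-1) ^+ s * (2 / (1 + q ^+ s)) * (Pb q n.+1 / Pb q s) * q ^+ (s * n.+2)
   - (-1) ^+ s * (2 / (1 + q ^+ s)) * (Pb q n / Pb q s) * q ^+ (s * n.+1) = U s.+1 - U s.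
  rewrite /U !PbS mulSn exprD (mulnS s n.+1) exprD (exprS (-1) s).
  have : 1 - q ^+ s.+1 != 0 by have := qn_lt1 q s q01; rewrite subr_eq0 eq_sym => /lt_eqF ->.
  have := q1 s; have := q1 s.+1; have := q1 n.+1; have := P0 s; have := P0 n.
  move: (q ^+ s.+1) (q ^+ n.+1) (Pb q s) (Pb q n) (q ^+ (s * n.+1)) => a b c d e.
  move: (q ^+ s) ((-1) ^+ s) => f g *; field.
  by do ! [apply/andP; split].
rewrite big_nat_recr //=.
have -> : \sum_(0 <= s < n.+1) (-1) ^+ s * (2 / (1 + q ^+ s)) * (Pb q n.+1 / Pb q s) * q ^+ (s * n.+2)
  = theta q n + (U n.+1 - U 0%N).
  rewrite IHn -(telescope_sumr U (leq0n n.+1)) -big_split /=.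
  by apply: eq_bigr => s _; rewrite -telU addrC subrK.
rewrite /theta big_ord_recr /= /U expr0 subrr mul0r mulr0 subr0.
rewrite divff // (_ : (n.+1 ^ 2 = n.+1 * n.+1)%N) // (mulnS n.+1 n.+1) exprD !PbS.
have : 1 - q ^+ n.+1 != 0 by have := qn_lt1 q n q01; rewrite subr_eq0 eq_sym => /lt_eqF ->.
have := q1 n.+1; have := P0 n.
move: (q ^+ n.+1) (Pb q n) ((-1) ^+ n.+1) (q ^+ (n.+1 * n.+1)) (\sum_(_ < n) _) => a b c d e *.
field.
by do ! [apply/andP; split].
Qed.

(** The summand s = 0 of [gauss_finite] is exactly [Pb q n], and each of the n others is at most 2
    q^n in absolute value. *)
Lemma theta_Pb q n : 0 < q < 1 -> `|theta q n - Pb q n| <= 2 * n%:R * q ^+ n.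
Proof.
move=> q01; rewrite gauss_finite // big_nat_recl // mul0n !expr0.
have -> : 1 * (2 / (1 + 1)) * (Pb q n / Pb q 0) * 1 = Pb q n.
  by rewrite /Pb big_ord0; field.
rewrite addrC addKr; apply: le_trans (ler_norm_sum _ _ _) _.
have -> : 2 * n%:R * q ^+ n = \sum_(0 <= s < n) 2 * q ^+ n.
  by rewrite sumr_const_nat subn0 -mulr_natr; ring.
apply: ler_sum_nat => s /andP[_ lt_s].
have q0 j : 0 < q ^+ j by case/andP: q01 => ? _; rewrite exprn_gt0.
rewrite !normrM normrX normrN1 expr1n mul1r normfV.
rewrite (ger0_norm (ltW (q0 _))) (@ger0_norm _ 2) //.
rewrite normfV !(ger0_norm (ltW (Pb_gt0 q _ q01))).
rewrite ger0_norm; last by have := q0 s.+1; lra.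
rewrite -mulrA; apply: ler_pM.
- by rewrite divr_ge0 // addr_ge0 // ltW.
- by rewrite mulr_ge0 ?divr_ge0 // ltW // Pb_gt0.
- by rewrite ler_pdivrMr; have := q0 s.+1; lra.
rewrite -[leRHS]mul1r; apply: ler_pM.
- by rewrite divr_ge0 // ltW // Pb_gt0.
- exact: ltW.
- by rewrite ler_pdivrMr ?Pb_gt0 // mul1r le_Pb.
case/andP: q01 => ? ?; rewrite ler_wiXn2l ?ltW //; nia.
Qed.


(** Real part of (e^(ix) + e^(-ix))^N e^(iy) expanded by the binomial theorem. The free angle y is
    what the induction needs: a factor 2 cos x turns it into y + x and y - x, and Pascal's rule
    recombines the two sums. *)
Lemma cos_pow N x y : (2 * cos x) ^+ N * cos y
  = \sum_(j < N.+1) 'C(N, j)%:R * cos (y + (N%:R - 2 * j%:R) * x).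
Proof.
elim: N y => [|N IHN] y.
  rewrite big_ord_recl big_ord0 /= expr0 bin0 !mul1r addr0.
  by congr cos; ring.
rewrite exprS -mulrA (mulrC _ (cos y)) mulrA.
have -> : 2 * cos x * cos y = cos (y + x) + cos (y - x) by rewrite cosD cosB; ring.
rewrite mulrC mulrDr !IHN.
pose g i := cos (y + (N.+1%:R - 2 * i%:R) * x).
rewrite (eq_bigr (fun j : 'I_N.+1 => 'C(N, j)%:R * g j)); last first.
  by move=> j _; congr (_ * cos _); rewrite -natr1; ring.
rewrite [X in _ + X](eq_bigr (fun j : 'I_N.+1 => 'C(N, j)%:R * g j.+1)); last first.
  by move=> j _; congr (_ * cos _); rewrite -!natr1; ring.
rewrite [RHS]big_ord_recl /= bin0.
under [X in _ = _ + X]eq_bigr => j _ do rewrite /bump /= add1n binS natrD mulrDl.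
rewrite big_split /= addrA; congr (_ + _).
rewrite big_ord_recl big_ord_recr /= bin0 bin_small // mul0r addr0.
by congr (_ + _); apply: eq_bigr => j _; rewrite /bump add1n.
Qed.

Lemma sum_sym m (f : nat -> R) :
    (forall d, (d <= m)%N -> f (m - d)%N = f (m + d)%N) ->
  \sum_(j < (2 * m).+1) f j = f m + 2 * \sum_(d < m) f (m + d.+1)%N.
Proof.
move=> fs; have -> : ((2 * m).+1 = m + m.+1)%N by lia.
rewrite big_split_ord /= (reindex_inj rev_ord_inj) /=.
rewrite big_ord_recl /= addn0.
have -> : \sum_(j < m) f (m - j.+1)%N = \sum_(d < m) f (m + d.+1)%N.
  by apply: eq_bigr => j _; rewrite fs.
under [X in _ + (_ + X)]eq_bigr => j _ do rewrite /bump add1n.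
by ring.
Qed.

Lemma sin_intpi_gt0 l (r : nat) : (0 < r < l)%N -> 0 < sin (r%:R * pi / l%:R) :> R.
Proof.
move=> /andP[r0 rl]; have l0 : 0 < l%:R :> R by rewrite ltr0n; lia.
apply: sin_gt0_pi; apply/andP; split.
  by rewrite divr_gt0 // mulr_gt0 ?ltr0n ?pi_gt0.
by rewrite ltr_pdivrMr // mulrC ltr_pM2l ?pi_gt0 // ltr_nat.
Qed.

Lemma sin_Dnpi n x : sin (x + n%:R * pi) = (-1) ^+ n * sin x :> R.
Proof.
elim: n => [|n IHn]; first by rewrite mul0r addr0 mul1r.
by rewrite -natr1 mulrDl mul1r addrA sinDpi IHn exprS mulN1r mulNr.
Qed.

Lemma cos_npi n : cos (n%:R * pi) = (-1) ^+ n :> R.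
Proof.
elim: n => [|n IHn]; first by rewrite mul0r cos0.
by rewrite -natr1 mulrDl mul1r cosDpi IHn exprS mulN1r.
Qed.

(** Multiplication by 2 sin(d pi / l), nonzero unless l divides d, makes the sum telescope to sin(2
    pi d) = 0. When l divides d, the odd multiples of pi make all the terms equal to (-1)^(d /
    l). *)
Lemma sum_cos_roots l d : (0 < l)%N ->
  \sum_(k < l) cos (d%:R * (pi * k.*2.+1%:R / l%:R))
    = (if (l %| d)%N then (-1) ^+ (d %/ l) * l%:R else 0) :> R.
Proof.
move=> l0; have ln0 : l%:R != 0 :> R by rewrite pnatr_eq0; lia.
case: (boolP (l %| d)%N) => [/dvdnP[v ->]|ld].
  rewrite mulnK // (eq_bigr (fun=> (-1) ^+ v)); last first.
    move=> k _; rewrite (_ : _ * _ = (v * k.*2.+1)%:R * pi); last first.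
      by rewrite !natrM; field.
    by rewrite cos_npi -signr_odd oddM /= odd_double andbT signr_odd.
  by rewrite sumr_const card_ord mulr_natr.
pose r := (d %% l)%N.
have s0 : sin (d%:R * pi / l%:R) != 0 :> R.
  rewrite {1}(divn_eq d l) natrD natrM.
  rewrite (_ : (_ + _) * _ / _ = r%:R * pi / l%:R + (d %/ l)%:R * pi); last by rewrite /r; field.
  rewrite sin_Dnpi mulf_neq0 ?signr_eq0 // gt_eqF // sin_intpi_gt0 //.
  by rewrite ltn_mod l0 andbT lt0n.
apply: (mulfI (mulf_neq0 (_ : 2 != 0 :> R) s0)); first by rewrite pnatr_eq0.
rewrite mulr0 mulr_sumr.
rewrite (eq_bigr (fun k : 'I_l => sin (k.+1%:R * (2 * (d%:R * pi / l%:R)))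
   - sin (k%:R * (2 * (d%:R * pi / l%:R))))); last first.
  move=> k _; set z := d%:R * pi / l%:R.
  rewrite (_ : k.+1%:R * (2 * z) = d%:R * (pi * k.*2.+1%:R / l%:R) + z); last first.
    by rewrite /z -!natr1 -mul2n natrM; field.
  rewrite (_ : k%:R * (2 * z) = d%:R * (pi * k.*2.+1%:R / l%:R) - z); last first.
    by rewrite /z -!natr1 -mul2n natrM; field.
  by rewrite sinD sinB; ring.
rewrite -(big_mkord xpredT (fun k => sin (k.+1%:R * (2 * (d%:R * pi / l%:R)))
   - sin (k%:R * (2 * (d%:R * pi / l%:R))))) telescope_sumr // mul0r sin0 subr0.
rewrite (_ : _ * _ = 0 + (d.*2)%:R * pi); last first.
  by rewrite -mul2n natrM; field.
by rewrite sin_Dnpi sin0 mulr0.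
Qed.

Lemma sum_multiples l m (f : nat -> R) : (0 < l)%N ->
  \sum_(d < m) (if (l %| d.+1)%N then f d.+1 else 0) = \sum_(v < m %/ l) f (v.+1 * l)%N.
Proof.
move=> l0; elim: m => [|m IHm]; first by rewrite div0n !big_ord0.
rewrite big_ord_recr /= IHm divnS //; case: (boolP (l %| m.+1)%N) => lm; last first.
  by rewrite addr0 add0n.
rewrite add1n big_ord_recr /=; congr (_ + f _).
by rewrite -{1}(divnK lm) divnS // lm add1n.
Qed.

Lemma cos_pow_even m x : (2 * cos x) ^+ (2 * m) = 'C(2 * m, m)%:R
  + 2 * \sum_(d < m) 'C(2 * m, m + d.+1)%:R * cos (d.+1%:R * (2 * x)).
Proof.
have := cos_pow (2 * m) x 0; rewrite cos0 mulr1 => ->.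
rewrite (sum_sym m (fun j => 'C(2 * m, j)%:R * cos (0 + ((2 * m)%:R - 2 * j%:R) * x))).
  rewrite natrM subrr mul0r addr0 cos0 mulr1; congr (_ + 2 * _).
  by apply: eq_bigr => d _; rewrite -cosN natrD; congr (_ * cos _); ring.
move=> d le_d; rewrite -[in RHS]bin_sub; last by lia.
rewrite (_ : (2 * m - (m + d) = m - d)%N); last by lia.
congr (_ * _).
by rewrite -cosN natrB // natrD natrM; congr cos; ring.
Qed.

(* Filtering the binomial theorem at the odd multiples of pi / (2 l) keeps one coefficient out of l, with alternating signs. *)
Lemma polya_filter l m : (0 < l)%N ->
  \sum_(k < l) (2 * cos (pi * k.*2.+1%:R / (2 * l%:R))) ^+ (2 * m)
  = l%:R * ('C(2 * m, m)%:R
      + 2 * \sum_(v < m %/ l) (-1) ^+ v.+1 * 'C(2 * m, m + v.+1 * l)%:R) :> R.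
Proof.
move=> l0; have ln0 : l%:R != 0 :> R by rewrite pnatr_eq0; lia.
under eq_bigr => k _ do rewrite cos_pow_even.
rewrite big_split /= sumr_const card_ord mulrDr; congr (_ + _).
  by rewrite mulr_natl.
rewrite -mulr_sumr exchange_big /= mulrCA; congr (_ * _).
under eq_bigr => d _.
  rewrite -mulr_sumr (eq_bigr (fun k : 'I_l => cos (d.+1%:R * (pi * k.*2.+1%:R / l%:R)))).
    rewrite sum_cos_roots // fun_if mulr0; over.
  by move=> k _; congr cos; field.
rewrite (sum_multiples l m (fun d => 'C(2 * m, m + d)%:R * ((-1) ^+ (d %/ l) * l%:R))) //.
rewrite mulr_sumr; apply: eq_bigr => v _.
by rewrite mulnK //; ring.
Qed.

End Theta.

(** * Dominated convergence and Riemann sums *)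

Section Riemann.
Context {R : realType}.
Local Notation mu := (@lebesgue_measure R).

Lemma integrable_oneDsqrV (c : R) :
  mu.-integrable [set: R] (EFin \o (fun x : R => c / (1 + x ^+ 2))).
Proof.
have mo : measurable_fun [set: R] (fun x : R => (oneDsqr x)^-1).
  by apply: continuous_measurable_fun; exact: continuous_oneDsqrV.
rewrite (_ : EFin \o _ = (fun x => c%:E * (EFin \o (fun x : R => ((oneDsqr x)^-1)%R)) x)%E) //.
have oV0 (x : R) : 0 <= (oneDsqr x)^-1.
  by rewrite invr_ge0 (le_trans _ (oneDsqr_ge1 x)).
apply: integrableZl => //; apply/integrableP; split; first exact/measurable_EFinP.
under eq_integral => x _ do rewrite /= ger0_norm ?oV0 //.
rewrite ge0_symfun_integralT.
- rewrite (_ : [set x : R | 0 <= x] = `[0, +oo[%classic); last first.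
    by apply/seteqP; split => x /=; rewrite in_itv /= andbT.
  by rewrite integral0y_oneDsqr -EFinM ltry.
- exact: oV0.
- exact: continuous_oneDsqrV.
- by move=> x; rewrite /= /oneDsqr sqrrN.
Qed.

Lemma Rintegral_dominated (f : nat -> R -> R) (g : R -> R) (c : R) :
    (forall n, measurable_fun setT (f n)) ->
    (forall x, f ^~ x @ \oo --> g x) ->
    (forall n x, `|f n x| <= c / (1 + x ^+ 2)) ->
  (fun n => \int[mu]_x f n x) @ \oo --> \int[mu]_x g x.
Proof.
move=> mf fg f_le.
have mg : measurable_fun setT g.
  by apply: (measurable_fun_cvg (fun n => mf n)) => x _; exact: fg.
have [] := @dominated_convergence _ _ _ mu setT measurableT
   (fun n => EFin \o f n) (EFin \o g) (EFin \o (fun x : R => c / (1 + x ^+ 2))).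
- by move=> n; apply/measurable_EFinP; exact: mf.
- exact/measurable_EFinP.
- by apply: aeW => x _; apply: cvg_EFin; [exact: nearW | exact: fg].
- exact: integrable_oneDsqrV.
- by apply: aeW => x n _; rewrite /= lee_fin.
move=> ig _ cv; apply: fine_cvg.
rewrite /Rintegral fineK //; exact: integrable_fin_num ig.
Qed.

(** Makes a Riemann sum the integral of a function on the line, so that its limit is a case of
    dominated convergence. With half-open cells, [Num.truncn (x / h)] is the index of the cell that
    contains x >= 0. *)
Definition step (h : R) (a : nat -> R) N (x : R) : R :=
  \sum_(j < N) a j * \1_(`[j%:R * h, j.+1%:R * h[%classic) x.

Lemma integrable_scale_indic (c a b : R) :
  mu.-integrable setT (EFin \o (fun x : R => c * \1_(`[a, b[%classic) x)).
Proof.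
rewrite (_ : EFin \o _ = (fun x => c%:E * (EFin \o \1_(`[a, b[%classic)) x)%E) //.
by apply: integrableZl => //; exact: integrable_indic_itv.
Qed.

Lemma integrable_step h a N : mu.-integrable setT (EFin \o step h a N).
Proof.
elim: N => [|N IHN].
  rewrite (_ : step h a 0 = cst 0); last by apply/funext => x; rewrite /step big_ord0.
  exact: integrable0.
rewrite (_ : EFin \o step h a N.+1 = (EFin \o step h a N)
   \+ (EFin \o (fun x => (a N * \1_(`[N%:R * h, N.+1%:R * h[%classic) x)%R)))%E; last first.
  by apply/funext => x; rewrite /= /step big_ord_recr /= EFinD.
apply: integrableD => //.
exact: integrable_scale_indic.
Qed.

Lemma Rintegral_step h a N : 0 < h ->
  \int[mu]_x step h a N x = h * \sum_(j < N) a j.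
Proof.
move=> h0; elim: N => [|N IHN].
  under eq_Rintegral => x _ do rewrite /step big_ord0.
  by rewrite big_ord0 mulr0 Rintegral_cst // mul0r.
under eq_Rintegral => x _ do rewrite /step big_ord_recr /=.
rewrite RintegralD //.
- rewrite IHN big_ord_recr mulrDr; congr (_ + _).
  rewrite RintegralZl //; last exact: integrable_indic_itv.
  rewrite /Rintegral integral_indic // setIT.
  rewrite [X in fine X](lebesgue_measure_itv `[N%:R * h, N.+1%:R * h[) /= lte_fin.
  rewrite ltr_pM2r // ltr_nat leqnn /= -mulrBl -natrB // subSnn.
  by rewrite mul1r mulrC.
- exact: integrable_step.
- exact: integrable_scale_indic.
Qed.

Lemma stepE h a N x : 0 < h ->
  step h a N x = if (0 <= x) && (Num.truncn (x / h) < N)%N then a (Num.truncn (x / h)) else 0.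
Proof.
move=> h0; rewrite /step.
have mem (j : nat) : x \in `[j%:R * h, j.+1%:R * h[%classic = (0 <= x) && (Num.truncn (x / h) == j).
  rewrite mem_setE in_itv /=; have [x0|x0] /= := leP 0 x.
    by rewrite truncn_eq ?divr_ge0 ?(ltW h0) // ler_pdivlMr // ltr_pdivrMr.
  by apply/negbTE; rewrite negb_and -ltNge (lt_le_trans x0) // mulr_ge0 // ltW.
case: (leP 0 x) mem => x0 mem; last first.
  by rewrite big1 // => j _; rewrite indicE mem mulr0.
under eq_bigr => j _ do rewrite indicE mem /=.
case: ltnP => /= [lt_N|le_N].
  rewrite (bigD1 (Ordinal lt_N)) //= eqxx mulr1 big1 ?addr0 // => j.
  by rewrite -val_eqE /= eq_sym => /negbTE ->; rewrite mulr0.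
rewrite big1 // => j _; case: eqP => [E|]; last by rewrite mulr0.
by move: (ltn_ord j); rewrite -E ltnNge le_N.
Qed.

Lemma Rintegral_gauss : \int[mu]_x (expR (- x ^+ 2)) = Num.sqrt pi :> R.
Proof. by rewrite /Rintegral integralT_gauss. Qed.

Lemma Rintegral_half_gauss :
  \int[mu]_x (if 0 <= x then expR (- x ^+ 2) else 0) = Num.sqrt pi / 2 :> R.
Proof.
rewrite /Rintegral.
rewrite (@eq_integral _ _ _ mu setT ((fun x : R => (gauss_fun x)%:E) \_ `[0%R, +oo[)).
  by rewrite -integral_mkcond integral0y_gauss.
move=> x _; rewrite patchE mem_setE in_itv /= andbT.
by case: ifP.
Qed.

(* Riemann sums of step h_n, with the summand allowed to depend on n. *)
Lemma riemann_gauss (h : nat -> R) (N : nat -> nat) (a : nat -> nat -> R) (C : R) :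
    0 <= C -> (forall n, 0 < h n <= 1) ->
    (forall n j, (j < N n)%N -> `|a n j| <= C / (1 + (h n * j%:R) ^+ 2)) ->
    (forall x, 0 <= x -> (fun n => if (Num.truncn (x / h n) < N n)%N
        then a n (Num.truncn (x / h n)) else 0) @ \oo --> expR (- x ^+ 2)) ->
  (fun n => h n * \sum_(j < N n) a n j) @ \oo --> Num.sqrt pi / 2.
Proof.
move=> C0 h01 a_le a_cvg; rewrite -Rintegral_half_gauss.
have h0 n : 0 < h n by case/andP: (h01 n).
under eq_fun => n do rewrite -Rintegral_step //.
(* The factor 3 pays for moving from the grid point y to x: y <= x <= y + 1 because [h n <= 1], and
   1 + (y + 1)^2 <= 3 (1 + y^2). *)
apply: (Rintegral_dominated (fun n => step (h n) (a n) (N n)) _ (3 * C)).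
- by move=> n; have /integrableP[/measurable_EFinP] := integrable_step (h n) (a n) (N n).
- move=> x; under eq_fun => n do rewrite stepE //.
  by case: (leP 0 x) => [x0|_] /=; [exact: a_cvg | exact: cvg_cst].
move=> n x; rewrite stepE //; case: ifP => [/andP[x0 lt_N]|_]; last first.
  by rewrite normr0 divr_ge0 ?mulr_ge0 // addr_ge0 // sqr_ge0.
apply: le_trans (a_le n _ lt_N) _.
have := @truncn_itv _ (x / h n); rewrite divr_ge0 ?(ltW (h0 n)) // => /(_ isT).
rewrite ler_pdivlMr // ltr_pdivrMr // -natr1.
case/andP: (h01 n) => _ h1; move: (Num.truncn _)%:R => j /andP[j1 j2].
have hj : 0 < 1 + (h n * j) ^+ 2 by rewrite ltr_wpDr ?sqr_ge0.
have hx : 0 < 1 + x ^+ 2 by rewrite ltr_wpDr ?sqr_ge0.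
rewrite ler_pdivrMr // mulrAC ler_pdivlMr // [3 * C]mulrC -mulrA ler_wpM2l //.
have h00 := h0 n; move: (h n * j) (mulrC j (h n)) => y yE; rewrite yE in j1.
rewrite mulrDl mul1r yE in j2.
have : x ^+ 2 <= (y + 1) ^+ 2 by rewrite lerXn2r ?nnegrE //; lra.
have := sqr_ge0 (y - 1); nra.
Qed.

End Riemann.

(** * Central binomial coefficients *)

Section Wallis.
Context {R : realType}.
Implicit Types (x y t : R) (m d l : nat).

Lemma cvg_expR (u : nat -> R) x : u @ \oo --> x ->
  (fun n => expR (u n)) @ \oo --> expR x.
Proof. by move=> ux; apply: continuous_cvg => //; exact: continuous_expR. Qed.

Definition cb m d : R := 'C(2 * m, m + d)%:R / 'C(2 * m, m)%:R.

Lemma bin_mid_gt0 m : 0 < 'C(2 * m, m)%:R :> R.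
Proof. by rewrite ltr0n bin_gt0; lia. Qed.

Lemma cb0 m : cb m 0 = 1.
Proof. by rewrite /cb addn0 divff // gt_eqF // bin_mid_gt0. Qed.

Lemma cb_ge0 m d : 0 <= cb m d.
Proof. by rewrite divr_ge0. Qed.

Lemma cbS m d : (d <= m)%N -> cb m d.+1 = cb m d * ((m%:R - d%:R) / (m%:R + d%:R + 1)).
Proof.
move=> le_d; have b0 := bin_mid_gt0 m.
have e : (m + d).+1%:R = m%:R + d%:R + 1 :> R by rewrite -natr1 natrD.
have e0 : m%:R + d%:R + 1 != 0 :> R by rewrite -e pnatr_eq0.
have := mul_bin_left (2 * m) (m + d); rewrite (_ : (2 * m - (m + d) = m - d)%N); last by lia.
move=> /(congr1 (fun i : nat => i%:R : R)); rewrite !natrM natrB // e => H.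
rewrite /cb addnS; apply: (mulfI e0); rewrite mulrA H.
by field; rewrite e0 gt_eqF.
Qed.

Lemma cbS_le m d : (d <= m)%N -> cb m d.+1 <= cb m d.
Proof.
move=> le_d; rewrite cbS // ler_piMr ?cb_ge0 // ler_pdivrMr; last by rewrite ltr_wpDl // addr_ge0.
by have : 0 <= d%:R :> R by []; lra.
Qed.

(** Consecutive ratios are 1 - (2 j + 1) / (m + j + 1), at most e^(- (2 j + 1) / (m + d)) for j < d,
    and the odd numbers 2 j + 1 sum to d^2. *)
Lemma cb_upper m d : (0 < m)%N -> (d <= m)%N -> cb m d <= expR (- (d%:R ^+ 2 / (m%:R + d%:R))).
Proof.
move=> m0 le_d.
have M0 : 0 < m%:R + d%:R :> R by rewrite ltr_wpDr // ltr0n.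
suff H j : (j <= d)%N -> cb m j <= expR (- (j%:R ^+ 2 / (m%:R + d%:R))) by exact: H.
elim: j => [|j IHj] le_j; first by rewrite cb0 expr0n mul0r oppr0 expR0.
rewrite cbS; last by lia.
have -> : - (j.+1%:R ^+ 2 / (m%:R + d%:R)) = - (j%:R ^+ 2 / (m%:R + d%:R))
    + (- ((2 * j%:R + 1) / (m%:R + d%:R))) :> R by rewrite -natr1; field; rewrite gt_eqF.
have jm : j%:R <= m%:R :> R by rewrite ler_nat; lia.
have jd : j%:R + 1 <= d%:R :> R by rewrite natr1 ler_nat.
have j0 : 0 <= j%:R :> R by [].
have m1 : 1 <= m%:R :> R by rewrite ler1n.
rewrite expRD; apply: ler_pM => //; rewrite ?cb_ge0 ?IHj //; try lia.
  by rewrite divr_ge0 // ?subr_ge0 // !addr_ge0.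
apply: le_trans (expR_ge1Dx _).
have -> : (m%:R - j%:R) / (m%:R + j%:R + 1) = 1 - (2 * j%:R + 1) / (m%:R + j%:R + 1) :> R.
  by field; rewrite gt_eqF //; lra.
rewrite lerD2l lerN2 ler_wpM2l //.
by rewrite lef_pV2 ?posrE //; lra.
Qed.

(** The inverse ratios are 1 + (2 j + 1) / (m - j), at most e^((2 j + 1) / (m - d)). Both exponents
    tend to - x^2 when d / sqrt m tends to x. *)
Lemma cb_lower m d : (d < m)%N -> expR (- (d%:R ^+ 2 / (m%:R - d%:R))) <= cb m d.
Proof.
move=> lt_d.
have M0 : 0 < m%:R - d%:R :> R by rewrite subr_gt0 ltr_nat.
suff H j : (j <= d)%N -> expR (- (j%:R ^+ 2 / (m%:R - d%:R))) <= cb m j by exact: H.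
elim: j => [|j IHj] le_j; first by rewrite cb0 expr0n mul0r oppr0 expR0.
rewrite cbS; last by lia.
have -> : - (j.+1%:R ^+ 2 / (m%:R - d%:R)) = - (j%:R ^+ 2 / (m%:R - d%:R))
    + (- ((2 * j%:R + 1) / (m%:R - d%:R))) :> R by rewrite -natr1; field; rewrite gt_eqF.
have jd : j%:R + 1 <= d%:R :> R by rewrite natr1 ler_nat.
have dm : d%:R + 1 <= m%:R :> R by rewrite natr1 ler_nat.
have j0 : 0 <= j%:R :> R by [].
have mj : 0 < m%:R - j%:R :> R by lra.
rewrite expRD; apply: ler_pM; rewrite ?expR_ge0 ?IHj //; try lia.
have mj1 : 0 < m%:R + j%:R + 1 :> R by lra.
have mjj : 0 < (m%:R - j%:R) / (m%:R + j%:R + 1) :> R by rewrite divr_gt0.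
rewrite -[leRHS]invrK expRN lef_pV2 ?posrE ?expR_gt0 ?invr_gt0 //.
rewrite invf_div; apply: (@le_trans _ _ (expR ((2 * j%:R + 1) / (m%:R - j%:R)))).
  apply: le_trans (expR_ge1Dx _).
  by rewrite ler_pdivrMr // mulrDl mul1r divfK ?gt_eqF //; lra.
rewrite ler_expR ler_wpM2l //.
by rewrite lef_pV2 ?posrE //; lra.
Qed.

Lemma cb_cvg (m d : nat -> nat) x : (forall n, (0 < m n)%N) ->
    (fun n => (Num.sqrt (m n)%:R)^-1) @ \oo --> (0 : R) ->
    (fun n => (d n)%:R / Num.sqrt (m n)%:R) @ \oo --> x ->
  (\forall n \near \oo, (d n < m n)%N) /\
  (fun n => cb (m n) (d n)) @ \oo --> expR (- x ^+ 2).
Proof.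
move=> m0 h_cvg r_cvg.
pose h n : R := (Num.sqrt (m n)%:R)^-1; pose r n : R := (d n)%:R * h n.
have s0 n : 0 < Num.sqrt (m n)%:R :> R by rewrite sqrtr_gt0 ltr0n.
have sm n : (m n)%:R = Num.sqrt (m n)%:R ^+ 2 :> R by rewrite sqr_sqrtr.
have rh_cvg : (fun n => r n * h n) @ \oo --> (0 : R).
  by rewrite -(mulr0 x); apply: cvgM.
have lt_dm : \forall n \near \oo, (d n < m n)%N.
  apply: filterS (cvgr_lt 0 rh_cvg 1 ltr01) => n.
  rewrite /r /h -mulrA -invfM -expr2 -sm ltr_pdivrMr ?ltr0n // mul1r.
  by rewrite ltr_nat.
split=> //.
have lim (b : R) : (fun n => expR (- (r n ^+ 2 / (1 + b * (r n * h n))))) @ \oo --> expR (- x ^+ 2).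
  apply: cvg_expR.
  apply: cvgN; rewrite -[X in _ --> X]mulr1 -{2}invr1.
  apply: cvgM; first by rewrite expr2; under eq_fun do rewrite expr2; apply: cvgM.
  apply: cvgV; first by rewrite oner_neq0.
  rewrite -[X in _ --> X]addr0 -(mulr0 b); apply: cvgD; first exact: cvg_cst.
  by apply: cvgM; [exact: cvg_cst | exact: rh_cvg].
apply: squeeze_cvgr (lim (- 1)) (lim 1).
near=> n.
have dm : (d n < m n)%N by near: n.
have E (b : R) : (m n)%:R + b * (d n)%:R != 0 ->
    r n ^+ 2 / (1 + b * (r n * h n)) = (d n)%:R ^+ 2 / ((m n)%:R + b * (d n)%:R).
  have : Num.sqrt (m n)%:R != 0 :> R by rewrite gt_eqF.
  rewrite /r /h; have := sm n; move: (Num.sqrt _) => s -> s0' sb0; field.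
  by rewrite sb0 s0'.
rewrite !E ?mulN1r ?mul1r ?cb_lower ?cb_upper ?(ltnW dm) //.
  by rewrite gt_eqF // ltr_wpDr // ltr0n.
by rewrite gt_eqF // subr_gt0 ltr_nat.
Unshelve. all: by end_near. Qed.

Lemma sum_cb m : \sum_(d < m.+1) cb m d = (4 ^+ m / 'C(2 * m, m)%:R + 1) / 2.
Proof.
have := sum_sym m (fun j => 'C(2 * m, j)%:R : R).
have b0 : 'C(2 * m, m)%:R != 0 :> R by rewrite gt_eqF // bin_mid_gt0.
rewrite -natr_sum.
have -> : (\sum_(j < (2 * m).+1) 'C(2 * m, j) = 4 ^ m)%N.
  rewrite -[4%N]/(2 ^ 2)%N -expnM -[2%N in RHS]/(1 + 1)%N expnDn.
  by apply: eq_bigr => i _; rewrite !exp1n !muln1.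
rewrite natrX => H; rewrite big_ord_recl cb0.
under eq_bigr => d _ do rewrite lift0.
rewrite -mulr_suml H //; first by field.
move=> d le_d; have le2 : (m - d <= 2 * m)%N by lia.
by rewrite -(bin_sub le2) (_ : (2 * m - (m - d) = m + d)%N) //; lia.
Qed.

Lemma sqrtV_cvg (u : nat -> R) : u @ \oo --> +oo ->
  (fun n => (Num.sqrt (u n))^-1) @ \oo --> (0 : R).
Proof.
move=> uy; apply/cvgrPdist_le => e e0; near=> n.
have un : e^-1 ^+ 2 <= u n by near: n; move/cvgryPge: uy; apply.
rewrite sub0r normrN ger0_norm ?invr_ge0 ?sqrtr_ge0 //.
have e1 : e^-1 <= Num.sqrt (u n).
  by rewrite -[leLHS](ger0_norm (ltW (_ : 0 < e^-1))) ?invr_gt0 // -sqrtr_sqr ler_wsqrtr.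
rewrite -[leRHS]invrK lef_pV2 ?posrE ?invr_gt0 //.
by rewrite (lt_le_trans _ e1) // invr_gt0.
Unshelve. all: by end_near. Qed.

Lemma trunc_scale_cvg (h : nat -> R) x : 0 <= x -> (forall n, 0 < h n) ->
  h @ \oo --> (0 : R) -> (fun n => (Num.truncn (x / h n))%:R * h n) @ \oo --> x.
Proof.
move=> x0 h0 h_cvg.
apply: (@squeeze_cvgr _ _ _ _ (fun n => x - h n) (fun=> x)); last exact: cvg_cst.
  apply: nearW => n; have := @truncn_itv _ (x / h n).
  rewrite divr_ge0 ?(ltW (h0 n)) // => /(_ isT).
  rewrite ler_pdivlMr // ltr_pdivrMr // -natr1 mulrDl mul1r => /andP[-> ?].
  by rewrite andbT lerBlDr ltW.
by rewrite -[X in _ --> X]subr0; apply: cvgB => //; exact: cvg_cst.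
Qed.

(** Here the Gaussian integral yields the Wallis constant. By [sum_cb] the sum of the central ratios
    is essentially half of 4^m / C(2m, m); with mesh 1 / sqrt m it is a Riemann sum for e^(- x^2) on
    the half-line. *)
Lemma wallis : (fun m => Num.sqrt m%:R * 'C(2 * m, m)%:R / 4 ^+ m : R) @ \oo --> ((Num.sqrt pi)^-1 : R).
Proof.
rewrite -cvg_shiftS /=.
pose h n : R := (Num.sqrt n.+1%:R)^-1.
have h0 n : 0 < h n by rewrite invr_gt0 sqrtr_gt0.
have h_cvg : h @ \oo --> (0 : R).
  by apply: sqrtV_cvg; have := @cvgr_idn R; rewrite -cvg_shiftS.
have h2 n : h n ^+ 2 = n.+1%:R^-1 by rewrite exprVn sqr_sqrtr.
have := @riemann_gauss R h (fun n => n.+2) (fun n => cb n.+1) 2.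
have -> : (fun n => h n * \sum_(j < n.+2) cb n.+1 j)
   = (fun n => ((Num.sqrt n.+1%:R * 'C(2 * n.+1, n.+1)%:R / 4 ^+ n.+1)^-1 + h n) / 2).
  apply/funext => n; rewrite sum_cb.
  have : 'C(2 * n.+1, n.+1)%:R != 0 :> R by rewrite gt_eqF // bin_mid_gt0.
  have : Num.sqrt n.+1%:R != 0 :> R by rewrite gt_eqF // sqrtr_gt0.
  have : 4 ^+ n.+1 != 0 :> R by rewrite expf_neq0.
  rewrite /h; move: (_ ^+ n.+1) (Num.sqrt _) ('C(_, _)%:R) => a b c a0 b0 c0.
  by field; rewrite a0 b0 c0.
move=> H; have {H} W : (fun n => ((Num.sqrt n.+1%:R * 'C(2 * n.+1, n.+1)%:R / 4 ^+ n.+1)^-1 + h n) / 2)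
   @ \oo --> (Num.sqrt pi / 2 : R).
  apply: H => //.
  - move=> n; rewrite h0 invf_le1 ?sqrtr_gt0 //.
    by rewrite -[X in X <= _]sqrtr1 ler_sqrt // ler1n.
  - move=> n j le_j; rewrite ger0_norm ?cb_ge0 //.
    apply: le_trans (cb_upper n.+1 j _ _) _ => //.
    rewrite exprMn h2.
    have n0 : 0 < n.+1%:R :> R by [].
    have jn : j%:R <= n.+1%:R :> R by rewrite ler_nat -ltnS.
    have j0 : 0 <= j%:R :> R by [].
    move: (n.+1%:R : R) (j%:R : R) n0 jn j0 => a b a0 ba b0.
    have z0 : 0 <= b ^+ 2 / (a + b) by rewrite divr_ge0 ?sqr_ge0 // addr_ge0 // ltW.
    have zy : a^-1 * b ^+ 2 <= 2 * (b ^+ 2 / (a + b)).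
      rewrite [leRHS]mulrCA [leLHS]mulrC ler_wpM2l ?sqr_ge0 // ler_pdivlMr; last by lra.
      by rewrite ler_pdivrMl //; lra.
    apply: le_trans (expRN_le _ _) _; first by lra.
    have y0 : 0 <= a^-1 * b ^+ 2 by rewrite mulr_ge0 ?invr_ge0 ?sqr_ge0 // ltW.
    rewrite -[leLHS]mul1r ler_pdivrMr; last by lra.
    by rewrite mulrAC ler_pdivlMr; lra.
  - move=> x x0.
    have [] := cb_cvg succn (fun n => Num.truncn (x / h n)) x.
    + by [].
    + exact: h_cvg.
    + exact: trunc_scale_cvg.
    move=> lt_d; apply: cvg_trans; apply: near_eq_cvg.
    by apply: filterS lt_d => n lt_n; rewrite ltnW // ltnS ltnW.
have pi0 : Num.sqrt pi != 0 :> R by rewrite gt_eqF // sqrtr_gt0 pi_gt0.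
have {W} : (fun n => (((Num.sqrt n.+1%:R * 'C(2 * n.+1, n.+1)%:R / 4 ^+ n.+1)^-1 + h n) / 2 * 2 - h n)^-1)
   @ \oo --> ((Num.sqrt pi / 2 * 2 - 0)^-1 : R).
  apply: cvgV; first by rewrite subr0 divfK.
  by apply: cvgB => //; apply: cvgM => //; exact: cvg_cst.
rewrite subr0 divfK //; apply: cvg_trans; apply: near_eq_cvg; apply: nearW => n.
by rewrite divfK // addrK invrK.
Qed.

End Wallis.

(** * The theta transformation *)

Section ThetaBounds.
Context {R : realType}.
Implicit Types (x y t : R) (m d l : nat).

Lemma alternating_tail (b : nat -> R) (M N : nat) : (M <= N)%N ->
    (forall v, 0 <= b v) -> (forall v, b v.+1 <= b v) ->
  `|\sum_(v < N) (-1) ^+ v.+1 * b v - \sum_(v < M) (-1) ^+ v.+1 * b v| <= b M.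
Proof.
move=> le_MN b0 bS; pose S N := \sum_(v < N) (-1) ^+ v.+1 * b v.
suff H j : exists2 e, 0 <= e <= b M & S (j + M)%N - S M = (-1) ^+ M.+1 * e.
  have [e /andP[e0 eM]] := H (N - M)%N; rewrite subnK // /S => ->.
  by rewrite normrM normrX normrN1 expr1n mul1r ger0_norm.
elim: j M {le_MN} => [|j IHj] M; first by exists 0; rewrite ?b0 ?lexx // subrr mulr0.
have [e /andP[e0 eM]] := IHj M.+1; rewrite addnS -addSn => E.
exists (b M - e); first by rewrite subr_ge0 (le_trans eM) //= lerBlDr lerDl.
rewrite (_ : S (j.+1 + M)%N - S M = S (j.+1 + M)%N - S M.+1 + (S M.+1 - S M)); last by ring.
by rewrite E /S big_ord_recr /= exprS; ring.
Qed.

Lemma polya_cb l m : (0 < l)%N ->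
  \sum_(k < l) cos (pi * k.*2.+1%:R / (2 * l%:R)) ^+ (2 * m)
  = l%:R * 'C(2 * m, m)%:R / 4 ^+ m *
     (1 + 2 * \sum_(v < m %/ l) (-1) ^+ v.+1 * cb m (v.+1 * l)) :> R.
Proof.
move=> l0; have f0 : 4 ^+ m != 0 :> R by rewrite expf_neq0.
apply: (mulfI f0); rewrite mulr_sumr.
rewrite (eq_bigr (fun k : 'I_l => (2 * cos (pi * k.*2.+1%:R / (2 * l%:R))) ^+ (2 * m))); last first.
  by move=> k _; rewrite exprMn exprM (_ : 4 = 2 ^+ 2) -?exprM //; ring.
rewrite polya_filter //.
have b0 : 'C(2 * m, m)%:R != 0 :> R by rewrite gt_eqF // bin_mid_gt0.
have -> : \sum_(v < m %/ l) (-1) ^+ v.+1 * cb m (v.+1 * l)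
  = (\sum_(v < m %/ l) (-1) ^+ v.+1 * 'C(2 * m, m + v.+1 * l)%:R) / 'C(2 * m, m)%:R :> R.
  by rewrite mulr_suml; apply: eq_bigr => v _; rewrite /cb mulrA.
by field; rewrite f0 b0.
Qed.

Lemma cos_pow_even_ge0 x m : 0 <= cos x ^+ (2 * m).
Proof. by rewrite exprM exprn_ge0 // sqr_ge0. Qed.

Lemma cos_rev l k : (k < l)%N ->
  cos (pi * (l - k.+1).*2.+1%:R / (2 * l%:R)) = - cos (pi * k.*2.+1%:R / (2 * l%:R)) :> R.
Proof.
move=> lt_k; have l0 : l%:R != 0 :> R by rewrite pnatr_eq0; lia.
have -> : (l - k.+1).*2.+1 = (2 * l - k.*2.+1)%N by lia.
rewrite natrB ?natrM; last by lia.
rewrite (_ : pi * _ / _ = - (pi * k.*2.+1%:R / (2 * l%:R)) + pi); last by field.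
by rewrite cosDpi cosN.
Qed.

(** The nodes k = 0 and k = l - 1 have opposite cosines, hence equal even powers; the other terms
    are nonnegative. *)
Lemma cos_sum_lower l m : (1 < l)%N ->
  2 * cos (pi / (2 * l%:R)) ^+ (2 * m)
   <= \sum_(k < l) cos (pi * k.*2.+1%:R / (2 * l%:R)) ^+ (2 * m) :> R.
Proof.
case: l => [|[|l]] // _; rewrite big_ord_recl big_ord_recr /= addrCA.
rewrite -[leLHS]add0r lerD ?sumr_ge0 // => [k _|]; first exact: cos_pow_even_ge0.
have E := cos_rev l.+2 0 (ltn0Sn _); rewrite subn1 /= in E.
by rewrite /bump /= add1n E mulr1 [X in _ + X]exprM sqrrN -exprM; lra.
Qed.

(** For nodes up to pi / 2, [cos_le_expR] gives e^(- B (2 k + 1)^2), below a geometric sequence of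
    ratio e^(- 8 B). The reflection [cos_rev] carries the remaining nodes there, so the two
    geometric series together cover the sum. *)
Lemma cos_sum_upper l m (B : R) : (0 < l)%N -> (0 < m)%N ->
    B = m%:R * pi ^+ 2 / (4 * l%:R ^+ 2) ->
  \sum_(k < l) cos (pi * k.*2.+1%:R / (2 * l%:R)) ^+ (2 * m)
   <= 2 * (expR (- B) / (1 - expR (- (8 * B)))) :> R.
Proof.
move=> l0 m0 BE; have ln0 : 0 < l%:R :> R by rewrite ltr0n.
have B0 : 0 < B by rewrite BE divr_gt0 ?mulr_gt0 ?exprn_gt0 ?pi_gt0 ?ltr0n.
have half k : (k.*2.+1 <= l)%N ->
    cos (pi * k.*2.+1%:R / (2 * l%:R)) ^+ (2 * m) <= expR (- B) * expR (- (8 * B)) ^+ k :> R.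
  move=> le_k; have kl : k.*2.+1%:R <= l%:R :> R by rewrite ler_nat.
  set x := pi * _ / _; have x0 : 0 <= x.
    by rewrite divr_ge0 ?mulr_ge0 ?pi_ge0.
  have xpi : x <= pi / 2.
    rewrite (_ : x = pi / 2 * (k.*2.+1%:R / l%:R)); last by rewrite /x; field; rewrite gt_eqF.
    by rewrite ler_piMr ?divr_ge0 ?pi_ge0 // ler_pdivrMr // mul1r.
  have c0 : 0 <= cos x by rewrite cos_ge0_pihalf // xpi andbT (le_trans _ x0) // oppr_le0 divr_ge0 ?pi_ge0.
  have cx : cos x <= expR (- (x ^+ 2 / 2)).
    by apply: cos_le_expR; rewrite x0 (le_trans xpi) // ler_pdivrMr // ler_peMr ?pi_ge0 ?ler1n.
  apply: (@le_trans _ _ (expR (- (x ^+ 2 / 2)) ^+ (2 * m))).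
    by rewrite lerXn2r ?nnegrE ?expR_ge0.
  rewrite -!expRM_natl -expRD ler_expR.
  have -> : (2 * m)%:R * - (x ^+ 2 / 2) = - (B * k.*2.+1%:R ^+ 2).
    by rewrite /x BE natrM; field; rewrite gt_eqF.
  rewrite -mul2n -natr1 natrM mulrN -opprD lerN2.
  (* The ratio comes from (2 k + 1)^2 = 1 + 4 k (k + 1) >= 1 + 8 k, an equality at k = 0 and k =
     1. *)
  have -> : B * (2 * k%:R + 1) ^+ 2 = B + k%:R * (4 * (k%:R + 1) * B) by ring.
  rewrite lerD2l; case: k {le_k kl x x0 xpi c0 cx} => [|k]; first by rewrite !mul0r.
  rewrite ler_wpM2l // (ler_wpM2r (ltW B0)) //.
  have : 1 <= k.+1%:R :> R by rewrite ler1n.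
  by lra.
set w := expR (- (8 * B)) in half *.
have w0 : 0 <= w by exact: expR_ge0.
have w1 : w < 1 by rewrite expR_lt1 oppr_lt0 mulr_gt0.
have summand k : (k < l)%N -> cos (pi * k.*2.+1%:R / (2 * l%:R)) ^+ (2 * m)
    <= expR (- B) * w ^+ k + expR (- B) * w ^+ (l - k.+1).
  move=> lt_k; have [le_k|gt_k] := leqP k.*2.+1 l.
    by apply: le_trans (half _ le_k) _; rewrite lerDl mulr_ge0 ?expR_ge0 ?exprn_ge0.
  have := half (l - k.+1)%N; rewrite cos_rev // exprM sqrrN -exprM => H.
  apply: le_trans (H _) _; first by lia.
  by rewrite lerDr mulr_ge0 ?expR_ge0 ?exprn_ge0.
apply: le_trans (ler_sum _ (fun (k : 'I_l) _ => summand k (ltn_ord k))) _.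
rewrite big_split /= [X in _ + X](reindex_inj rev_ord_inj) /=.
under [X in _ + X]eq_bigr => k _ do rewrite subnSK // subKn ?(ltnW (ltn_ord k)) //.
rewrite -!mulr_sumr.
have S_le : \sum_(i < l) w ^+ i <= (1 - w)^-1.
  rewrite -[leRHS]mul1r ler_pdivlMr; last by lra.
  have -> : (\sum_(i < l) w ^+ i) * (1 - w) = 1 - w ^+ l.
    by rewrite -opprB mulrN mulrC -subrX1 opprB.
  by rewrite lerBlDr lerDl exprn_ge0.
by have := ler_wpM2l (expR_ge0 (- B)) S_le; lra.
Qed.

Lemma cb_leS m d : cb m d.+1 <= cb m d :> R.
Proof.
have [le_d|lt_d] := leqP d m; first exact: cbS_le.
by rewrite [leLHS]/cb bin_small ?mul0r ?cb_ge0 //; lia.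
Qed.

Lemma cb_le m d d' : (d <= d')%N -> cb m d' <= cb m d :> R.
Proof.
move=> /subnK <-; elim: (d' - d)%N => // j; apply: le_trans.
by rewrite addSn cb_leS.
Qed.

(* Polya's proof of the theta transformation: in [polya_cb] let l and m tend to
   infinity with m ~ l^2 / t. The central binomial ratios tend to Gaussians, so
   the right-hand side tends to sqrt(t / pi) * theta, while on the left only the
   nodes next to 0 and pi contribute. *)
Section FixedT.
Context (t : R) (t0 : 0 < t).
Let q : R := expR (- t).
Let A : R := pi ^+ 2 / (4 * t).

(** At least 2, so that the nodes next to 0 and to pi are distinct, as [cos_sum_lower] requires. *)
Let ll (n : nat) := n.+2.
Let mm (n : nat) := (Num.truncn ((ll n)%:R ^+ 2 / t)).+1.

Let ll0 n : (ll n)%:R != 0 :> R. Proof. by rewrite pnatr_eq0. Qed.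

Lemma mm_itv n : (ll n)%:R ^+ 2 / t < (mm n)%:R <= (ll n)%:R ^+ 2 / t + 1.
Proof.
have := @truncn_itv _ ((ll n)%:R ^+ 2 / t).
rewrite divr_ge0 ?sqr_ge0 ?(ltW t0) // => /(_ isT) /andP[h1 h2].
by rewrite /mm h2 /= -natr1 lerD2r.
Qed.

Lemma llV_cvg : (fun n => (ll n)%:R^-1) @ \oo --> (0 : R).
Proof.
have := @cvg_harmonic R; rewrite -cvg_shiftS; apply: cvg_trans.
by apply: near_eq_cvg; apply: nearW.
Qed.

Lemma mm_cvg : (fun n => (mm n)%:R / (ll n)%:R ^+ 2) @ \oo --> t^-1.
Proof.
have l0 n : 0 < (ll n)%:R ^+ 2 :> R by rewrite exprn_gt0.
apply: (@squeeze_cvgr _ _ _ _ (fun=> t^-1) (fun n => t^-1 + (ll n)%:R^-1 ^+ 2)).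
- apply: nearW => n; have /andP[h1 h2] := mm_itv n.
  rewrite ler_pdivlMr // ler_pdivrMr // mulrC (ltW h1) /=.
  by rewrite mulrDl exprVn mulVf ?gt_eqF // mulrC.
- exact: cvg_cst.
rewrite -[X in _ --> X]addr0; apply: cvgD; first exact: cvg_cst.
rewrite -(mulr0 0); under eq_fun do rewrite expr2.
by apply: cvgM; exact: llV_cvg.
Qed.

Lemma mm_cvgy : (fun n => (mm n)%:R : R) @ \oo --> +oo.
Proof.
apply/cvgryPge => M; near=> n.
have /andP[h1 _] := mm_itv n; apply: le_trans (ltW h1).
have : M * t <= n%:R by near: n; exact: nbhs_infty_ger.
have : n%:R <= (ll n)%:R :> R by rewrite ler_nat /ll; lia.
rewrite ler_pdivlMr // => h3 h4; apply: le_trans h4 _; apply: le_trans h3 _.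
by rewrite expr2 ler_peMr // ler1n.
Unshelve. all: by end_near. Qed.

Lemma sqrt_mm_cvg : (fun n => (ll n)%:R / Num.sqrt (mm n)%:R) @ \oo --> Num.sqrt t.
Proof.
have -> : (fun n => (ll n)%:R / Num.sqrt (mm n)%:R) = (fun n => (Num.sqrt ((mm n)%:R / (ll n)%:R ^+ 2))^-1) :> (nat -> R).
  apply/funext => n; rewrite sqrtrM // -exprVn sqrtr_sqr.
  by rewrite ger0_norm ?invr_ge0 // invfM invrK mulrC.
rewrite -[X in _ --> X]invrK -sqrtrV ?(ltW t0) //.
apply: cvgV; first by rewrite gt_eqF // sqrtr_gt0 invr_gt0.
by apply: continuous_cvg; [exact: sqrt_continuous | exact: mm_cvg].
Qed.

Lemma cb_mm_cvg (v : nat) : (fun n => cb (mm n) (v * ll n)) @ \oo --> q ^+ (v ^ 2).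
Proof.
have [] := @cb_cvg R mm (fun n => (v * ll n)%N) (v%:R * Num.sqrt t).
- by [].
- by apply: sqrtV_cvg; exact: mm_cvgy.
- under eq_fun do rewrite natrM -mulrA.
  by apply: cvgM; [exact: cvg_cst | exact: sqrt_mm_cvg].
move=> _; rewrite exprMn sqr_sqrtr ?(ltW t0) // -natrX -mulrN expRM_natl.
exact.
Qed.

Lemma prefactor_cvg : (fun n => (ll n)%:R * 'C(2 * mm n, mm n)%:R / 4 ^+ (mm n) : R)
  @ \oo --> Num.sqrt (t / pi).
Proof.
rewrite sqrtrM ?(ltW t0) // sqrtrV ?pi_ge0 //.
have -> : (fun n => (ll n)%:R * 'C(2 * mm n, mm n)%:R / 4 ^+ (mm n) : R)
  = (fun n => (ll n)%:R / Num.sqrt (mm n)%:R * (Num.sqrt (mm n)%:R * 'C(2 * mm n, mm n)%:R / 4 ^+ (mm n))).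
  by apply/funext => n; rewrite !mulrA divfK // gt_eqF // sqrtr_gt0.
apply: cvgM; first exact: sqrt_mm_cvg.
apply: (cvg_comp mm _ _ (@wallis R)).
apply/cvgnyPge => M; have /cvgryPge/(_ M%:R) := mm_cvgy.
by apply: filterS => n; rewrite ler_nat.
Qed.

Lemma ratio_mm_ge (M : nat) : \forall n \near \oo, (M <= mm n %/ ll n)%N.
Proof.
near=> n; rewrite leq_divRL // -(ler_nat R) natrM.
have /andP[h1 _] := mm_itv n; apply: le_trans (ltW h1).
rewrite ler_pdivlMr // expr2 mulrAC ler_wpM2r //.
have : M%:R * t <= n%:R by near: n; exact: nbhs_infty_ger.
have : n%:R <= (ll n)%:R :> R by rewrite ler_nat /ll; lia.
by move=> h3 h4; apply: le_trans h4 h3.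
Unshelve. all: by end_near. Qed.

Let thetasum n := 1 + 2 * \sum_(v < mm n %/ ll n) (-1) ^+ v.+1 * cb (mm n) (v.+1 * ll n) : R.

Lemma thetasum_partial (M : nat) : \forall n \near \oo,
  `|thetasum n - (1 + 2 * \sum_(v < M) (-1) ^+ v.+1 * cb (mm n) (v.+1 * ll n))|
    <= 2 * cb (mm n) (M.+1 * ll n).
Proof.
apply: filterS (ratio_mm_ge M) => n le_M.
rewrite /thetasum opprD addrACA subrr add0r -mulrBr normrM (@ger0_norm _ 2) // ler_wpM2l //.
apply: (alternating_tail (fun v => cb (mm n) (v.+1 * ll n))) => // v; first exact: cb_ge0.
by apply: cb_le; rewrite leq_mul2r leqnSn orbT.
Qed.

Lemma partial_cvg (M : nat) : (fun n => 1 + 2 * \sum_(v < M) (-1) ^+ v.+1 * cb (mm n) (v.+1 * ll n) : R)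
  @ \oo --> theta q M.
Proof.
apply: cvgD; first exact: cvg_cst.
apply: cvgM; first exact: cvg_cst.
elim: M => [|M IHM].
  rewrite big_ord0; under eq_fun do rewrite big_ord0; exact: cvg_cst.
rewrite big_ord_recr /=; under eq_fun do rewrite big_ord_recr /=.
apply: cvgD; first exact: IHM.
by apply: cvgM; [exact: cvg_cst | exact: cb_mm_cvg].
Qed.

Let B n : R := (mm n)%:R * pi ^+ 2 / (4 * (ll n)%:R ^+ 2).

Lemma B_cvg : B @ \oo --> A.
Proof.
rewrite /B; have -> : (fun n => (mm n)%:R * pi ^+ 2 / (4 * (ll n)%:R ^+ 2))
   = (fun n => (mm n)%:R / (ll n)%:R ^+ 2 * (pi ^+ 2 / 4)) :> (nat -> R).
  by apply/funext => n; field; rewrite ll0.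
rewrite (_ : A = t^-1 * (pi ^+ 2 / 4)); last by rewrite /A; field; rewrite gt_eqF.
by apply: cvgM; [exact: mm_cvg | exact: cvg_cst].
Qed.

(** The truncation M stays fixed while l and m grow: the alternating sum is within its first omitted
    term of the partial sum, and both have termwise limits. This makes a limit under an infinite sum
    unnecessary. *)
Lemma theta_lower (M : nat) :
  2 * expR (- A) <= Num.sqrt (t / pi) * (theta q M + 2 * q ^+ (M.+1 ^ 2)).
Proof.
(* Half the squared angle of the node next to 0, so that its cosine is at least 1 - y >= e^(- y / (1
   - y)); raising to the power 2 m produces B, because 2 m y = B. *)
pose y n : R := (pi / (2 * (ll n)%:R)) ^+ 2 / 2.
have y_cvg : y @ \oo --> (0 : R).
  rewrite (_ : 0 = (pi / 2) ^+ 2 / 2 * (0 * 0) :> R); last by rewrite !mulr0.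
  rewrite (_ : y = fun n => (pi / 2) ^+ 2 / 2 * ((ll n)%:R^-1 * (ll n)%:R^-1)); last first.
    by apply/funext => n; rewrite /y; field; rewrite ll0.
  by apply: cvgM; [exact: cvg_cst | apply: cvgM; exact: llV_cvg].
have low_cvg : (fun n => 2 * expR (- (B n / (1 - y n)))) @ \oo --> 2 * expR (- A).
  apply: cvgM; first exact: cvg_cst.
  apply: cvg_expR; apply: cvgN; rewrite -[X in _ --> X]mulr1 -{2}invr1 -{2}(subr0 1).
  apply: cvgM; first exact: B_cvg.
  by apply: cvgV; [rewrite subr0 oner_neq0 | apply: cvgB => //; exact: cvg_cst].
have up_cvg : (fun n => (ll n)%:R * 'C(2 * mm n, mm n)%:R / 4 ^+ (mm n) *
     ((1 + 2 * \sum_(v < M) (-1) ^+ v.+1 * cb (mm n) (v.+1 * ll n)) + 2 * cb (mm n) (M.+1 * ll n)))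
   @ \oo --> Num.sqrt (t / pi) * (theta q M + 2 * q ^+ (M.+1 ^ 2)).
  apply: cvgM; first exact: prefactor_cvg.
  apply: cvgD; first exact: partial_cvg.
  by apply: cvgM; [exact: cvg_cst | exact: cb_mm_cvg].
apply: ler_cvg_to low_cvg up_cvg _; near=> n.
have y1 : y n < 1 by near: n; exact: (cvgr_lt 0 y_cvg 1 ltr01).
have le_th : thetasum n <= (1 + 2 * \sum_(v < M) (-1) ^+ v.+1 * cb (mm n) (v.+1 * ll n)) + 2 * cb (mm n) (M.+1 * ll n).
  suff : `|thetasum n - (1 + 2 * \sum_(v < M) (-1) ^+ v.+1 * cb (mm n) (v.+1 * ll n))|
    <= 2 * cb (mm n) (M.+1 * ll n) by rewrite ler_norml => /andP[_]; rewrite lerBlDl.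
  by near: n; exact: thetasum_partial.
apply: (@le_trans _ _ ((ll n)%:R * 'C(2 * mm n, mm n)%:R / 4 ^+ (mm n) * thetasum n)); last first.
  by rewrite ler_wpM2l // divr_ge0 ?mulr_ge0 ?exprn_ge0.
rewrite -polya_cb //; apply: le_trans (cos_sum_lower _ _ _) => //.
rewrite ler_wpM2l //; apply: (@le_trans _ _ ((1 - y n) ^+ (2 * mm n))).
  apply: (@le_trans _ _ (expR (- (y n / (1 - y n))) ^+ (2 * mm n))).
    rewrite -expRM_natl ler_expR mulrN lerN2 mulrA ler_wpM2r ?invr_ge0 ?subr_ge0 ?(ltW y1) //.
    by rewrite /B /y natrM le_eqVlt; apply/orP; left; apply/eqP; field; rewrite ll0.
  by rewrite lerXn2r ?nnegrE ?expR_ge0 ?subr_ge0 ?(ltW y1) // expRN_ge.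
by rewrite lerXn2r ?nnegrE ?subr_ge0 ?(ltW y1) ?cos_ge // (le_trans _ (cos_ge _)) // subr_ge0 (ltW y1).
Unshelve. all: by end_near. Qed.

Lemma theta_upper (M : nat) :
  Num.sqrt (t / pi) * (theta q M - 2 * q ^+ (M.+1 ^ 2)) <= 2 * (expR (- A) / (1 - expR (- (8 * A)))).
Proof.
have A0 : 0 < A by rewrite divr_gt0 ?mulr_gt0 ?exprn_gt0 ?pi_gt0.
have up_cvg : (fun n => 2 * (expR (- B n) / (1 - expR (- (8 * B n))))) @ \oo
    --> 2 * (expR (- A) / (1 - expR (- (8 * A)))).
  apply: cvgM; first exact: cvg_cst.
  apply: cvgM; first by apply: cvg_expR; apply: cvgN; exact: B_cvg.
  apply: cvgV; first by rewrite subr_eq0 eq_sym lt_eqF // expR_lt1 oppr_lt0 mulr_gt0.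
  apply: cvgB; first exact: cvg_cst.
  apply: cvg_expR; apply: cvgN; apply: cvgM; first exact: cvg_cst.
  exact: B_cvg.
have low_cvg : (fun n => (ll n)%:R * 'C(2 * mm n, mm n)%:R / 4 ^+ (mm n) *
     ((1 + 2 * \sum_(v < M) (-1) ^+ v.+1 * cb (mm n) (v.+1 * ll n)) - 2 * cb (mm n) (M.+1 * ll n)))
   @ \oo --> Num.sqrt (t / pi) * (theta q M - 2 * q ^+ (M.+1 ^ 2)).
  apply: cvgM; first exact: prefactor_cvg.
  apply: cvgB; first exact: partial_cvg.
  by apply: cvgM; [exact: cvg_cst | exact: cb_mm_cvg].
apply: ler_cvg_to low_cvg up_cvg _; near=> n.
have le_th : (1 + 2 * \sum_(v < M) (-1) ^+ v.+1 * cb (mm n) (v.+1 * ll n)) - 2 * cb (mm n) (M.+1 * ll n) <= thetasum n.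
  suff : `|thetasum n - (1 + 2 * \sum_(v < M) (-1) ^+ v.+1 * cb (mm n) (v.+1 * ll n))|
    <= 2 * cb (mm n) (M.+1 * ll n).
    by rewrite ler_norml => /andP[h _]; move: h; rewrite lerBrDl.
  by near: n; exact: thetasum_partial.
apply: (@le_trans _ _ ((ll n)%:R * 'C(2 * mm n, mm n)%:R / 4 ^+ (mm n) * thetasum n)).
  by rewrite ler_wpM2l // divr_ge0 ?mulr_ge0 ?exprn_ge0.
by rewrite -polya_cb //; exact: cos_sum_upper.
Unshelve. all: by end_near. Qed.

End FixedT.

End ThetaBounds.

(** * The logarithm of the product and its derivatives *)

Section Log.
Context {R : realType}.
Implicit Types (x y t q : R) (K M k : nat).

Lemma expRN_01 t : 0 < t -> 0 < expR (- t) < 1.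
Proof. by move=> t0; rewrite expR_gt0 expR_lt1 oppr_lt0. Qed.

Lemma expRN_natX t k : expR (- t) ^+ k = expR (- (k%:R * t)).
Proof. by rewrite -expRM_natl mulrN. Qed.

Lemma expRN_pow_le x n : 0 < x -> expR (- x) <= n.+1`!%:R / x ^+ n.+1.
Proof.
move=> x0; have f0 : 0 < n.+1`!%:R :> R by rewrite ltr0n fact_gt0.
have xn : 0 < x ^+ n.+1 by rewrite exprn_gt0.
rewrite expRN -[leRHS]invrK lef_pV2 ?posrE ?expR_gt0 ?invr_gt0 ?divr_gt0 // invf_div.
by apply: le_trans (expR_ge1Dxn n (ltW x0)); rewrite lerDr.
Qed.

Lemma gauss_error_le t n : 0 < t ->
  2 * n.+1%:R * expR (- t) ^+ n.+1 + 2 * expR (- t) ^+ (n.+2 ^ 2) <= 8 / t ^+ 2 * n.+1%:R^-1.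
Proof.
move=> t0; have /andP[q0 q1] := expRN_01 t t0.
have N1 : 1 <= n.+1%:R :> R by rewrite ler1n.
have N0 : 0 < n.+1%:R :> R by [].
have h1 : expR (- t) ^+ (n.+2 ^ 2) <= expR (- t) ^+ n.+1.
  by rewrite ler_wiXn2l ?(ltW q0) ?(ltW q1) //; lia.
have h2 : expR (- t) ^+ n.+1 <= 2 / (n.+1%:R * t) ^+ 2.
  by rewrite expRN_natX; apply: (expRN_pow_le _ 1); rewrite mulr_gt0.
set e := expR (- t) ^+ n.+1 in h1 h2 *.
have e0 : 0 <= e by rewrite exprn_ge0 // ltW.
apply: (@le_trans _ _ (4 * n.+1%:R * (2 / (n.+1%:R * t) ^+ 2))).
  have : n.+1%:R * e <= n.+1%:R * (2 / (n.+1%:R * t) ^+ 2) by rewrite ler_wpM2l.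
  have : e <= n.+1%:R * e by rewrite ler_peMl.
  rewrite -!mulrA; move: h1; move: (expR _ ^+ _) (n.+1%:R * (2 / _)) (n.+1%:R * e) => ? ? ?.
  by lra.
rewrite le_eqVlt; apply/orP; left; apply/eqP; field.
by rewrite !gt_eqF.
Qed.

Lemma inv_error_cvg (c : R) : (fun n => c * n.+1%:R^-1) @ \oo --> (0 : R).
Proof.
by rewrite -(mulr0 c); apply: cvgM; [exact: cvg_cst | exact: cvg_harmonic].
Qed.

(** Gauss's identity is exact only for the infinite product. As [Pb] decreases in K, the lower bound
    found in the limit holds at every K with no correction; an upper bound at finite K must pay for
    the missing factors, see [Pb_tail]. *)
Lemma Pb_lower t K : 0 < t ->
  2 * expR (- (pi ^+ 2 / (4 * t))) <= Num.sqrt (t / pi) * Pb (expR (- t)) K.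
Proof.
move=> t0; have q01 := expRN_01 t t0.
have cv : (fun n => Num.sqrt (t / pi) * (Pb (expR (- t)) K + 8 / t ^+ 2 * n.+1%:R^-1)) @ \oo
    --> Num.sqrt (t / pi) * (Pb (expR (- t)) K + 0).
  apply: cvgM; first exact: cvg_cst.
  by apply: cvgD; [exact: cvg_cst | exact: inv_error_cvg].
rewrite -[Pb _ _]addr0; apply: (ler_cvg_to (cvg_cst _) cv); near=> n.
apply: le_trans (theta_lower t t0 n.+1) _; rewrite ler_wpM2l ?sqrtr_ge0 //.
have := theta_Pb (expR (- t)) n.+1 q01; rewrite ler_norml => /andP[_ h1].
have h2 := gauss_error_le t n t0.
have h3 : Pb (expR (- t)) n.+1 <= Pb (expR (- t)) K.
  by apply: le_Pb => //; near: n; exists K => // n /= ?; exact: leqW.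
move: h1 h2 h3; move: (_ * expR _ ^+ n.+1) (2 * expR _ ^+ _) (8 / _ / _) => ? ? ?.
move: (theta _ _) (Pb _ n.+1) (Pb _ K) => ? ? ?; lra.
Unshelve. all: by end_near. Qed.

(** Each missing factor is inverted as (1 + b) / (1 - b) = 1 + 2 b / (1 - b) <= e^(2 b / (1 - q))
    with b a power of q, and the exponents form a geometric series. *)
Lemma Pb_tail q K M : 0 < q < 1 -> (K <= M)%N ->
  Pb q K <= Pb q M * expR (2 * q ^+ K.+1 / (1 - q) ^+ 2).
Proof.
move=> q01 le_KM; have /andP[q0 q1] := q01.
have q1' : 0 < 1 - q by lra.
suff H : Pb q K <= Pb q M * expR (2 / (1 - q) * ((q ^+ K.+1 - q ^+ M.+1) / (1 - q))).
  apply: le_trans H _; rewrite ler_wpM2l ?(ltW (Pb_gt0 _ _ _)) // ler_expR.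
  rewrite (_ : 2 * q ^+ K.+1 / (1 - q) ^+ 2 = 2 / (1 - q) * (q ^+ K.+1 / (1 - q))); last first.
    by field; rewrite gt_eqF.
  rewrite ler_wpM2l ?divr_ge0 ?(ltW q1') // ler_wpM2r ?invr_ge0 ?(ltW q1') //.
  by rewrite lerBlDr lerDl exprn_ge0 // ltW.
move: le_KM => /subnK <-; elim: (M - K)%N => [|j IHj].
  by rewrite subrr mul0r mulr0 expR0 mulr1.
rewrite addSn PbS; apply: le_trans IHj _.
set a := q ^+ K.+1; set b := q ^+ (j + K).+1; set P := Pb _ _.
have P0 : 0 < P by exact: Pb_gt0.
have b0 : 0 < b by rewrite exprn_gt0.
have bq : b <= q by rewrite -[leRHS]expr1 ler_wiXn2l // ltW.
have -> : q ^+ (j + K).+2 = q * b by rewrite exprS.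
rewrite -(mulrA P) ler_wpM2l ?(ltW P0) //.
have -> : 2 / (1 - q) * ((a - q * b) / (1 - q)) = 2 / (1 - q) * ((a - b) / (1 - q)) + 2 / (1 - q) * b.
  by field; rewrite gt_eqF.
rewrite expRD; set E1 := expR (_ * (_ / _)).
rewrite [leRHS](mulrCA _ E1) ler_peMr ?expR_ge0 //.
have h : (1 + b) / (1 - b) <= expR (2 / (1 - q) * b).
  apply: (@le_trans _ _ (expR (2 / (1 - b) * b))).
    apply: le_trans (expR_ge1Dx _).
    by rewrite le_eqVlt; apply/orP; left; apply/eqP; field; rewrite gt_eqF //; lra.
  rewrite ler_expR ler_wpM2r ?(ltW b0) // ler_wpM2l // lef_pV2 ?posrE; lra.
have e0 : 0 < (1 - b) / (1 + b) by rewrite divr_gt0 //; lra.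
apply: le_trans (ler_wpM2l (ltW e0) h).
by rewrite le_eqVlt; apply/orP; left; apply/eqP; field; rewrite !gt_eqF //; lra.
Qed.

Lemma Pb_upper t K : 0 < t ->
  Num.sqrt (t / pi) * Pb (expR (- t)) K <=
   2 * (expR (- (pi ^+ 2 / (4 * t))) / (1 - expR (- (8 * (pi ^+ 2 / (4 * t))))))
    * expR (2 * expR (- t) ^+ K.+1 / (1 - expR (- t)) ^+ 2).
Proof.
move=> t0; have q01 := expRN_01 t t0.
set U := 2 * _; set T := expR (2 * _ / _).
have cv : (fun n => (U + Num.sqrt (t / pi) * (8 / t ^+ 2 * n.+1%:R^-1)) * T) @ \oo
    --> (U + Num.sqrt (t / pi) * 0) * T.
  apply: cvgM; last exact: cvg_cst.
  apply: cvgD; first exact: cvg_cst.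
  by apply: cvgM; [exact: cvg_cst | exact: inv_error_cvg].
rewrite mulr0 addr0 in cv.
apply: (ler_cvg_to (cvg_cst _) cv); near=> n.
have h0 : (K <= n.+1)%N by near: n; exists K => // n /= ?; exact: leqW.
apply: le_trans (ler_wpM2l (sqrtr_ge0 _) (Pb_tail _ _ _ q01 h0)) _.
rewrite mulrA ler_wpM2r ?expR_ge0 //.
have h1 := theta_upper t t0 n.+1.
have := theta_Pb (expR (- t)) n.+1 q01; rewrite ler_norml => /andP[h3 _].
have h2 := gauss_error_le t n t0.
rewrite -/U in h1; rewrite -lerBlDr; apply: le_trans h1.
rewrite -mulrBr ler_wpM2l ?sqrtr_ge0 //.
move: h2 h3; move: (_ * expR _ ^+ n.+1) (2 * expR _ ^+ _) (8 / _ / _) => ? ? ?.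
move: (theta _ _) (Pb _ n.+1) => ? ?; lra.
Unshelve. all: by end_near. Qed.

(** This is ln coth(x / 2). *)
Definition lncoth x : R := ln ((1 + expR (- x)) / (1 - expR (- x))).
Definition Lam K t : R := \sum_(k < K) lncoth (k.+1%:R * t).

Lemma Pb_Lam K t : 0 < t -> Pb (expR (- t)) K = expR (- Lam K t).
Proof.
move=> t0; rewrite /Lam -sumrN expR_sum; apply: eq_bigr => k _.
have /andP[q0 q1] : 0 < expR (- (k.+1%:R * t)) < 1 by apply: expRN_01; rewrite mulr_gt0.
rewrite expRN_natX (expRN (lncoth _)) /lncoth lnK ?invf_div //.
by rewrite posrE divr_gt0 //; lra.
Qed.

(** Minus the logarithm of 2 sqrt(pi / t) e^(- pi^2 / (4 t)), the size of the infinite product. *)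
Definition main_term t : R := pi ^+ 2 / (4 * t) + ln (t / (4 * pi)) / 2.

Lemma ln_sqrt x : 0 < x -> ln (Num.sqrt x) = ln x / 2 :> R.
Proof.
move=> x0; rewrite -[in RHS](sqr_sqrtr (ltW x0)) lnXn ?sqrtr_gt0 //.
by rewrite -[ln _ *+ 2]mulr_natr mulfK // pnatr_eq0.
Qed.

Lemma main_ln t : 0 < t ->
  main_term t = pi ^+ 2 / (4 * t) + ln (Num.sqrt (t / pi)) - ln 2.
Proof.
move=> t0; have p0 := pi_gt0 R; rewrite ln_sqrt ?divr_gt0 // /main_term.
have -> : t / (4 * pi) = t / pi / (2 ^+ 2).
  by rewrite -[RHS]mulrA -invfM; congr (_ / _); ring.
rewrite [ln (_ / _ / _)]ln_div ?posrE ?divr_gt0 // lnXn // mulrBl -[ln _ *+ 2]mulr_natr.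
by rewrite mulfK ?pnatr_eq0 // addrA.
Qed.

Lemma Lam_le_main K t : 0 < t -> Lam K t <= main_term t.
Proof.
move=> t0; have s0 : 0 < Num.sqrt (t / pi) by rewrite sqrtr_gt0 divr_gt0 // pi_gt0.
have := Pb_lower t K t0; rewrite Pb_Lam // -ler_ln ?posrE ?mulr_gt0 ?expR_gt0 //.
by rewrite !lnM ?posrE ?expR_gt0 // !expRK main_ln //; lra.
Qed.

(** For K >= 1 / (16 t^2) the exponent K t is at least 1 / (16 t), so q^(K+1) is O(t^3) and
    outweighs the factor (1 - q)^(-2) of [Pb_tail], leaving O(t). The 16 anticipates two difference
    quotients: each evaluates at points u >= t / 2 and so costs a factor 4, from 1 / t^2 for [Var]
    and 1 / (4 t^2) for [Mean]. *)
Lemma main_le_Lam : exists2 C : R, 0 <= C &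
  forall t K, 0 < t <= 1 -> 1 / (16 * t ^+ 2) <= K%:R -> main_term t - C * t <= Lam K t.
Proof.
exists (48 * 16 ^+ 3 + 1); first by rewrite addr_ge0 // mulr_ge0 // exprn_ge0.
move=> t K /andP[t0 t1] le_K.
have p0 := pi_gt0 R; have p2 := pi_ge2 R.
have s0 : 0 < Num.sqrt (t / pi) by rewrite sqrtr_gt0 divr_gt0.
set A := pi ^+ 2 / (4 * t).
have A0 : 0 < A by rewrite divr_gt0 ?mulr_gt0 ?exprn_gt0.
have At : 1 / t <= A.
  rewrite (_ : A = pi ^+ 2 / 4 * (1 / t)); last by rewrite /A; field; rewrite gt_eqF.
  by rewrite ler_peMl ?divr_ge0 ?(ltW t0) // ler_pdivlMr //; nra.
set z := expR (- (8 * A)).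
have z0 : 0 < z by exact: expR_gt0.
have zt : z <= t / 8.
  have A8 : 0 < 8 * A by exact: mulr_gt0.
  apply: le_trans (expRN_pow_le _ 0 A8) _.
  rewrite expr1 ler_pdivrMr // (_ : t / 8 * (8 * A) = A * t); last by field.
  by rewrite -ler_pdivrMr.
have lnz : - t <= ln (1 - z).
  have z2 : - 2^-1 <= - z by lra.
  have /andP[h _] := ln1D_bounds (- z) z2.
  by apply: le_trans h; nra.
have := Pb_upper t K t0; rewrite Pb_Lam // -/A -/z.
set q := expR (- t); set T := 2 * q ^+ K.+1 / _.
have TC : T <= 48 * 16 ^+ 3 * t.
  have q1 : t / 2 <= 1 - q.
    have := expRN_le t; rewrite -/q => /(_ (lt_trans (ltrN10 _) t0)).
    have : (1 + t)^-1 <= 1 - t / 2 by rewrite -[leLHS]mul1r ler_pdivrMr; nra.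
    by lra.
  have qK : q ^+ K.+1 <= 6 * 16 ^+ 3 * t ^+ 3.
    rewrite /q expRN_natX.
    apply: (@le_trans _ _ (expR (- (1 / (16 * t))))).
      rewrite ler_expR lerN2 (_ : K.+1%:R * t = K%:R * t + t); last by rewrite -natr1 mulrDl mul1r.
      apply: (@le_trans _ _ (K%:R * t)); last by rewrite lerDl ltW.
      apply: le_trans (ler_wpM2r (ltW t0) le_K).
      by rewrite le_eqVlt; apply/orP; left; apply/eqP; field; rewrite gt_eqF.
    apply: le_trans (expRN_pow_le _ 2 _) _; first by rewrite divr_gt0 ?mulr_gt0.
    rewrite (_ : 3`!%:R = 6) //.
    by rewrite le_eqVlt; apply/orP; left; apply/eqP; field; rewrite gt_eqF.
  rewrite /T ler_pdivrMr; last by rewrite exprn_gt0 //; lra.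
  apply: (@le_trans _ _ (2 * (6 * 16 ^+ 3 * t ^+ 3))); first by rewrite ler_wpM2l.
  apply: (@le_trans _ _ (48 * 16 ^+ 3 * t * (t / 2) ^+ 2)).
    by rewrite le_eqVlt; apply/orP; left; apply/eqP; field.
  rewrite ler_wpM2l ?mulr_ge0 ?exprn_ge0 ?(ltW t0) // lerXn2r ?nnegrE //; lra.
have z1 : 0 < 1 - z by lra.
have g0 : 0 < 2 * (expR (- A) / (1 - z)) by rewrite mulr_gt0 // divr_gt0 // expR_gt0.
rewrite -ler_ln ?posrE ?(mulr_gt0 s0) ?(mulr_gt0 g0) ?expR_gt0 //.
rewrite (lnM s0) ?posrE ?expR_gt0 // (lnM g0) ?posrE ?expR_gt0 //.
rewrite (@lnM _ 2) ?posrE ?divr_gt0 ?expR_gt0 //.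
rewrite (ln_div _ z1) ?posrE ?expR_gt0 //.
rewrite !expRK main_ln // -/A; lra.
Qed.

(** 1 / sinh x; its product with coth x is [csch_coth]. Up to sign they are the first and second
    derivatives of [lncoth]. *)
Definition csch x : R := 2 * expR (- x) / (1 - expR (- x) ^+ 2).
Definition csch_coth x : R := 2 * expR (- x) * (1 + expR (- x) ^+ 2) / (1 - expR (- x) ^+ 2) ^+ 2.

Lemma is_derive_lncoth x : 0 < x -> is_derive x 1 lncoth (- csch x).
Proof.
move=> x0; have /andP[e0 e1] := expRN_01 x x0.
have p0 : 0 < (1 + expR (- x)) / (1 - expR (- x)) by rewrite divr_gt0 //; lra.
have d0 : 1 - expR (- x) != 0 by rewrite gt_eqF //; lra.
have dl := is_derive1_ln p0.
rewrite /lncoth; apply: is_derive_eq; rewrite /GRing.scale /= /csch.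
have d1 : 1 + expR (- x) != 0 by rewrite gt_eqF //; lra.
have d2 : 1 - expR (- x) ^+ 2 != 0 by rewrite gt_eqF //; nra.
move: (expR (- x)) d0 d1 d2 => e d0 d1 d2; field.
by rewrite d0 d1 d2.
Qed.

Lemma is_derive_csch x : 0 < x -> is_derive x 1 csch (- csch_coth x).
Proof.
move=> x0; have /andP[e0 e1] := expRN_01 x x0.
have d0 : 1 - expR (- x) ^+ 2 != 0 by rewrite gt_eqF //; nra.
rewrite /csch; apply: is_derive_eq; rewrite /GRing.scale /= /csch_coth.
by move: (expR (- x)) d0 => e d0; field; rewrite d0.
Qed.

Lemma csch_anti x y : 0 < x -> x <= y -> csch y <= csch x.
Proof.
move=> x0 xy; have /andP[e0 e1] := expRN_01 x x0.
have f0 := expR_gt0 (- y); have ef : expR (- y) <= expR (- x) by rewrite ler_expR lerN2.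
rewrite /csch; move: (expR (- x)) (expR (- y)) e0 e1 f0 ef => a b a0 a1 b0 ba.
have b2 : b ^+ 2 <= a ^+ 2 by rewrite lerXn2r ?nnegrE // ltW.
have a2 : a ^+ 2 < 1 by rewrite exprn_ilt1 // ltW.
apply: ler_pM; rewrite ?invr_ge0 ?mulr_ge0 ?subr_ge0 //; try lra.
by rewrite lef_pV2 ?posrE; lra.
Qed.

Lemma csch_coth_anti x y : 0 < x -> x <= y -> csch_coth y <= csch_coth x.
Proof.
move=> x0 xy; have /andP[e0 e1] := expRN_01 x x0.
have f0 := expR_gt0 (- y); have ef : expR (- y) <= expR (- x) by rewrite ler_expR lerN2.
rewrite /csch_coth; move: (expR (- x)) (expR (- y)) e0 e1 f0 ef => a b a0 a1 b0 ba.
have b2 : b ^+ 2 <= a ^+ 2 by rewrite lerXn2r ?nnegrE // ltW.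
have a2 : a ^+ 2 < 1 by rewrite exprn_ilt1 // ltW.
have b20 : 0 <= b ^+ 2 by exact: sqr_ge0.
apply: ler_pM.
- by rewrite !mulr_ge0 ?addr_ge0 // ltW.
- by rewrite invr_ge0 sqr_ge0.
- by apply: ler_pM; rewrite ?mulr_ge0 ?addr_ge0 ?(ltW b0) //; lra.
rewrite lef_pV2 ?posrE ?exprn_gt0 ?subr_gt0 //; last by lra.
by rewrite lerXn2r ?nnegrE; lra.
Qed.

(** The mean value theorem for a convex decreasing shape: the slope of a chord lies between the
    slopes at its ends. Summed with weights, it serves [Lam] and then [Mean]. *)
Lemma anti_tangent (f g : R -> R) : (forall x, 0 < x -> is_derive x 1 f (- g x)) ->
    (forall x y, 0 < x -> x <= y -> g y <= g x) ->
  forall x y, 0 < x -> x <= y -> g y * (y - x) <= f x - f y <= g x * (y - x).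
Proof.
move=> df ga x y x0; rewrite le_eqVlt => /orP[/eqP <-|xy].
  by rewrite !subrr !mulr0 lexx.
have [||c] := @MVT R f (fun x => - g x) x y xy.
- by move=> z; rewrite in_itv /= => /andP[? _]; apply: df; exact: lt_trans x0 _.
- apply: derivable_within_continuous => z; rewrite in_itv /= => /andP[h _].
  by have [] := df z (lt_le_trans x0 h).
rewrite in_itv /= => /andP[c1 c2] E.
have -> : f x - f y = g c * (y - x) by rewrite -opprB E mulNr opprK.
have yx0 : 0 <= y - x by rewrite subr_ge0 ltW.
rewrite !ler_wpM2r ?ga //; try exact: ltW.
exact: lt_trans x0 c1.
Qed.

Definition Mean K t : R := \sum_(k < K) k.+1%:R * csch (k.+1%:R * t).
Definition Var K t : R := \sum_(k < K) k.+1%:R ^+ 2 * csch_coth (k.+1%:R * t).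

Lemma sum_tangent (f g : R -> R) (c : nat -> R) K :
    (forall x, 0 < x -> is_derive x 1 f (- g x)) ->
    (forall x y, 0 < x -> x <= y -> g y <= g x) -> (forall k, 0 <= c k) ->
  forall s t, 0 < s -> s <= t ->
  (\sum_(k < K) c k * (k.+1%:R * g (k.+1%:R * t))) * (t - s)
     <= \sum_(k < K) c k * f (k.+1%:R * s) - \sum_(k < K) c k * f (k.+1%:R * t)
     <= (\sum_(k < K) c k * (k.+1%:R * g (k.+1%:R * s))) * (t - s).
Proof.
move=> df ga c0 s t s0 st; rewrite -sumrB !mulr_suml.
have H k : g (k.+1%:R * t) * (k.+1%:R * t - k.+1%:R * s) <= f (k.+1%:R * s) - f (k.+1%:R * t)
    <= g (k.+1%:R * s) * (k.+1%:R * t - k.+1%:R * s).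
  by apply: (anti_tangent f g df ga); rewrite ?mulr_gt0 // ler_wpM2l.
apply/andP; split; apply: ler_sum => k _; rewrite -mulrBr -mulrA ler_wpM2l //.
  by have /andP[h _] := H k; apply: le_trans h; rewrite -mulrBr mulrAC mulrC mulrA mulrAC -mulrA mulrC.
by have /andP[_ h] := H k; apply: le_trans h _; rewrite -mulrBr mulrCA mulrA.
Qed.

Lemma Lam_tangent K s t : 0 < s -> s <= t ->
  Mean K t * (t - s) <= Lam K s - Lam K t <= Mean K s * (t - s).
Proof.
move=> s0 st; have := sum_tangent lncoth csch (fun=> 1) K is_derive_lncoth csch_anti (fun=> ler01) s t s0 st.
have E F : \sum_(k < K) 1 * F k = \sum_(k < K) F k :> R by apply: eq_bigr => k _; rewrite mul1r.
by rewrite !E.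
Qed.

Lemma Mean_tangent K s t : 0 < s -> s <= t ->
  Var K t * (t - s) <= Mean K s - Mean K t <= Var K s * (t - s).
Proof.
move=> s0 st.
have := sum_tangent csch csch_coth (fun k => k.+1%:R) K is_derive_csch csch_coth_anti (fun k => ler0n _ _) s t s0 st.
have E u : \sum_(k < K) k.+1%:R * (k.+1%:R * csch_coth (k.+1%:R * u)) = Var K u.
  by apply: eq_bigr => k _; rewrite mulrA -expr2.
by rewrite !E.
Qed.

Lemma main_diff s t : 0 < s -> 0 < t ->
  main_term s - main_term t = pi ^+ 2 / 4 * ((t - s) / (s * t)) + ln (s / t) / 2.
Proof.
move=> s0 t0; have p0 : 0 < 4 * pi :> R by rewrite mulr_gt0 // pi_gt0.
rewrite /main_term !ln_div ?posrE //; field; rewrite !gt_eqF //.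
Qed.

(* Lam is convex with derivative - Mean, so Mean t lies between the difference
   quotients of Lam at t with steps t^2 and - t^2. *)
Lemma Mean_estimate : exists2 D : R, 0 <= D &
  forall t K, 0 < t <= 2^-1 -> 1 / (4 * t ^+ 2) <= K%:R ->
    `|Mean K t - pi ^+ 2 / (4 * t ^+ 2)| <= D / t.
Proof.
have [C C0 HC] := main_le_Lam; exists (C * 2 + 1 + pi ^+ 2).
  by rewrite !addr_ge0 ?sqr_ge0 ?mulr_ge0.
move=> t K /andP[t0 t2] le_K; have p2 : 0 <= pi ^+ 2 :> R by exact: sqr_ge0.
have lnle (y : R) : 0 < y -> ln y <= y - 1.
  move=> y0; rewrite -[y in ln y](subrK 1) addrC; apply: le_ln1Dx; lra.
(* This step balances two errors of order 1 / t: the uncertainty C t of [Lam] divided by s, and s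
   times the second derivative, of order t^(-3), of pi^2 / (4 t). *)
set s := t ^+ 2; have s0 : 0 < s by rewrite exprn_gt0.
have st : s <= t / 2 by rewrite /s; nra.
have tms : 0 < t - s by lra.
have Kge (u : R) : t / 2 <= u -> 1 / (16 * u ^+ 2) <= K%:R.
  move=> u2; have u0 : 0 < u by lra.
  apply: le_trans le_K; rewrite !div1r lef_pV2 ?posrE ?mulr_gt0 ?exprn_gt0 //.
  have : (t / 2) ^+ 2 <= u ^+ 2 by rewrite lerXn2r ?nnegrE //; lra.
  by lra.
have ub : Mean K t * s <= pi ^+ 2 / 4 * (s / ((t - s) * t)) + C * t.
  have := Lam_tangent K (t - s) t tms; rewrite (_ : t - (t - s) = s); last by ring.
  move=> /(_ (ltW _))/andP[]; first by lra.
  have l1 := Lam_le_main K (t - s) tms.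
  have l2 : main_term t - C * t <= Lam K t by apply: HC; [lra | apply: Kge; lra].
  have := main_diff (t - s) t tms t0; rewrite (_ : t - (t - s) = s); last by ring.
  have : ln ((t - s) / t) <= 0 by apply: ln_le0; rewrite ler_pdivrMr //; lra.
  lra.
have lb : pi ^+ 2 / 4 * (s / (t * (t + s))) - t / 2 - C * t * 2 <= Mean K t * s.
  have ts0 : 0 < t + s by lra.
  have := Lam_tangent K t (t + s) t0; rewrite (_ : t + s - t = s); last by ring.
  move=> /(_ _)/andP[]; first by lra.
  have l1 := Lam_le_main K (t + s) ts0.
  have l2 : main_term t - C * t <= Lam K t by apply: HC; [lra | apply: Kge; lra].
  have := main_diff t (t + s) t0 ts0; rewrite (_ : t + s - t = s); last by ring.
  have : - t <= ln (t / (t + s)).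
    rewrite -[t / _]invrK lnV ?posrE ?invr_gt0 ?divr_gt0 // lerN2 invf_div.
    apply: le_trans (lnle _ _) _; first by rewrite divr_gt0.
    by rewrite mulrDl divff ?gt_eqF // addrAC subrr add0r /s expr2 mulfK // gt_eqF.
  have : 0 <= C * t by rewrite mulr_ge0 // ltW.
  lra.
have e1 : s / ((t - s) * t) <= 1 + 2 * t.
  rewrite ler_pdivrMr ?mulr_gt0 // /s; nra.
have e2 : 1 - t <= s / (t * (t + s)).
  rewrite ler_pdivlMr ?mulr_gt0 //; last by lra.
  by rewrite /s; nra.
have P1 := ler_wpM2l (divr_ge0 p2 (ler0n R 4)) e1.
have P2 := ler_wpM2l (divr_ge0 p2 (ler0n R 4)) e2.
have -> : Mean K t - pi ^+ 2 / (4 * t ^+ 2) = (Mean K t * s - pi ^+ 2 / 4) / s.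
  by rewrite /s; field; rewrite gt_eqF.
have -> : (C * 2 + 1 + pi ^+ 2) / t = (C * 2 + 1 + pi ^+ 2) * t / s.
  by rewrite /s; field; rewrite gt_eqF.
rewrite normrM normfV (gtr0_norm s0) ler_wpM2r ?invr_ge0 ?(ltW s0) //.
have Ct : 0 <= C * t by rewrite mulr_ge0 // ltW.
have pt : 0 <= pi ^+ 2 * t by rewrite mulr_ge0 // ltW.
rewrite ler_norml; apply/andP; split; lra.
Qed.

(* Likewise Var = - Mean' at t = r^2, with steps r^3 and - r^3. *)
Lemma Var_estimate : exists2 D : R, 0 <= D &
  forall r K, 0 < r <= 2^-1 -> 1 / (r ^+ 4) <= K%:R ->
    pi ^+ 2 / 4 * ((2 + r) / (1 + r) ^+ 2) - D * r <= r ^+ 6 * Var K (r ^+ 2)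
    <= pi ^+ 2 / 4 * ((2 - r) / (1 - r) ^+ 2) + D * r.
Proof.
have [D D0 HD] := Mean_estimate; exists (3 * D); first by rewrite mulr_ge0.
move=> r K /andP[r0 r2] le_K.
have r20 : 0 < r ^+ 2 by rewrite exprn_gt0.
have rr : r ^+ 2 <= 2^-1 * r by rewrite expr2 ler_wpM2r // ltW.
(* The same balance one order higher: the error D / t of [Mean] over a step t^(3/2), against a
   curvature of order t^(-4) times the step, are both t^(-5/2), a relative error of order r = sqrt
   t. *)
set t := r ^+ 2; set s := r ^+ 3; have s0 : 0 < s by rewrite exprn_gt0.
have tE : s = t * r by rewrite /s /t exprSr.
have st : s <= t / 2 by rewrite tE ler_wpM2l // ltW.
have t0 : 0 < t by [].
have t4 : t <= 4^-1 by rewrite /t; nra.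
have r4 : r ^+ 4 = t ^+ 2 by rewrite /t -exprM.
have Kge (u : R) : t / 2 <= u -> 1 / (4 * u ^+ 2) <= K%:R.
  move=> u2; have u0 : 0 < u by lra.
  apply: le_trans le_K; rewrite !div1r lef_pV2 ?posrE ?mulr_gt0 ?exprn_gt0 //.
  have : (t / 2) ^+ 2 <= u ^+ 2 by rewrite lerXn2r ?nnegrE //; lra.
  by rewrite r4; lra.
have Mest (u : R) : t / 2 <= u -> u <= 2^-1 -> `|Mean K u - pi ^+ 2 / (4 * u ^+ 2)| <= D / u.
  by move=> u1 u2; apply: HD; [lra | exact: Kge].
have Du (u : R) : t / 2 <= u -> D / u <= 2 * D / t.
  move=> u1; have u0 : 0 < u by lra.
  by rewrite ler_pdivrMr // mulrAC ler_pdivlMr //; nra.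
have rn0 : r != 0 by rewrite gt_eqF.
have r1n : 1 - r != 0 by rewrite gt_eqF //; lra.
have r1p : 1 + r != 0 by rewrite gt_eqF //; lra.
have M0 : `|Mean K t - pi ^+ 2 / (4 * t ^+ 2)| <= D / t by apply: Mest; lra.
have M1 : `|Mean K (t - s) - pi ^+ 2 / (4 * (t - s) ^+ 2)| <= 2 * D / t.
  by apply: le_trans (Du (t - s) _); [apply: Mest |]; lra.
have M2 : `|Mean K (t + s) - pi ^+ 2 / (4 * (t + s) ^+ 2)| <= 2 * D / t.
  by apply: le_trans (Du (t + s) _); [apply: Mest |]; lra.
have w0 : 0 <= r ^+ 3 by exact: ltW.
have Dr : r ^+ 3 * (3 * D / t) = 3 * D * r by rewrite /t; field.
have E6 : r ^+ 6 * Var K t = r ^+ 3 * (Var K t * s) by rewrite /s; ring.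
have eu : r ^+ 3 * (pi ^+ 2 / (4 * (t - s) ^+ 2) - pi ^+ 2 / (4 * t ^+ 2))
    = pi ^+ 2 / 4 * ((2 - r) / (1 - r) ^+ 2).
  rewrite tE /t (_ : r ^+ 2 - r ^+ 2 * r = r ^+ 2 * (1 - r)); last by ring.
  by field; rewrite rn0 r1n.
have el : r ^+ 3 * (pi ^+ 2 / (4 * t ^+ 2) - pi ^+ 2 / (4 * (t + s) ^+ 2))
    = pi ^+ 2 / 4 * ((2 + r) / (1 + r) ^+ 2).
  rewrite tE /t (_ : r ^+ 2 + r ^+ 2 * r = r ^+ 2 * (1 + r)); last by ring.
  by field; rewrite rn0 r1p.
move: M0 M1 M2; rewrite !ler_norml => /andP[M0 M0'] /andP[M1 M1'] /andP[M2 M2'].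
rewrite -eu -el -Dr E6 -(mulrBr _ _ (3 * D / t)) -(mulrDr _ _ (3 * D / t)) -(mulrA 3 D); move: M0 M0' M1 M1' M2 M2'.
rewrite -(mulrA 2 D).
have : Var K t * s <= Mean K (t - s) - Mean K t.
  have := Mean_tangent K (t - s) t; rewrite (_ : t - (t - s) = s); last by ring.
  by move=> /(_ _ _)/andP[] //; lra.
have : Mean K t - Mean K (t + s) <= Var K t * s.
  have := Mean_tangent K t (t + s) t0; rewrite (_ : t + s - t = s); last by ring.
  by move=> /(_ _)/andP[] //; lra.
move: (pi ^+ 2 / (4 * t ^+ 2)) (pi ^+ 2 / (4 * (t - s) ^+ 2)) (pi ^+ 2 / (4 * (t + s) ^+ 2)).
move: (D / t) (Var K t * s) (Mean K t) (Mean K (t - s)) (Mean K (t + s)).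
clear -w0 => W V m1 m2 m3 X Y Z H1 H2 H3 H4 H5 H6 H7 H8.
by apply/andP; split; rewrite ler_wpM2l //; lra.
Qed.

End Log.

(** * Expansion at the saddle point *)

Section Factors.
Context {R : realType}.
Implicit Types (p a x t : R) (k m K : nat).

(** The modulus of 1 - p e^(ia) relative to its value at a = 0; p = - q^k serves the factors 1 +
    q^k. *)
Definition eta p a : R := dmod p a / (1 - p).

Lemma subr1_norm p : `|p| < 1 -> 0 < 1 - `|p| <= 1 - p.
Proof. by move=> p1; have := ler_norm p; lra. Qed.

Lemma sub1_cos_bounds a : 0 <= 1 - cos a <= a ^+ 2 / 2.
Proof. by have := cos_ge a; have := cos_le1 a; lra. Qed.

Lemma eta_gt0 p a : `|p| < 1 -> 0 < eta p a.
Proof. by move=> p1; rewrite divr_gt0 ?dmod_gt0 //; have := subr1_norm p p1; lra. Qed.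

Lemma eta_sqr p a : `|p| < 1 -> eta p a ^+ 2 = 1 + 2 * p * (1 - cos a) / (1 - p) ^+ 2.
Proof.
move=> p1; have /andP[_ d0] := subr1_norm p p1.
rewrite /eta expr_div_n /dmod sqr_sqrtr; first by field; lra.
have := @cos_le1 R a; have := cos_geN1 a; have := ler_norm p; have := ler_normr p (`|p|).
rewrite (_ : _ + _ = (1 - p * cos a) ^+ 2 + (p * sin a) ^+ 2) ?addr_ge0 ?sqr_ge0 //.
by rewrite exprMn sin2cos2; ring.
Qed.

Lemma ln_eta p a : `|p| < 1 -> ln (eta p a) = ln (1 + 2 * p * (1 - cos a) / (1 - p) ^+ 2) / 2.
Proof.
move=> p1; rewrite -eta_sqr // lnXn ?eta_gt0 // -[ln _ *+ 2]mulr_natr mulfK // pnatr_eq0.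
Qed.

(** Second-order expansions of cos and of ln(1 + y) for y = 2 p (1 - cos a) / (1 - p)^2. The error
    is written in |p| so that p and - p share one bound, with the factor |p| kept to make it
    summable over k. *)
Lemma ln_eta_approx p a : `|p| < 1 -> `|p| * (a / (1 - `|p|)) ^+ 2 <= 2^-1 ->
  `|ln (eta p a) - p * a ^+ 2 / (1 - p) ^+ 2 / 2| <= 2 * (`|p| * (a / (1 - `|p|)) ^+ 4).
Proof.
move=> p1; have /andP[d0 dD] := subr1_norm p p1; rewrite ln_eta //.
have D0 : 0 < 1 - p by lra.
have P0 : 0 <= `|p| by [].
have /andP[c0 c1] := sub1_cos_bounds a.
have c2 : a ^+ 2 / 2 - a ^+ 4 / 24 <= 1 - cos a by have := cos_le a; lra.
have H (u v : R) : `|u| <= v -> `|p * u / (1 - p) ^+ 2| <= `|p| * (v / (1 - `|p|) ^+ 2).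
  move=> uv; rewrite -mulrA normrM ler_wpM2l // normrM normfV (ger0_norm (sqr_ge0 (1 - p))).
  rewrite ler_pM ?invr_ge0 ?sqr_ge0 // lef_pV2 ?posrE ?exprn_gt0 //.
  by rewrite lerXn2r ?nnegrE // ltW.
have y1 := H (2 * (1 - cos a)) (a ^+ 2) _; rewrite mulrA (mulrC p 2) in y1.
have y10 := H (2 * (1 - cos a) - a ^+ 2) (a ^+ 4 / 12) _.
rewrite -expr_div_n in y1.
have {}y1 : `|2 * p * (1 - cos a) / (1 - p) ^+ 2| <= `|p| * (a / (1 - `|p|)) ^+ 2.
  by apply: y1; rewrite ger0_norm; lra.
have a40 : 0 <= a ^+ 4 by rewrite exprn_even_ge0.
have {}y10 : `|2 * p * (1 - cos a) / (1 - p) ^+ 2 - p * a ^+ 2 / (1 - p) ^+ 2|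
   <= `|p| * (a / (1 - `|p|)) ^+ 4 / 12.
  rewrite -mulrBl (_ : 2 * p * (1 - cos a) - _ = p * (2 * (1 - cos a) - a ^+ 2)); last by ring.
  apply: le_trans (y10 _) _; first by rewrite ler_norml; lra.
  rewrite -(mulrA `|p|) ler_wpM2l // expr_div_n mulrAC ler_wpM2r // ler_wpM2l //.
  rewrite lef_pV2 ?posrE ?exprn_gt0 // ler_wiXn2l //; lra.
move=> Y; have y2 : (2 * p * (1 - cos a) / (1 - p) ^+ 2) ^+ 2 <= `|p| * (a / (1 - `|p|)) ^+ 4.
  rewrite -real_normK ?num_real //.
  apply: (@le_trans _ _ ((`|p| * (a / (1 - `|p|)) ^+ 2) ^+ 2)).
    by rewrite lerXn2r ?nnegrE // (le_trans _ y1).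
  rewrite exprMn -exprM expr2 -mulrA ler_piMl ?(ltW p1) //.
  by rewrite mulr_ge0 // exprn_even_ge0.
have := ln1D_bounds (2 * p * (1 - cos a) / (1 - p) ^+ 2).
move: y1 y10 y2 Y; move: (2 * p * (1 - cos a) / (1 - p) ^+ 2) (p * a ^+ 2 / (1 - p) ^+ 2).
move: (`|p| * (a / (1 - `|p|)) ^+ 2) (`|p| * (a / (1 - `|p|)) ^+ 4) => w z u v.
rewrite !ler_norml => /andP[? ?] /andP[? ?] ? ? /(_ _)/andP[]; first by lra.
move=> ? ?; apply/andP; split; lra.
Qed.

Lemma darg_quot_le p a : `|p| < 1 -> `|p * sin a / (1 - p * cos a)| <= `|p| * `|a / (1 - `|p|)|.
Proof.
move=> p1; have /andP[d0 dD] := subr1_norm p p1.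
have e0 := den_gt0 p a p1.
have de : 1 - `|p| <= 1 - p * cos a.
  have : p * cos a <= `|p|.
    apply: le_trans (ler_norm _) _; rewrite normrM ler_piMr //.
    by rewrite ler_norml cos_geN1 cos_le1.
  by lra.
rewrite !normrM !normfV (gtr0_norm d0) (gtr0_norm e0) -mulrA ler_wpM2l //.
by rewrite ler_pM ?norm_sin_le ?invr_ge0 ?(ltW e0) // lef_pV2 ?posrE.
Qed.

Lemma norm_darg_le p a : `|p| < 1 -> `|a| <= 1 -> p <= 0 -> `|darg p a| <= `|a|.
Proof.
move=> p1 a1 p0; apply: le_trans (norm_atan_le _) _; have e0 := den_gt0 p a p1.
rewrite normrM normfV (gtr0_norm e0) ler_pdivrMr // normrM.
have c0 : 0 <= cos a.
  have := cos_ge a; have : a ^+ 2 <= 1 by rewrite -real_normK ?num_real // expr_le1.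
  by lra.
apply: (@le_trans _ _ (1 * `|a|)).
  by apply: ler_pM => //; [exact: ltW | exact: norm_sin_le].
by rewrite mulrC ler_wpM2l //; nra.
Qed.

Lemma darg_approx p a : `|p| < 1 ->
  `|darg p a - p * a / (1 - p)| <= 2 * (`|p| * `|a / (1 - `|p|)| ^+ 3).
Proof.
move=> p1; have /andP[d0 dD] := subr1_norm p p1.
have D0 : 0 < 1 - p by lra.
have P0 : 0 <= `|p| by [].
have e0 := den_gt0 p a p1.
have de : 1 - `|p| <= 1 - p * cos a.
  have : p * cos a <= `|p|.
    apply: le_trans (ler_norm _) _; rewrite normrM ler_piMr //.
    by rewrite ler_norml cos_geN1 cos_le1.
  by lra.
have zle := darg_quot_le p a p1.
have h1 : `|darg p a - p * sin a / (1 - p * cos a)| <= `|p| * `|a / (1 - `|p|)| ^+ 3.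
  apply: le_trans (atan_approx _) _.
  apply: (@le_trans _ _ ((`|p| * `|a / (1 - `|p|)|) ^+ 3)); first by rewrite lerXn2r ?nnegrE.
  rewrite exprMn ler_wpM2r ?exprn_ge0 // exprS ler_piMr // exprn_ile1 //; lra.
have h2 : `|p * sin a / (1 - p * cos a) - p * a / (1 - p)| <= `|p| * `|a / (1 - `|p|)| ^+ 3.
  have -> : p * sin a / (1 - p * cos a) - p * a / (1 - p) =
      p * ((sin a - a) / (1 - p * cos a) - p * a * (1 - cos a) / ((1 - p) * (1 - p * cos a))).
    by field; rewrite !gt_eqF.
  have s3 : `|sin a - a| <= `|a| ^+ 3 / 6.
    wlog a0 : a {zle h1 e0 de} / 0 <= a => [H|].
      case: (leP 0 a) => [/H //|a0].
      have -> : sin a - a = - (sin (- a) - (- a)) by rewrite sinN; ring.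
      by rewrite normrN -(normrN a); apply: H; lra.
    by have := sin_ge a a0; have := sin_le a a0; rewrite (ger0_norm a0) ler_norml; lra.
  have /andP[c0 c1] := sub1_cos_bounds a.
  rewrite normrM ler_wpM2l //; apply: le_trans (ler_normB _ _) _.
  have A30 : 0 <= `|a| ^+ 3 by rewrite exprn_ge0.
  have D3 : 0 < (1 - `|p|) ^+ 3 by rewrite exprn_gt0.
  have V1 : (1 - p * cos a)^-1 <= (1 - `|p|) ^- 3.
    rewrite lef_pV2 ?posrE // (le_trans _ de) // -[leRHS]expr1 ler_wiXn2l //; lra.
  have V2 : ((1 - p) * (1 - p * cos a))^-1 <= (1 - `|p|) ^- 3.
    rewrite lef_pV2 ?posrE ?mulr_gt0 // (@le_trans _ _ ((1 - `|p|) ^+ 2)) //.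
      rewrite ler_wiXn2l //; lra.
    rewrite expr2 ler_pM //; lra.
  rewrite !(normrM, normfV) (gtr0_norm D0) (gtr0_norm e0) (gtr0_norm d0) (ger0_norm c0).
  rewrite -[((1 - p) * _)^-1]/(_^-1) exprMn exprVn.
  have h3 : `|sin a - a| / (1 - p * cos a) <= `|a| ^+ 3 / 6 * (1 - `|p|) ^- 3.
    by rewrite ler_pM ?invr_ge0 // ltW.
  have h4 : `|p| * `|a| * (1 - cos a) / ((1 - p) * (1 - p * cos a)) <= `|a| ^+ 3 / 2 * (1 - `|p|) ^- 3.
    rewrite ler_pM ?invr_ge0 ?mulr_ge0 ?(ltW D0) ?(ltW e0) //.
    have := c1; rewrite -(@real_normK _ a) ?num_real //; move: (normr_ge0 a) P0 p1 => ? ? ? ?.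
    apply: (@le_trans _ _ (1 * `|a| * (1 - cos a))); last by nra.
    by rewrite ler_wpM2r // ler_wpM2r // ltW.
  have : 0 <= `|a| ^+ 3 * (1 - `|p|) ^- 3 by rewrite mulr_ge0 // invr_ge0 ltW.
  by lra.
have -> : darg p a - p * a / (1 - p) = (darg p a - p * sin a / (1 - p * cos a))
   + (p * sin a / (1 - p * cos a) - p * a / (1 - p)) by ring.
by apply: le_trans (ler_normD _ _) _; lra.
Qed.

Lemma quot_le x : 0 < x -> 0 <= x / (1 - expR (- x)) <= 1 + x.
Proof.
move=> x0; have /andP[e0 e1] := expRN_01 x x0; have d0 : 0 < 1 - expR (- x) by lra.
rewrite divr_ge0 ?(ltW x0) ?(ltW d0) //= ler_pdivrMr //.
have : expR (- x) * (1 + x) <= 1.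
  by rewrite -ler_pdivlMr ?div1r ?expRN_le //; lra.
lra.
Qed.

(** Half of the exponential decay absorbs the polynomial growth: x / (1 - e^(- x)) <= 1 + x <= 8
    e^(x / 8), whose fourth power is 8^4 e^(x / 2). *)
Lemma expRN_quot_le x n : 0 < x -> (n <= 4)%N ->
  expR (- x) * (x / (1 - expR (- x))) ^+ n <= 8 ^+ 4 * expR (- (x / 2)).
Proof.
move=> x0 n4; have /andP[h0 h1] := quot_le x x0.
have E : expR (- (x / 2)) = expR (- x) * expR (x / 8) ^+ 4.
  by rewrite -expRM_natl -expRD; congr expR; field.
rewrite E mulrCA -exprMn ler_wpM2l ?expR_ge0 //.
apply: (@le_trans _ _ ((1 + x) ^+ n)); first by rewrite lerXn2r ?nnegrE //; lra.
apply: (@le_trans _ _ ((1 + x) ^+ 4)); first by rewrite ler_weXn2l //; lra.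
rewrite lerXn2r ?nnegrE ?mulr_ge0 ?expR_ge0 //; first by lra.
by have := expR_ge1Dx (x / 8); lra.
Qed.

Lemma sum_expRN_le K t : 0 < t -> \sum_(k < K) expR (- (k.+1%:R * t)) <= 1 / t.
Proof.
move=> t0; have /andP[q0 q1] := expRN_01 t t0; have d0 : 0 < 1 - expR (- t) by lra.
suff H : \sum_(k < K) expR (- (k.+1%:R * t)) <= expR (- t) * (1 - expR (- t) ^+ K) / (1 - expR (- t)).
  apply: le_trans H _; rewrite ler_pdivrMr //.
  have : expR (- t) * (1 + t) <= 1 by rewrite -ler_pdivlMr ?div1r ?expRN_le //; lra.
  have : 0 <= expR (- t) ^+ K by rewrite exprn_ge0 // ltW.
  rewrite div1r (mulrC t^-1) ler_pdivlMr //.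
  by move: (expR (- t)) q0 (_ ^+ K) => q q0 Q Q0 H; have := mulr_ge0 (mulr_ge0 (ltW q0) (ltW t0)) Q0; lra.
elim: K => [|K IHK]; first by rewrite big_ord0 expr0 subrr mulr0 mul0r.
rewrite big_ord_recr /=; apply: le_trans (lerD IHK (lexx _)) _.
rewrite -expRN_natX exprS; move: (expR (- t)) (_ ^+ K) d0 => q Q d0.
by rewrite le_eqVlt; apply/orP; left; apply/eqP; field; rewrite gt_eqF.
Qed.

Lemma sum_lt_const K m (c : R) :
  \sum_(k < K) (if (m <= k)%N then 0 else c) = (minn m K)%:R * c.
Proof.
elim: K => [|K IHK]; first by rewrite big_ord0 minn0 mul0r.
rewrite big_ord_recr IHK /=; case: leqP => h.
  by rewrite addr0 (minn_idPl (leqW h)).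
by rewrite (minn_idPr h) -natr1 mulrDl mul1r.
Qed.

(* lnrho is the logarithm of amp at th relative to its value at 0, see [ampE]. *)
Definition lnrho m t K th : R :=
  \sum_(k < K) ((if (m <= k)%N then ln (eta (- expR (- (k.+1%:R * t))) (k.+1%:R * th)) else 0)
    - ln (eta (expR (- (k.+1%:R * t))) (k.+1%:R * th))).

Lemma ln_eta_neg_small p a : 0 <= p < 1 -> `|a| <= 1 -> `|ln (eta (- p) a)| <= a ^+ 2.
Proof.
move=> /andP[p0 p1] a1; rewrite ln_eta; last by rewrite normrN ger0_norm.
have a2 : a ^+ 2 <= 1 by rewrite -real_normK ?num_real // expr_le1.
have /andP[c0 c1] := sub1_cos_bounds a.
have p2 : 0 < (1 - - p) ^+ 2 by rewrite exprn_gt0 //; lra.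
have y0 : - (a ^+ 2 / 4) <= 2 * - p * (1 - cos a) / (1 - - p) ^+ 2.
  rewrite ler_pdivlMr //; have h1 : 0 <= p * (a ^+ 2 / 2 - (1 - cos a)) by rewrite mulr_ge0 // subr_ge0.
  have h2 := mulr_ge0 (sqr_ge0 a) (sqr_ge0 (1 - p)); lra.
have y1 : 2 * - p * (1 - cos a) / (1 - - p) ^+ 2 <= 0.
  by rewrite ler_pdivrMr // mul0r; nra.
have := ln1D_bounds (2 * - p * (1 - cos a) / (1 - - p) ^+ 2).
move: (_ / _ ^+ 2) y0 y1 => y y0 y1 /(_ _)/andP[]; first by lra.
by move=> h1 h2; rewrite ler_norml; nra.
Qed.

Lemma sum_expRN_half_le K t : 0 < t -> \sum_(k < K) expR (- (k.+1%:R * t / 2)) <= 2 / t.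
Proof.
move=> t0; have := @sum_expRN_le K (t / 2) (divr_gt0 t0 (ltr0n _ 2)).
rewrite div1r invf_div; under eq_bigr do rewrite mulrA; exact.
Qed.

Lemma quot_scale k t th : 0 < t ->
  k.+1%:R * th / (1 - expR (- (k.+1%:R * t)))
   = th / t * (k.+1%:R * t / (1 - expR (- (k.+1%:R * t)))).
Proof.
move=> t0; have /andP[_ e1] := expRN_01 (k.+1%:R * t) (mulr_gt0 (ltr0n _ k.+1) t0).
by field; rewrite !gt_eqF //; lra.
Qed.

(** Each of the m factors with k < m lacks its numerator term, of size O((m th)^2); the quartic
    remainders sum to O((th / t)^4 / t). For m of order t^(-1/2) and th of order t^(3/2) these
    errors are of order t^(3/2) and t. *)
Lemma lnrho_estimate m K t th : 0 < t -> 8 ^+ 4 * (th / t) ^+ 2 <= 2^-1 -> m%:R * `|th| <= 1 ->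
  `|lnrho m t K th + Var K t * th ^+ 2 / 2| <= m%:R * (m%:R * th) ^+ 2 + 8 * 8 ^+ 4 * (th / t) ^+ 4 / t.
Proof.
move=> t0 dle mth; set d := th / t in dle *.
have d40 : 0 <= d ^+ 4 by rewrite exprn_even_ge0.
have Q0 : 0 <= 8 ^+ 4 :> R by rewrite exprn_ge0.
rewrite /lnrho /Var -mulrA mulr_suml -big_split /=.
apply: le_trans (ler_norm_sum _ _ _) _.
apply: (@le_trans _ _ (\sum_(k < K) ((if (m <= k)%N then 0 else (m%:R * th) ^+ 2)
    + 4 * 8 ^+ 4 * d ^+ 4 * expR (- (k.+1%:R * t / 2))))); last first.
  rewrite big_split /= sum_lt_const -mulr_sumr lerD //.
    by rewrite ler_wpM2r ?sqr_ge0 // ler_nat geq_minl.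
  apply: le_trans (ler_wpM2l _ (sum_expRN_half_le K t t0)) _.
    by rewrite mulr_ge0 // mulr_ge0.
  by rewrite le_eqVlt; apply/orP; left; apply/eqP; field; rewrite gt_eqF.
apply: ler_sum => k _.
have x0 : 0 < k.+1%:R * t by rewrite mulr_gt0.
have /andP[p0 p1] := expRN_01 _ x0.
have h2 := expRN_quot_le _ 2 x0 isT; have h4 := expRN_quot_le _ 4 x0 isT.
have sc := quot_scale k t th t0; rewrite -/d in sc.
have e1 : expR (- (k.+1%:R * t / 2)) <= 1 by have /andP[_ /ltW] := expRN_01 _ (divr_gt0 x0 (ltr0n _ 2)).
(* The term of [Var] is the difference of the quadratic terms of [ln_eta_approx] at p and at - p. *)
have vE : k.+1%:R ^+ 2 * csch_coth (k.+1%:R * t) * (th ^+ 2 / 2) =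
   expR (- (k.+1%:R * t)) * (k.+1%:R * th) ^+ 2 / (1 - expR (- (k.+1%:R * t))) ^+ 2 / 2
   - (- expR (- (k.+1%:R * t))) * (k.+1%:R * th) ^+ 2 / (1 - - expR (- (k.+1%:R * t))) ^+ 2 / 2.
  rewrite /csch_coth; move: (expR (- _)) p0 p1 => p p0 p1; field.
  by rewrite !gt_eqF //; nra.
rewrite vE; set p := expR (- (k.+1%:R * t)) in p0 p1 h2 h4 sc *; set a := k.+1%:R * th in sc *.
have np : `|p| = p by rewrite ger0_norm // ltW.
have Y : `|p| * (a / (1 - `|p|)) ^+ 2 <= 2^-1.
  rewrite np sc exprMn mulrCA; apply: le_trans (ler_wpM2l (sqr_ge0 _) h2) _.
  by apply: le_trans dle; rewrite mulrA (mulrC (d ^+ 2)) ler_piMr // mulr_ge0 // sqr_ge0.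
have Z : `|p| * (a / (1 - `|p|)) ^+ 4 <= 8 ^+ 4 * d ^+ 4 * expR (- (k.+1%:R * t / 2)).
  rewrite np sc exprMn mulrCA; apply: le_trans (ler_wpM2l d40 h4) _.
  by rewrite mulrCA mulrA.
have pn1 : `|p| < 1 by rewrite np.
have B := ln_eta_approx p a pn1 Y.
have A := ln_eta_approx (- p) a; rewrite normrN in A; have {}A := A pn1 Y.
have S : (k < m)%N -> `|ln (eta (- p) a)| <= (m%:R * th) ^+ 2.
  move=> km; have le_km : k.+1%:R <= m%:R :> R by rewrite ler_nat.
  have a1 : `|a| <= m%:R * `|th| by rewrite /a normrM normr_nat ler_wpM2r.
  apply: (@le_trans _ _ (a ^+ 2)).
    by apply: ln_eta_neg_small; [rewrite ltW | exact: le_trans a1 mth].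
  by rewrite !exprMn ler_wpM2r ?sqr_ge0 // lerXn2r ?nnegrE.
move: A B Z S; rewrite !ler_norml => /andP[A1 A2] /andP[B1 B2] Z.
case: leqP => km S.
  by clear -A1 A2 B1 B2 Z; apply/andP; split; lra.
by have /andP[S1 S2] := S isT; clear -A1 A2 B1 B2 Z S1 S2; apply/andP; split; lra.
Qed.

(** The linear terms of [darg_approx] at p and - p add up to [Mean]. In the same scaling both
    errors, m^2 |th| and |th / t|^3 / t, are of order t^(1/2). *)
Lemma phase_estimate m K t th : 0 < t -> m%:R * `|th| <= 1 ->
  `|phase m (expR (- t)) K th - Mean K t * th| <= m%:R * (2 * (m%:R * `|th|)) + 8 * 8 ^+ 4 * `|th / t| ^+ 3 / t.
Proof.
move=> t0 mth; set d := th / t.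
have d40 : 0 <= `|d| ^+ 3 by rewrite exprn_ge0.
have Q0 : 0 <= 8 ^+ 4 :> R by rewrite exprn_ge0.
rewrite /phase /Mean mulr_suml -sumrB /=.
apply: le_trans (ler_norm_sum _ _ _) _.
apply: (@le_trans _ _ (\sum_(k < K) ((if (m <= k)%N then 0 else 2 * (m%:R * `|th|))
    + 4 * 8 ^+ 4 * `|d| ^+ 3 * expR (- (k.+1%:R * t / 2))))); last first.
  rewrite big_split /= sum_lt_const -mulr_sumr lerD //.
    by rewrite ler_wpM2r ?mulr_ge0 // ler_nat geq_minl.
  apply: le_trans (ler_wpM2l _ (sum_expRN_half_le K t t0)) _.
    by rewrite mulr_ge0 // mulr_ge0.
  by rewrite le_eqVlt; apply/orP; left; apply/eqP; field; rewrite gt_eqF.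
apply: ler_sum => k _; rewrite expRN_natX.
have x0 : 0 < k.+1%:R * t by rewrite mulr_gt0.
have /andP[p0 p1] := expRN_01 _ x0.
have h3 := expRN_quot_le _ 3 x0 isT.
have sc := quot_scale k t th t0; rewrite -/d in sc.
have mE : k.+1%:R * csch (k.+1%:R * t) * th =
   expR (- (k.+1%:R * t)) * (k.+1%:R * th) / (1 - expR (- (k.+1%:R * t)))
   - (- expR (- (k.+1%:R * t))) * (k.+1%:R * th) / (1 - - expR (- (k.+1%:R * t))).
  rewrite /csch; move: (expR (- _)) p0 p1 => p p0 p1; field.
  by rewrite !gt_eqF //; nra.
have /andP[r0 _] := quot_le _ x0.
rewrite mE; set p := expR (- (k.+1%:R * t)) in p0 p1 h3 sc r0 *; set a := k.+1%:R * th in sc *.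
have np : `|p| = p by rewrite ger0_norm // ltW.
have Z : `|p| * `|a / (1 - `|p|)| ^+ 3 <= 8 ^+ 4 * `|d| ^+ 3 * expR (- (k.+1%:R * t / 2)).
  rewrite np sc normrM (ger0_norm r0) exprMn mulrCA; apply: le_trans (ler_wpM2l d40 h3) _.
  by rewrite mulrCA mulrA.
have pn1 : `|p| < 1 by rewrite np.
have B := darg_approx p a pn1.
have A := darg_approx (- p) a; rewrite normrN in A; have {}A := A pn1.
have S : (k < m)%N -> `|a + darg (- p) a| <= 2 * (m%:R * `|th|).
  move=> km; have le_km : k.+1%:R <= m%:R :> R by rewrite ler_nat.
  have a1 : `|a| <= m%:R * `|th| by rewrite /a normrM normr_nat ler_wpM2r.
  have : `|darg (- p) a| <= `|a|.
    by apply: norm_darg_le; [rewrite normrN | exact: le_trans a1 mth | lra].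
  by have := ler_normD a (darg (- p) a); lra.
move: A B Z S; rewrite !ler_norml => /andP[A1 A2] /andP[B1 B2] Z.
case: leqP => km S.
  by clear -A1 A2 B1 B2 Z; apply/andP; split; lra.
by have /andP[S1 S2] := S isT; clear -A1 A2 B1 B2 Z S1 S2; apply/andP; split; lra.
Qed.

End Factors.

(** * Bounds away from the saddle point *)

Section Domination.
Context {R : realType}.
Implicit Types (p a x t th : R) (k m K J : nat).

(** The effect at th = 0 of replacing 1 + q^k by 2 q^k for k <= m. *)
Definition weight m t : R := \prod_(k < m) (2 * expR (- (k.+1%:R * t)) / (1 + expR (- (k.+1%:R * t)))).

Definition etas K t th : R := \prod_(k < K) eta (expR (- (k.+1%:R * t))) (k.+1%:R * th).

Lemma prod_lt_if K m (F : nat -> R) : (m <= K)%N ->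
  \prod_(k < K) (if (m <= k)%N then 1 else F k) = \prod_(k < m) F k.
Proof.
move=> /subnK <-; elim: (K - m)%N => [|j IHj].
  by apply: eq_bigr => k _; rewrite leqNgt ltn_ord.
by rewrite addSn big_ord_recr /= IHj leq_addl mulr1.
Qed.

Lemma ampE m K t th : 0 < t -> (m <= K)%N ->
  amp m (expR (- t)) K th = weight m t / Pb (expR (- t)) K * expR (lnrho m t K th).
Proof.
move=> t0 mK; rewrite /weight -(prod_lt_if K m (fun k => 2 * expR (- (k.+1%:R * t)) / (1 + expR (- (k.+1%:R * t))))) //.
rewrite /amp /Pb /lnrho expR_sum -prodfV -!big_split /=.
apply: eq_bigr => k _; rewrite expRN_natX.
have x0 : 0 < k.+1%:R * t by rewrite mulr_gt0.
have /andP[p0 p1] := expRN_01 _ x0; set p := expR _ in p0 p1 *.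
have pn : `|p| < 1 by rewrite ger0_norm // ltW.
have pn' : `|- p| < 1 by rewrite normrN.
have e1 := eta_gt0 p (k.+1%:R * th) pn; have e2 := eta_gt0 (- p) (k.+1%:R * th) pn'.
rewrite expRD expRN lnK ?posrE //.
have d1 := dmod_gt0 p (k.+1%:R * th) pn; have d2 := dmod_gt0 (- p) (k.+1%:R * th) pn'.
case: leqP => km; last first.
  by rewrite expR0 /eta; field; rewrite !gt_eqF //; lra.
by rewrite lnK ?posrE // /eta; field; rewrite !gt_eqF //; lra.
Qed.

Lemma eta_ge1 p a : 0 <= p < 1 -> 1 <= eta p a.
Proof.
move=> /andP[p0 p1]; have pn : `|p| < 1 by rewrite ger0_norm.
have e0 := eta_gt0 p a pn; rewrite -(@ler_pXn2r _ 2) ?nnegrE ?(ltW e0) // expr1n eta_sqr // lerDl.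
by have /andP[c0 _] := sub1_cos_bounds a; rewrite divr_ge0 ?sqr_ge0 // mulr_ge0 // mulr_ge0.
Qed.

Lemma eta_neg_le1 p a : 0 <= p < 1 -> eta (- p) a <= 1.
Proof.
move=> /andP[p0 p1]; have pn : `|- p| < 1 by rewrite normrN ger0_norm.
have e0 := eta_gt0 (- p) a pn; rewrite -(@ler_pXn2r _ 2) ?nnegrE ?(ltW e0) // expr1n eta_sqr //.
have /andP[c0 _] := sub1_cos_bounds a; rewrite gerDl mulrN !mulNr oppr_le0.
by rewrite divr_ge0 ?sqr_ge0 // mulr_ge0 // mulr_ge0.
Qed.

Lemma exp_in01 k t : 0 < t -> 0 <= expR (- (k.+1%:R * t)) < 1.
Proof.
move=> t0; have /andP[p0 p1] := expRN_01 (k.+1%:R * t) (mulr_gt0 (ltr0n _ k.+1) t0).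
by rewrite ltW.
Qed.

Lemma exp_norm_lt1 k t : 0 < t -> `|expR (- (k.+1%:R * t))| < 1.
Proof. by move=> t0; have /andP[p0 p1] := exp_in01 k t t0; rewrite ger0_norm. Qed.

(** The numerators |1 + q^k e^(ik th)| are largest at th = 0, so discarding them leaves a bound
    independent of m. *)
Lemma expR_lnrho_le m K t th : 0 < t -> expR (lnrho m t K th) <= (etas K t th)^-1.
Proof.
move=> t0; rewrite /lnrho expR_sum /etas -prodfV.
apply: ler_prod => k _; rewrite expR_ge0 /= expRD (expRN (ln _)).
have := exp_norm_lt1 k t t0; have p01 := exp_in01 k t t0.
set p := expR (- _) in p01 *; move=> pn.
have e0 := eta_gt0 p (k.+1%:R * th) pn.
rewrite (lnK e0) ler_piMl ?invr_ge0 ?(ltW e0) //.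
case: leqP => _; last by rewrite expR0.
by rewrite lnK ?eta_neg_le1 // posrE eta_gt0 // normrN.
Qed.

Lemma etas_ge1 K t th : 0 < t -> 1 <= etas K t th.
Proof.
move=> t0; apply: (big_ind (fun x : R => 1 <= x)) => // [x y|k _]; first exact: mulr_ege1.
by apply: eta_ge1; exact: exp_in01.
Qed.

(** All the factors are at least 1, so any initial segment bounds the product from below. Squares
    avoid the square root in [dmod]. *)
Lemma etas_sqr_ge J K t th (c : nat -> R) : 0 < t -> (J <= K)%N ->
  (forall k, (k < J)%N -> 0 <= c k <= eta (expR (- (k.+1%:R * t))) (k.+1%:R * th) ^+ 2) ->
  \prod_(k < J) c k <= etas K t th ^+ 2.
Proof.
move=> t0 JK H; rewrite /etas expr2 -big_split /=.
rewrite -(prod_lt_if K J c) //; apply: ler_prod => k _; rewrite -expr2.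
have p01 := exp_in01 k t t0.
case: leqP => kJ; last exact: H.
by rewrite ler01 exprn_ege1 // eta_ge1.
Qed.

Lemma bernoulli_ineq x n : 0 <= x -> 1 + n%:R * x <= (1 + x) ^+ n.
Proof.
move=> x0; elim: n => [|n IHn]; first by rewrite mul0r addr0 expr0.
rewrite exprSr; apply: le_trans (ler_wpM2r _ IHn); last by lra.
by rewrite -natr1; have := mulr_ge0 (ler0n R n) (sqr_ge0 x); lra.
Qed.

(* For |th| <= t the factors k <= 1 / t alone give the bound, by Bernoulli. *)
Lemma etas_small K t th : 0 < t <= 4^-1 -> `|th| <= t -> 1 / t ^+ 2 <= K%:R ->
  (etas K t th)^-1 <= 24 / (1 + th ^+ 2 / t ^+ 3).
Proof.
move=> /andP[t0 t4] tht le_K; set J := Num.truncn (1 / (2 * t)).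
have /andP[J1 J2] : J%:R <= 1 / (2 * t) < J.+1%:R.
  by apply: truncn_itv; rewrite divr_ge0 // mulr_ge0 // ltW.
have tJ : (2 * J)%:R * t <= 1.
  rewrite natrM (mulrAC 2) mulrC -ler_pdivlMr ?mulr_gt0 //.
have JK : (2 * J <= K)%N.
  rewrite -(ler_nat R); apply: le_trans le_K; rewrite ler_pdivlMr ?exprn_gt0 //.
  by rewrite expr2 mulrA; nra.
(* For k t <= 1 one has p >= 1 / 4, 1 - p <= k t and 1 - cos(k th) >= (k th)^2 / 3, so a squared
   factor is at least 1 + d. Since J >= 1 / (4 t), J d is at least th^2 / (24 t^3), whence the
   constant 24. *)
set d := (th / t) ^+ 2 / 6.
have d0 : 0 <= d by rewrite divr_ge0 ?sqr_ge0.
have E0 : 0 < etas K t th by apply: lt_le_trans (etas_ge1 K t th t0).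
have E1 : 1 + J%:R * d <= etas K t th.
  apply: le_trans (bernoulli_ineq _ _ d0) _.
  rewrite -(@ler_pXn2r _ 2) ?nnegrE ?exprn_ge0 ?(ltW E0) //; last by lra.
  rewrite -exprM mulnC -[(2 * J)%N]card_ord -prodr_const.
  apply: (etas_sqr_ge (2 * J) K t th (fun=> 1 + d) t0 JK) => k kJ.
  rewrite eta_sqr ?exp_norm_lt1 //; apply/andP; split; first by lra.
  rewrite lerD2l.
  have x1 : k.+1%:R * t <= 1 by apply: le_trans tJ; rewrite ler_wpM2r ?ler_nat // ltW.
  have x0 : 0 < k.+1%:R * t by rewrite mulr_gt0.
  have /andP[p0 p1] := expRN_01 _ x0.
  have p4 : 4^-1 <= expR (- (k.+1%:R * t)).
    have -> : expR (- (k.+1%:R * t)) = expR (- (k.+1%:R * t) / 2) ^+ 2.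
      by rewrite -expRM_natl; congr expR; field.
    by have := expR_ge1Dx (- (k.+1%:R * t) / 2); nra.
  have px : 1 - expR (- (k.+1%:R * t)) <= k.+1%:R * t by have := expR_ge1Dx (- (k.+1%:R * t)); lra.
  have aE : (k.+1%:R * th) ^+ 2 = 6 * d * (k.+1%:R * t) ^+ 2.
    by rewrite /d; field; rewrite gt_eqF.
  have d6 : 6 * d <= 1.
    rewrite /d mulrC divfK ?pnatr_eq0 // expr_div_n ler_pdivrMr ?exprn_gt0 // mul1r.
    by rewrite -real_normK ?num_real // lerXn2r ?nnegrE // ltW.
  have cb := cos_le (k.+1%:R * th).
  rewrite (exprM _ 2 2) aE in cb.
  move: (k.+1%:R * t) (expR (- (k.+1%:R * t))) (cos (k.+1%:R * th)) x1 x0 p0 p1 p4 px cb => x p c x1 x0 p0 p1 p4 px cb.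
  have D0 : 0 < 1 - p by lra.
  have Dx : (1 - p) ^+ 2 <= x ^+ 2 by rewrite lerXn2r ?nnegrE //; lra.
  rewrite ler_pdivlMr ?exprn_gt0 //.
  have x21 : x ^+ 2 <= 1 by rewrite expr_le1 // ltW.
  have dx0 : 0 <= d * x ^+ 2 by rewrite mulr_ge0 // sqr_ge0.
  have h1 : 2 * (d * x ^+ 2) <= 1 - c.
    have : (6 * d * x ^+ 2) ^+ 2 <= 6 * (d * x ^+ 2).
      have z1 : 6 * d * x ^+ 2 <= 1 by rewrite mulr_ile1 ?sqr_ge0 // mulr_ge0.
      have z0 : 0 <= 1 - 6 * d * x ^+ 2 by lra.
      by have := mulr_ge0 dx0 z0; lra.
    by lra.
  apply: (@le_trans _ _ (d * x ^+ 2)); first by rewrite ler_wpM2l.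
  apply: (@le_trans _ _ (2 * 4^-1 * (2 * (d * x ^+ 2)))); first by lra.
  rewrite ler_pM //; lra.
have J4 : 1 / (4 * t) <= J%:R.
  have e1 : 1 / (2 * t) = 2 * (1 / (4 * t)) by field; rewrite gt_eqF.
  have : 1 <= 1 / (4 * t) by rewrite ler_pdivlMr ?mulr_gt0 //; lra.
  by rewrite -[J.+1%:R]natr1 e1 in J2; move: J2; move: (1 / (4 * t)) => w; lra.
have E2 : 1 + th ^+ 2 / t ^+ 3 / 24 <= etas K t th.
  apply: le_trans E1; rewrite lerD2l; apply: le_trans (ler_wpM2r d0 J4).
  by rewrite /d le_eqVlt; apply/orP; left; apply/eqP; field; rewrite gt_eqF.
have g0 : 0 <= th ^+ 2 / t ^+ 3 by rewrite divr_ge0 ?sqr_ge0 // exprn_ge0 // ltW.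
rewrite ler_pdivlMr; last by lra.
by rewrite mulrC ler_pdivrMr //; lra.
Qed.

Lemma dirichlet J th : 2 * sin (th / 2) * \sum_(k < J) cos (k.+1%:R * th)
  = sin (J%:R * th + th / 2) - sin (th / 2).
Proof.
elim: J => [|J IHJ]; first by rewrite big_ord0 mulr0 mul0r add0r subrr.
rewrite big_ord_recr /= mulrDr IHJ.
have -> : J%:R * th + th / 2 = J.+1%:R * th - th / 2 by rewrite -natr1; field.
by rewrite sinB sinD; ring.
Qed.

Lemma pi_le4 : pi <= 4 :> R.
Proof. have := @pihalf_lt2 R; lra. Qed.

(** By [dirichlet] the sum times 2 sin(th / 2) is at most 1, and sin(th / 2) >= th / 6 on this
    range. *)
Lemma sum_cos_le J th : 0 < th <= pi -> \sum_(k < J) cos (k.+1%:R * th) <= 3 / th.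
Proof.
move=> /andP[t0 tp]; have p4 := pi_le4.
have s3 : th / 6 <= sin (th / 2).
  by have := sin_ge (th / 2) (divr_ge0 (ltW t0) (ler0n _ 2)); nra.
have d := dirichlet J th.
have h : 2 * sin (th / 2) * \sum_(k < J) cos (k.+1%:R * th) <= 1.
  by rewrite d; have := sin_le1 (J%:R * th + th / 2); lra.
have [s0|s0] := leP (\sum_(k < J) cos (k.+1%:R * th)) 0.
  by apply: le_trans s0 _; rewrite divr_ge0 // ltW.
rewrite ler_pdivlMr //; nra.
Qed.

Lemma expR_half_le (y : R) : 0 <= y <= 1 -> expR (y / 2) <= 1 + y.
Proof.
move=> /andP[y0 y1]; have h := expR_ge1Dx (- (y / 2)).
rewrite -(ler_pM2r (expR_gt0 (- (y / 2)))) -expRD subrr expR0.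
nra.
Qed.

(* For t <= |th| <= pi the factors k <= 4 / t give exp(c / t): by the Dirichlet
   kernel a positive proportion of the cosines cos(k th) stays away from 1. *)
Lemma etas_large : exists2 C : R, 0 <= C & forall K t th,
  0 < t <= 4^-1 -> t <= th <= pi -> 1 / t ^+ 2 <= K%:R ->
  (etas K t th)^-1 <= C / (1 + th ^+ 2 / t ^+ 3).
Proof.
set c := expR (- 4) : R; have c0 : 0 < c by exact: expR_gt0.
have c4 : c <= 4^-1.
  by have := expRN_le (4 : R) (lt_trans (ltrN10 _) (ltr0n _ 4)); move=> h; apply: le_trans h _; rewrite lef_pV2 ?posrE; lra.
(* 6 (4 t / c)^3 bounds e^(- c / (4 t)), and 17 = 1 + 4^2 bounds t^3 + th^2. *)
exists (6 * 4 ^+ 3 * 17 / c ^+ 3); first by rewrite divr_ge0 // ?exprn_ge0 ?(ltW c0) // !mulr_ge0 ?exprn_ge0.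
(* With J > 4 / t - 1 and a cosine sum of at most 3 / th <= 3 / t, the sum of 1 - cos(k th) is at
   least 1 / t - 1 >= 1 / (2 t). On this range k t <= 4, so c = e^(- 4) bounds every e^(- k t) from
   below. *)
move=> K t th /andP[t0 t4] /andP[tth thp] le_K; set J := Num.truncn (4 / t).
have /andP[J1 J2] : J%:R <= 4 / t < J.+1%:R by apply: truncn_itv; rewrite divr_ge0 // ltW.
have tJ : J%:R * t <= 4 by rewrite -ler_pdivlMr.
have JK : (J <= K)%N.
  rewrite -(ler_nat R); apply: le_trans le_K; rewrite ler_pdivlMr ?exprn_gt0 //.
  by rewrite expr2 mulrA; nra.
have E0 : 0 < etas K t th by apply: lt_le_trans (etas_ge1 K t th t0).
have E1 : expR (c / (4 * t)) <= etas K t th.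
  rewrite -(@ler_pXn2r _ 2) ?nnegrE ?expR_ge0 ?(ltW E0) //.
  apply: (@le_trans _ _ (\prod_(k < J) expR (c * (1 - cos (k.+1%:R * th))))).
    rewrite -expR_sum -expRM_natl ler_expR -mulr_sumr.
    rewrite (_ : 2 * (c / (4 * t)) = c * (1 / (2 * t))); last by field; rewrite gt_eqF.
    rewrite ler_wpM2l ?(ltW c0) // sumrB sumr_const card_ord.
    have th0 : 0 < th by lra.
    have := sum_cos_le J th; rewrite th0 thp => /(_ isT) h.
    have : 3 / th <= 3 / t by rewrite ler_wpM2l // lef_pV2 ?posrE.
    have : 2 <= 1 / (2 * t) by rewrite ler_pdivlMr ?mulr_gt0 //; lra.
    rewrite -[J.+1%:R]natr1 in J2.
    rewrite (_ : 4 / t = 8 * (1 / (2 * t))) in J2; last by field; rewrite gt_eqF.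
    have -> : 3 / t = 6 * (1 / (2 * t)) by field; rewrite gt_eqF.
    move: (1 / (2 * t)) h J2; move: (\sum_(_ < _) _) => S w h J2; lra.
  apply: (etas_sqr_ge J K t th (fun k => expR (c * (1 - cos (k.+1%:R * th)))) t0 JK) => k kJ.
  rewrite expR_ge0 eta_sqr ?exp_norm_lt1 //=.
  have x4 : k.+1%:R * t <= 4 by apply: le_trans tJ; rewrite ler_wpM2r ?ler_nat // ltW.
  have pc : c <= expR (- (k.+1%:R * t)) by rewrite ler_expR lerN2.
  have /andP[p0 p1] := exp_in01 k t t0.
  have b1 := cos_geN1 (k.+1%:R * th); have b2 := @cos_le1 R (k.+1%:R * th).
  move: (expR (- _)) (cos _) pc p0 p1 b1 b2 => p y pc p0 p1 b1 b2.
  have -> : c * (1 - y) = 2 * c * (1 - y) / 2 by field.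
  apply: le_trans (expR_half_le _ _) _; first by nra.
  rewrite lerD2l; apply: (@le_trans _ _ (2 * p * (1 - y))); first by nra.
  rewrite ler_peMr //; first by nra.
  by rewrite invf_ge1 ?exprn_gt0 ?expr_le1 //; lra.
have ct : 0 < c / (4 * t) by rewrite divr_gt0 // mulr_gt0.
apply: (@le_trans _ _ (expR (- (c / (4 * t))))).
  by rewrite expRN lef_pV2 ?posrE ?expR_gt0.
apply: le_trans (expRN_pow_le _ 2 ct) _; rewrite (_ : 3`!%:R = 6) //.
have t30 : 0 < t ^+ 3 by rewrite exprn_gt0.
have g0 : 0 <= th ^+ 2 / t ^+ 3 by rewrite divr_ge0 ?sqr_ge0 // ltW.
rewrite ler_pdivlMr; last by lra.
have p4 := pi_le4.
have h : 1 + th ^+ 2 / t ^+ 3 <= 17 / t ^+ 3.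
  rewrite ler_pdivlMr // mulrDl divfK ?gt_eqF // mul1r.
  have : t ^+ 3 <= 1 by rewrite exprn_ile1 //; lra.
  by have : th ^+ 2 <= 4 ^+ 2 by [rewrite lerXn2r ?nnegrE //; lra]; lra.
apply: le_trans (ler_wpM2l _ h) _; first by rewrite divr_ge0 // exprn_ge0 // ltW.
by rewrite le_eqVlt; apply/orP; left; apply/eqP; field; rewrite !gt_eqF.
Qed.

Lemma etas_le : exists2 C : R, 0 <= C & forall K t th,
  0 < t <= 4^-1 -> `|th| <= pi -> 1 / t ^+ 2 <= K%:R ->
  (etas K t th)^-1 <= C / (1 + th ^+ 2 / t ^+ 3).
Proof.
have [C C0 HC] := etas_large; exists (24 + C); first by rewrite addr_ge0.
move=> K t th /[dup] t4 /andP[t0 _] thp le_K.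
have g0 : 0 < 1 + th ^+ 2 / t ^+ 3 by rewrite ltr_wpDr // divr_ge0 ?sqr_ge0 // exprn_ge0 // ltW.
have [tth|tth] := leP `|th| t.
  by apply: le_trans (etas_small _ _ _ t4 tth le_K) _; rewrite ler_wpM2r ?invr_ge0 ?(ltW g0) // lerDl.
have -> : etas K t th = etas K t `|th|.
  apply: eq_bigr => k _; have [_|_] := ger0P th; first by [].
  by rewrite /eta /dmod mulrN cosN.
apply: le_trans (HC K t `|th| t4 _ le_K) _; first by rewrite (ltW tth).
by rewrite real_normK ?num_real // ler_wpM2r ?invr_ge0 ?(ltW g0) // lerDr.
Qed.

(** * Gaussian bounds for the weight *)

Lemma weight_ge0 m t : 0 <= weight m t.
Proof.
by rewrite prodr_ge0 // => k _; rewrite divr_ge0 ?addr_ge0 ?mulr_ge0 ?expR_ge0.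
Qed.

(** With e = e^(- k t / 2), the inequality 2 e <= 1 + e^2 bounds each factor 2 e^2 / (1 + e^2) by e,
    and the exponents k t / 2 sum to at least t m^2 / 4. *)
Lemma weight_le m t : 0 < t -> weight m t <= expR (- (t * m%:R ^+ 2 / 4)).
Proof.
move=> t0; elim: m => [|m IHm].
  by rewrite /weight big_ord0 expr0n /= mulr0 mul0r oppr0 expR0.
rewrite /weight big_ord_recr /= -/(weight m t).
apply: (@le_trans _ _ (expR (- (t * m%:R ^+ 2 / 4)) * expR (- (m.+1%:R * t / 2)))).
  apply: ler_pM; rewrite ?weight_ge0 ?divr_ge0 ?addr_ge0 ?mulr_ge0 ?expR_ge0 //.
  have -> : expR (- (m.+1%:R * t)) = expR (- (m.+1%:R * t / 2)) ^+ 2.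
    by rewrite -expRM_natl; congr expR; field.
  have := expR_gt0 (- (m.+1%:R * t / 2)); move: (expR _) => e e0.
  rewrite ler_pdivrMr; last by rewrite ltr_wpDr ?sqr_ge0.
  by have := mulr_ge0 (ltW e0) (sqr_ge0 (1 - e)); lra.
by rewrite -expRD ler_expR -[m.+1%:R]natr1; have := mulr_ge0 (ler0n R m) (ltW t0); lra.
Qed.

(** For x = k t <= 1 / 2 a factor is at least e^(- (x / 2 + x^2)). The squares sum to at most t^2
    m^3, which is negligible for m of order t^(-1/2). *)
Lemma weight_ge m t : 0 < t -> m%:R * t <= 2^-1 ->
  expR (- (t * m%:R * m.+1%:R / 4 + t ^+ 2 * m%:R ^+ 3)) <= weight m t.
Proof.
move=> t0; elim: m => [_|m IHm mt].
  by rewrite /weight big_ord0 expr0n /= !mulr0 !mul0r addr0 oppr0 expR0.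
have x0 : 0 < m.+1%:R * t by rewrite mulr_gt0.
rewrite /weight big_ord_recr /= -/(weight m t).
apply: (@le_trans _ _ (expR (- (t * m%:R * m.+1%:R / 4 + t ^+ 2 * m%:R ^+ 3)) *
   expR (- (m.+1%:R * t / 2 + (m.+1%:R * t) ^+ 2)))).
  rewrite -expRD ler_expR -[m.+2%:R]natr1 -[m.+1%:R]natr1; have := mulr_ge0 (sqr_ge0 t) (sqr_ge0 (m%:R : R)).
  by have := mulr_ge0 (sqr_ge0 t) (ler0n R m); lra.
apply: ler_pM; rewrite ?expR_ge0 //.
  by apply: IHm; apply: le_trans mt; rewrite ler_wpM2r ?ler_nat // ltW.
move: mt x0; move: (m.+1%:R * t) => x x2 x0.
have px := expR_ge1Dx (- x).
have x20 := sqr_ge0 x.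
apply: le_trans (expRN_le _ _) _; first by lra.
have p0 := expR_gt0 (- x).
rewrite -div1r ler_pdivrMr; last by lra.
rewrite mulrAC ler_pdivlMr; last by lra.
move: (expR (- x)) px p0 => p px p0; nra.
Qed.

End Domination.

(** * The saddle point limit *)

Section Saddle.
Context {R : realType} (r : nat -> R) (N : nat -> nat).
Context (r01 : forall n, 0 < r n <= 2^-1) (r_cvg : r @ \oo --> (0 : R)).
Context (NE : forall n, (N n)%:R = pi ^+ 2 / (4 * r n ^+ 4)).
Local Notation mu := (@lebesgue_measure R).

(* t is the saddle parameter (q = e^(-t), N = pi^2 / (4 t^2)), s the scale of the
   angle th = s u, chosen so that Var * th^2 / 2 tends to u^2, and h the mesh of
   the Riemann sum over m. *)
Let t n := r n ^+ 2.
Let s n := 2 / pi * r n ^+ 3.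
Let h n := r n / 2.
Let q n := expR (- t n).

Lemma r_gt0 n : 0 < r n.
Proof. by have /andP[] := r01 n. Qed.
#[local] Hint Resolve r_gt0 : core.
Lemma t_gt0 n : 0 < t n.
Proof. by rewrite exprn_gt0. Qed.
#[local] Hint Resolve t_gt0 : core.
Lemma h_gt0 n : 0 < h n.
Proof. by rewrite divr_gt0. Qed.
#[local] Hint Resolve h_gt0 : core.
Lemma s_gt0 n : 0 < s n.
Proof. by rewrite mulr_gt0 ?exprn_gt0 // divr_gt0 // pi_gt0. Qed.
#[local] Hint Resolve s_gt0 : core.
Lemma q01 n : 0 < q n < 1.
Proof. exact: expRN_01. Qed.
Lemma t_le n : t n <= 4^-1.
Proof. by have /andP[r0 r1] := r01 n; rewrite /t; nra. Qed.

Lemma tN n : 1 / t n ^+ 2 <= (N n)%:R.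
Proof.
have -> : (N n)%:R = pi ^+ 2 / 4 * (1 / t n ^+ 2) by rewrite NE /t; field; rewrite ?gt_eqF.
have p2 : 2 ^+ 2 <= pi ^+ 2 :> R by rewrite lerXn2r ?nnegrE ?pi_ge0 // pi_ge2.
by rewrite ler_peMl ?divr_ge0 ?sqr_ge0 // ler_pdivlMr //; lra.
Qed.

Lemma thetaE n u : s n * u / t n = 2 / pi * u * r n.
Proof. by rewrite /s /t; move: (pi : R) (pi_gt0 R) => p p0; field; rewrite !gt_eqF. Qed.

Lemma rpow_cvg (c : R) k : (fun n => c * r n ^+ k.+1) @ \oo --> (0 : R).
Proof.
rewrite -(mulr0 c); apply: cvgM; first exact: cvg_cst.
elim: k => [|k IHk]; first by under eq_fun do rewrite expr1.
under eq_fun do rewrite exprS.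
by rewrite -(mulr0 0); apply: cvgM.
Qed.

Lemma dist_cvg (a b : nat -> R) (l : R) : (\forall n \near \oo, `|a n - l| <= b n) ->
  b @ \oo --> (0 : R) -> a @ \oo --> l.
Proof.
move=> ab b0; apply: (@squeeze_cvgr _ _ _ _ (fun n => l - b n) (fun n => l + b n)).
- by near=> n; rewrite -ler_distl; near: n.
- by rewrite -[X in _ --> X]subr0; apply: cvgB => //; exact: cvg_cst.
by rewrite -[X in _ --> X]addr0; apply: cvgD => //; exact: cvg_cst.
Unshelve. all: by end_near. Qed.

Lemma h_cvg : h @ \oo --> (0 : R).
Proof. by rewrite -(mul0r 2^-1); apply: cvgM => //; exact: cvg_cst. Qed.

Lemma trunc_le x n : 0 <= x -> (Num.truncn (x / h n))%:R * r n <= 2 * x.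
Proof.
move=> x0; have /andP[h1 _] : (Num.truncn (x / h n))%:R <= x / h n < (Num.truncn (x / h n)).+1%:R.
  by apply: truncn_itv; rewrite divr_ge0 // ltW.
by move: h1; rewrite ler_pdivlMr // /h; lra.
Qed.

Lemma weight_cvg x : 0 <= x ->
  (fun n => weight (Num.truncn (x / h n)) (t n)) @ \oo --> expR (- x ^+ 2).
Proof.
move=> x0; set y := fun n => (Num.truncn (x / h n))%:R * h n.
have y_cvg : y @ \oo --> x by apply: trunc_scale_cvg => //; exact: h_cvg.
have y2 : (fun n => y n ^+ 2) @ \oo --> x ^+ 2.
  by rewrite expr2; under eq_fun do rewrite expr2; exact: cvgM.
have lo : (fun n => - (y n ^+ 2 + h n * (y n + 16 * y n * y n ^+ 2))) @ \oo --> - (x ^+ 2).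
  rewrite -[x ^+ 2]addr0 -(mul0r (x + 16 * x * x ^+ 2)); apply: cvgN; apply: cvgD => //.
  apply: cvgM; first exact: h_cvg.
  apply: cvgD => //; apply: cvgM => //; apply: cvgM => //; exact: cvg_cst.
apply: (@squeeze_cvgr _ _ _ _ (fun n => expR (- (y n ^+ 2 + h n * (y n + 16 * y n * y n ^+ 2))))
    (fun n => expR (- (y n ^+ 2)))); last 2 first.
- exact: cvg_expR.
- by apply: cvg_expR; exact: cvgN.
near=> n; set m := Num.truncn _.
have m2 : m%:R * r n <= 2 * x by exact: trunc_le.
have mt : m%:R * t n <= 2^-1.
  rewrite /t expr2 mulrA; apply: (@le_trans _ _ (2 * x * r n)).
    by rewrite ler_wpM2r // ltW.
  by rewrite -[r n]expr1; near: n; have /cvgr_le := rpow_cvg (2 * x) 0; apply; lra.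
apply/andP; split.
  apply: le_trans (weight_ge _ _ (t_gt0 n) mt); rewrite ler_expR lerN2 -/m -[m.+1%:R]natr1.
  rewrite le_eqVlt; apply/orP; left; apply/eqP.
  by rewrite /y -/m /t /h; field.
apply: le_trans (weight_le _ _ (t_gt0 n)) _; rewrite ler_expR lerN2.
by rewrite le_eqVlt; apply/orP; left; apply/eqP; rewrite /y -/m /t /h; field.
Unshelve. all: by end_near. Qed.

Lemma Var_cvg : (fun n => r n ^+ 6 * Var (N n) (t n)) @ \oo --> pi ^+ 2 / 2.
Proof.
have [D D0 HD] := @Var_estimate R.
have lim (e c : R) : (fun n => pi ^+ 2 / 4 * ((2 + e * r n) / (1 + e * r n) ^+ 2) + c * r n)
    @ \oo --> pi ^+ 2 / 2.
  have er : (fun n => e * r n) @ \oo --> e * 0 by apply: cvgM => //; exact: cvg_cst.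
  have -> : pi ^+ 2 / 2 = pi ^+ 2 / 4 * ((2 + e * 0) / ((1 + e * 0) * (1 + e * 0))) + c * 0 :> R.
    by rewrite !mulr0 !addr0 !mulr1 invr1 mulr1; field.
  under eq_fun do rewrite expr2.
  have c1 : (fun n => 1 + e * r n) @ \oo --> 1 + e * 0 by apply: cvgD => //; exact: cvg_cst.
  apply: cvgD; last by apply: cvgM => //; exact: cvg_cst.
  apply: cvgM; first exact: cvg_cst.
  apply: cvgM; first by apply: cvgD => //; exact: cvg_cst.
  by apply: cvgV; [rewrite mulr0 addr0 mulr1 oner_eq0 | exact: cvgM].
apply: (@squeeze_cvgr _ _ _ _ _ _ _ _ _ (lim 1 (- D)) (lim (- 1) D)); apply: nearW => n.
rewrite mulN1r mul1r mulNr; apply: HD => //.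
by have := tN n; rewrite /t -exprM.
Qed.

Lemma lnrho_cvg x u : 0 <= x ->
  (fun n => lnrho (Num.truncn (x / h n)) (t n) (N n) (s n * u)) @ \oo --> - u ^+ 2.
Proof.
move=> x0; set b := 2 / pi * u; have p0 := pi_gt0 R.
have V : (fun n => Var (N n) (t n) * (s n * u) ^+ 2 / 2) @ \oo --> u ^+ 2.
  have -> : u ^+ 2 = pi ^+ 2 / 2 * (b ^+ 2 / 2) by rewrite /b; move: (pi : R) p0 => p p0; field; rewrite gt_eqF.
  have E n : Var (N n) (t n) * (s n * u) ^+ 2 / 2 = r n ^+ 6 * Var (N n) (t n) * (b ^+ 2 / 2).
    by rewrite /s /b; ring.
  under eq_fun do rewrite E.
  by apply: cvgM; [exact: Var_cvg | exact: cvg_cst].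
have Z : (fun n => lnrho (Num.truncn (x / h n)) (t n) (N n) (s n * u)
    + Var (N n) (t n) * (s n * u) ^+ 2 / 2) @ \oo --> (0 : R).
  apply: (@dist_cvg _ (fun n => (2 * x) ^+ 3 * b ^+ 2 * r n ^+ 3 + 8 * 8 ^+ 4 * b ^+ 4 * r n ^+ 2)); last first.
    by rewrite -(addr0 0); apply: cvgD; exact: rpow_cvg.
  near=> n; rewrite subr0; set m := Num.truncn _.
  have m2 : m%:R * r n <= 2 * x by exact: trunc_le.
  have rn0 := ltW (r_gt0 n).
  have d : s n * u / t n = b * r n by exact: thetaE.
  have sE : s n * u = b * r n ^+ 3 by rewrite /s /b; ring.
  apply: le_trans (lnrho_estimate m (N n) (t n) _ (t_gt0 n) _ _) _.
  - rewrite d exprMn mulrA; near: n.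
    by have /cvgr_le := rpow_cvg (8 ^+ 4 * b ^+ 2) 1; apply; lra.
  - rewrite sE normrM (ger0_norm (exprn_ge0 _ rn0)).
    apply: (@le_trans _ _ (2 * x * `|b| * r n ^+ 2)).
      rewrite (_ : m%:R * _ = m%:R * r n * (`|b| * r n ^+ 2)); last by ring.
      by rewrite -[leRHS]mulrA ler_wpM2r // mulr_ge0 ?exprn_ge0.
    by near: n; have /cvgr_le := rpow_cvg (2 * x * `|b|) 1; apply; lra.
  rewrite d sE; apply: lerD.
    rewrite (_ : _ * _ = (m%:R * r n) ^+ 3 * (b ^+ 2 * r n ^+ 3)); last by ring.
    have br0 : 0 <= b ^+ 2 * r n ^+ 3 := mulr_ge0 (sqr_ge0 b) (exprn_ge0 3 rn0).
    rewrite -mulrA (ler_wpM2r br0) //.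
    by rewrite lerXn2r ?nnegrE ?mulr_ge0.
  by rewrite le_eqVlt; apply/orP; left; apply/eqP; rewrite /t; field; rewrite ?gt_eqF.
have -> : - u ^+ 2 = 0 - u ^+ 2 by rewrite sub0r.
have -> : (fun n => lnrho (Num.truncn (x / h n)) (t n) (N n) (s n * u)) =
   (fun n => (lnrho (Num.truncn (x / h n)) (t n) (N n) (s n * u)
    + Var (N n) (t n) * (s n * u) ^+ 2 / 2) - Var (N n) (t n) * (s n * u) ^+ 2 / 2).
  by apply/funext => n; rewrite addrK.
exact: cvgB.
Unshelve. all: by end_near. Qed.

Lemma phase_cvg x u : 0 <= x ->
  (fun n => phase (Num.truncn (x / h n)) (q n) (N n) (s n * u) - (N n)%:R * (s n * u)) @ \oo --> (0 : R).
Proof.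
move=> x0; set b := 2 / pi * u; have p0 := pi_gt0 R.
have [D D0 HD] := @Mean_estimate R.
apply: (@dist_cvg _ (fun n => 2 * (2 * x) ^+ 2 * `|b| * r n ^+ 1 + 8 * 8 ^+ 4 * `|b| ^+ 3 * r n ^+ 1
     + D * `|b| * r n ^+ 1)); last first.
  by rewrite -(addr0 0); apply: cvgD; [rewrite -(addr0 0); apply: cvgD|]; exact: rpow_cvg.
near=> n; rewrite subr0; set m := Num.truncn _.
have m2 : m%:R * r n <= 2 * x by exact: trunc_le.
have rn0 := ltW (r_gt0 n).
have d : s n * u / t n = b * r n by exact: thetaE.
have sE : s n * u = b * r n ^+ 3 by rewrite /s /b; ring.
have nsE : `|s n * u| = `|b| * r n ^+ 3 by rewrite sE normrM (ger0_norm (exprn_ge0 _ rn0)).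
have P := phase_estimate m (N n) (t n) (s n * u) (t_gt0 n).
have M : `|Mean (N n) (t n) - (N n)%:R| <= D / t n.
  rewrite NE (_ : r n ^+ 4 = t n ^+ 2); last by rewrite /t -exprM.
  apply: HD; first by rewrite t_gt0 /=; have := t_le n; lra.
  apply: le_trans (tN n); rewrite !div1r lef_pV2 ?posrE ?mulr_gt0 ?exprn_gt0 //.
  by have := sqr_ge0 (t n); lra.
rewrite (_ : phase _ _ _ _ - _ = (phase m (q n) (N n) (s n * u) - Mean (N n) (t n) * (s n * u))
   + (Mean (N n) (t n) - (N n)%:R) * (s n * u)); last by ring.
apply: le_trans (ler_normD _ _) _; apply: lerD.
  apply: le_trans (P _) _.
    rewrite nsE; apply: (@le_trans _ _ (2 * x * `|b| * r n ^+ 2)).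
      rewrite (_ : m%:R * _ = m%:R * r n * (`|b| * r n ^+ 2)); last by ring.
      by rewrite -[leRHS]mulrA ler_wpM2r // mulr_ge0 ?exprn_ge0.
    by near: n; have /cvgr_le := rpow_cvg (2 * x * `|b|) 1; apply; lra.
  rewrite d nsE; apply: lerD.
    rewrite (_ : _ * _ = 2 * (m%:R * r n) ^+ 2 * (`|b| * r n ^+ 1)); last by ring.
    rewrite -[leRHS]mulrA ler_wpM2r ?mulr_ge0 // ler_wpM2l //.
    by rewrite lerXn2r ?nnegrE ?mulr_ge0.
  rewrite normrM (ger0_norm rn0).
  by rewrite le_eqVlt; apply/orP; left; apply/eqP; rewrite /t; field; rewrite ?gt_eqF.
rewrite normrM nsE; apply: le_trans (ler_wpM2r _ M) _; first by rewrite mulr_ge0 ?exprn_ge0.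
by rewrite le_eqVlt; apply/orP; left; apply/eqP; rewrite /t; field; rewrite ?gt_eqF.
Unshelve. all: by end_near. Qed.

(** The integrand [wave] multiplied by [Pb], extended by 0 outside one period so that all n share
    the whole line as domain. *)
Definition summand n m u : R := if `|u| <= pi / s n then
  weight m (t n) * expR (lnrho m (t n) (N n) (s n * u))
    * cos (phase m (q n) (N n) (s n * u) - (N n)%:R * (s n * u)) else 0.

Lemma summand_cvg x u : 0 <= x ->
  (fun n => if (Num.truncn (x / h n) < (N n).+1)%N then summand n (Num.truncn (x / h n)) u else 0)
    @ \oo --> expR (- x ^+ 2) * expR (- u ^+ 2).
Proof.
move=> x0; rewrite -[X in _ --> X]mulr1 -(@cos0 R).
apply: (@cvg_trans _ ((fun n => weight (Num.truncn (x / h n)) (t n) *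
   expR (lnrho (Num.truncn (x / h n)) (t n) (N n) (s n * u))
    * cos (phase (Num.truncn (x / h n)) (q n) (N n) (s n * u) - (N n)%:R * (s n * u))) @ \oo)); last first.
  apply: cvgM.
    by apply: cvgM; [exact: weight_cvg | apply: cvg_expR; exact: lnrho_cvg].
  apply: continuous_cvg; first exact: continuous_cos.
  exact: phase_cvg.
apply: near_eq_cvg; near=> n.
have m2 : (Num.truncn (x / h n))%:R * r n <= 2 * x by exact: trunc_le.
rewrite /summand !ifT //.
- rewrite ler_pdivlMr // (_ : _ * _ = 2 / pi * `|u| * r n ^+ 3); last by rewrite /s; ring.
  near: n; have /cvgr_le := rpow_cvg (2 / pi * `|u|) 2; apply; exact: pi_gt0.
rewrite ltnS -(ler_nat R); apply: le_trans (tN n).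
rewrite ler_pdivlMr ?exprn_gt0 // /t -exprM.
apply: (@le_trans _ _ (2 * x * r n ^+ 3)).
  have r3 : 0 <= r n ^+ 3 by rewrite exprn_ge0 // ltW.
  by rewrite (exprS (r n) 3) mulrA (ler_wpM2r r3).
by near: n; have /cvgr_le := rpow_cvg (2 * x) 2; apply; lra.
Unshelve. all: by end_near. Qed.

(** The majorant splits: [etas_le] gives decay in u and [weight_le] decay in m. Hence dominated
    convergence applies to the sum at fixed u, and then to the integral. The factor 4 comes from
    th^2 / t^3 = (2 / pi)^2 u^2 >= u^2 / 4. *)
Lemma summand_le : exists2 C : R, 0 <= C & forall n m u,
  `|summand n m u| <= C / (1 + u ^+ 2) / (1 + (h n * m%:R) ^+ 2).
Proof.
have [C C0 HC] := @etas_le R; exists (4 * C); first by rewrite mulr_ge0.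
move=> n m u; have u0 := sqr_ge0 u; have m0 := sqr_ge0 (h n * m%:R).
have u1 : 0 < 1 + u ^+ 2 by lra.
rewrite /summand; case: (leP `|u| (pi / s n)) => us; last first.
  by rewrite normr0 !divr_ge0 ?mulr_ge0 //; lra.
rewrite normrM; apply: (@le_trans _ _ (weight m (t n) * expR (lnrho m (t n) (N n) (s n * u)))).
  rewrite (ger0_norm (mulr_ge0 (weight_ge0 _ _) (expR_ge0 _))) ler_piMr ?mulr_ge0 ?weight_ge0 ?expR_ge0 //.
  by rewrite ler_norml cos_geN1; exact: cos_le1.
rewrite mulrC ler_pM ?weight_ge0 ?expR_ge0 //.
  apply: le_trans (expR_lnrho_le _ _ _ _ (t_gt0 n)) _.
  apply: le_trans (HC _ _ _ _ _ (tN n)) _.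
  - by rewrite t_gt0 t_le.
  - by rewrite normrM (gtr0_norm (s_gt0 n)) mulrC -ler_pdivlMr.
  have -> : (s n * u) ^+ 2 / t n ^+ 3 = (2 / pi) ^+ 2 * u ^+ 2.
    by rewrite /s /t; move: (pi : R) (pi_gt0 R) => p p0; field; rewrite !gt_eqF.
  have p4 : 4^-1 <= (2 / pi) ^+ 2 :> R.
    have p2 : 2^-1 <= 2 / pi :> R by rewrite ler_pdivlMr ?pi_gt0 //; have := @pi_le4 R; lra.
    have -> : 4^-1 = (2^-1) ^+ 2 :> R by rewrite exprVn; congr (_^-1); ring.
    by rewrite lerXn2r ?nnegrE //; lra.
  have h4 : (1 + u ^+ 2) / 4 <= 1 + (2 / pi) ^+ 2 * u ^+ 2.
    by have := ler_wpM2r u0 p4; lra.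
  have := ler_wpM2l C0 h4; move: (_ ^+ 2 * _ ^+ 2) h4 => X h4 CX.
  rewrite ler_pdivrMr; last by lra.
  by rewrite mulrAC ler_pdivlMr //; lra.
apply: le_trans (weight_le _ _ (t_gt0 n)) _.
rewrite (_ : t n * m%:R ^+ 2 / 4 = (h n * m%:R) ^+ 2); last by rewrite /t /h; field.
by apply: expRN_le; lra.
Qed.

(* 1 / (1 + y^2) <= 2 / (1 + y)^2, which telescopes. *)
Lemma sum_oneDsqrV_le (c : R) M : 0 < c <= 1 ->
  c * \sum_(m < M) (1 + (c * m%:R) ^+ 2)^-1 <= 4.
Proof.
move=> /andP[c0 c1].
suff H : c * \sum_(m < M) (1 + (c * m%:R) ^+ 2)^-1 <= 2 * (1 + c) * (1 - (1 + c * M%:R)^-1).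
  apply: le_trans H _.
  have : 0 <= (1 + c * M%:R)^-1 by rewrite invr_ge0 addr_ge0 // mulr_ge0 // ltW.
  by move: (_^-1) => w w0; nra.
elim: M => [|M IHM]; first by rewrite big_ord0 !mulr0 addr0 invr1 subrr mulr0.
rewrite big_ord_recr /= mulrDr; apply: le_trans (lerD IHM (lexx _)) _.
have y0 : 0 <= c * M%:R by rewrite mulr_ge0 // ltW.
rewrite -[M.+1%:R]natr1 (mulrDr c) mulr1; move: (c * M%:R) y0 => y y0.
rewrite -lerBrDl -mulrBr.
have -> : 1 - (1 + (y + c))^-1 - (1 - (1 + y)^-1) = c / ((1 + y) * (1 + (y + c))).
  by field; rewrite !gt_eqF //; lra.
have y2 := sqr_ge0 y; have y12 := sqr_ge0 (1 - y).
rewrite ler_pdivrMr; last by lra.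
rewrite mulrA mulrAC ler_pdivlMr; last by rewrite mulr_gt0 //; lra.
have cy := mulr_ge0 (ltW c0) y0.
rewrite [leRHS](_ : _ = c * (2 * (1 + c) * (1 + y ^+ 2))); last by ring.
rewrite ler_wpM2l ?(ltW c0) //.
by have := mulr_ge0 (ltW c0) y2; have := mulr_ge0 (ltW c0) y12; lra.
Qed.

Definition density n u : R := h n * \sum_(m < (N n).+1) summand n m u.

Lemma density_cvg u : density ^~ u @ \oo --> expR (- u ^+ 2) * (Num.sqrt pi / 2).
Proof.
have [C C0 HC] := summand_le.
have E0 := expR_gt0 (u ^+ 2).
have u1 : 0 < 1 + u ^+ 2 by rewrite ltr_wpDr ?sqr_ge0.
(* At fixed u the summands tend to e^(- x^2) e^(- u^2); multiplying by e^(u^2) gives the limit that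
   [riemann_gauss] expects. *)
have H := @riemann_gauss R h (fun n => (N n).+1) (fun n j => expR (u ^+ 2) * summand n j u)
  (expR (u ^+ 2) * (C / (1 + u ^+ 2))).
have {}H : (fun n => h n * \sum_(j < (N n).+1) (expR (u ^+ 2) * summand n j u)) @ \oo --> Num.sqrt pi / 2.
  apply: H.
  - by rewrite mulr_ge0 ?divr_ge0 // ltW.
  - by move=> n; have /andP[r0 r1] := r01 n; rewrite h_gt0 /h; lra.
  - move=> n j _; rewrite normrM (gtr0_norm E0) -mulrA ler_wpM2l ?(ltW E0) //.
  move=> x x0; have := summand_cvg x u x0.
  move=> /(cvgM (cvg_cst (expR (u ^+ 2)))).
  rewrite mulrCA -expRD subrr expR0 mulr1.
  apply: cvg_trans; apply: near_eq_cvg; apply: nearW => n /=.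
  by case: ifP => _ //; rewrite mulr0.
have {}H : (fun n => expR (- u ^+ 2) * (h n * \sum_(j < (N n).+1) (expR (u ^+ 2) * summand n j u)))
    @ \oo --> expR (- u ^+ 2) * (Num.sqrt pi / 2) by apply: cvgM => //; exact: cvg_cst.
apply: cvg_trans H; apply: near_eq_cvg; apply: nearW => n /=.
rewrite -mulr_sumr /density; move: (\sum_(_ < _) _) => S.
rewrite (_ : _ * _ = expR (- u ^+ 2) * expR (u ^+ 2) * (h n * S)); last by ring.
by rewrite -expRD addrC subrr expR0 mul1r.
Qed.

Lemma density_le : exists c : R, forall n u, `|density n u| <= c / (1 + u ^+ 2).
Proof.
have [C C0 HC] := summand_le; exists (4 * C) => n u.
have u1 : 0 < 1 + u ^+ 2 by rewrite ltr_wpDr ?sqr_ge0.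
rewrite /density normrM (gtr0_norm (h_gt0 n)).
apply: (@le_trans _ _ (h n * \sum_(m < (N n).+1) C / (1 + u ^+ 2) * (1 + (h n * m%:R) ^+ 2)^-1)).
  rewrite ler_wpM2l ?(ltW (h_gt0 n)) //; apply: le_trans (ler_norm_sum _ _ _) _.
  by apply: ler_sum => m _; exact: HC.
rewrite -mulr_sumr mulrCA mulrC -(mulrA 4) ler_wpM2r ?divr_ge0 ?(ltW u1) //.
by apply: sum_oneDsqrV_le; have /andP[r0 r1] := r01 n; rewrite h_gt0 /h; lra.
Qed.

(** * The integral of the density as a multiple of [sigmaMex] *)

Lemma continuous_sum_ord (F : nat -> R -> R) M : (forall i, continuous (F i)) ->
  continuous (fun u => \sum_(i < M) F i u).
Proof.
move=> cF; elim: M => [|M IHM] u.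
  rewrite (_ : (fun u => _) = fun=> 0); first exact: cvg_cst.
  by apply/funext => v; rewrite big_ord0.
rewrite (_ : (fun u => _) = fun u => \sum_(i < M) F i u + F M u).
  by apply: cvgD; [exact: IHM | exact: cF].
by apply/funext => v; rewrite big_ord_recr.
Qed.

Lemma Rintegral_sum_cont (F : nat -> R -> R) (a b : R) M : (forall i, continuous (F i)) ->
  \int[mu]_(u in `[a, b]) (\sum_(i < M) F i u) = \sum_(i < M) \int[mu]_(u in `[a, b]) F i u.
Proof.
move=> cF; elim: M => [|M IHM].
  under eq_Rintegral => u _ do rewrite big_ord0.
  by rewrite big_ord0 Rintegral_cst // mul0r.
under eq_Rintegral => u _ do rewrite big_ord_recr /=.
rewrite big_ord_recr /= -IHM RintegralD //.
  exact: (integrable_cont _ _ _ (continuous_sum_ord F M cF)).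
exact: (integrable_cont _ _ _ (cF M)).
Qed.

Definition full_density n u : R := h n * Pb (q n) (N n) * \sum_(m < (N n).+1) wave m (q n) (N n) (N n) (s n * u).

(** [ampE] applies to every m <= N and turns the normalized wave into [summand]. The density is thus
    a continuous function cut to one period, which yields its measurability and identifies its
    integral with Fourier coefficients. *)
Lemma densityE n : density n = (full_density n) \_ `[- (pi / s n), pi / s n].
Proof.
apply/funext => u; rewrite patchE mem_setE in_itv /= -ler_norml /density /full_density.
have P0 := Pb_gt0 (q n) (N n) (q01 n).
case: ifP => us; last by rewrite big1 ?mulr0 // => m _; rewrite /summand us.
rewrite -mulrA; congr (_ * _); rewrite mulr_sumr; apply: eq_bigr => m _.
have mN : (m <= N n)%N by rewrite -ltnS.
rewrite /summand us /wave /q (ampE m (N n) (t n) (s n * u) (t_gt0 n) mN) -pmulrn.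
move: P0; rewrite /q; move: (Pb _ _) (weight _ _) (expR (lnrho _ _ _ _)) (cos _) => P w e c P0.
by field; rewrite gt_eqF.
Qed.

Lemma continuous_wave_scale n m : continuous (fun u => wave m (q n) (N n) (N n) (s n * u)).
Proof. exact: (continuous_scale _ (s n) (continuous_wave m (q n) (N n) (N n) (q01 n))). Qed.

Lemma continuous_dens n : continuous (full_density n).
Proof.
move=> u; apply: cvgM; first exact: cvg_cst.
exact: (continuous_sum_ord (fun m u => wave m (q n) (N n) (N n) (s n * u)) _ (continuous_wave_scale n)).
Qed.

Lemma measurable_density n : measurable_fun setT (density n).
Proof.
rewrite densityE; apply/(measurable_restrictT _ _).1 => //.
apply: measurable_funTS; apply: continuous_measurable_fun; exact: continuous_dens.
Qed.

Lemma Rintegral_density n : \int[mu]_u density n u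
  = h n * Pb (q n) (N n) * (2 * pi / s n * ((sigmaMex (N n))%:R * q n ^+ (N n))).
Proof.
rewrite densityE -Rintegral_mkcond /full_density.
rewrite RintegralZl //; last first.
  apply: integrable_cont.
  exact: (continuous_sum_ord (fun m u => wave m (q n) (N n) (N n) (s n * u)) _ (continuous_wave_scale n)).
rewrite (Rintegral_sum_cont (fun m u => wave m (q n) (N n) (N n) (s n * u)) _ _ _ (continuous_wave_scale n)).
congr (_ * _); rewrite sigmaMexE natr_sum mulr_suml mulr_sumr; apply: eq_bigr => m _.
have := coef_count_ovp m (q n) (s n) (N n) (N n) (q01 n) (s_gt0 n).
by rewrite /coef.
Qed.

Lemma integral_cvg : (fun n => \int[mu]_u density n u) @ \oo --> pi / 2.
Proof.
have [c Hc] := density_le.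
have -> : pi / 2 = \int[mu]_u (expR (- u ^+ 2) * (Num.sqrt pi / 2)).
  under eq_Rintegral => u _ do rewrite mulrC.
  rewrite RintegralZl //.
    by rewrite Rintegral_gauss mulrAC -expr2 sqr_sqrtr // pi_ge0.
  apply: le_integrable (integrable_oneDsqrV 1) => //.
    apply/measurable_EFinP; apply: continuous_measurable_fun => u.
    apply: continuous_comp; last exact: continuous_expR.
    by apply: cvgN; exact: exprn_continuous.
  move=> u _; have u2 := sqr_ge0 u; rewrite lee_fin ger0_norm ?expR_ge0 //.
  by rewrite div1r ger0_norm ?invr_ge0; [apply: expRN_le|]; lra.
exact: (Rintegral_dominated _ _ c measurable_density density_cvg Hc).
Qed.

Lemma Lam_main_cvg : (fun n => expR (Lam (N n) (t n) - main_term (t n))) @ \oo --> (1 : R).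
Proof.
rewrite -expR0; apply: cvg_expR; have [C C0 HC] := @main_le_Lam R.
apply: (@dist_cvg _ (fun n => C * r n ^+ 2)); last exact: rpow_cvg.
apply: nearW => n; have h1 := Lam_le_main (N n) (t n) (t_gt0 n).
have h2 : main_term (t n) - C * t n <= Lam (N n) (t n).
  apply: HC; first by rewrite t_gt0; have := t_le n; lra.
  apply: le_trans (tN n); rewrite !div1r lef_pV2 ?posrE ?mulr_gt0 ?exprn_gt0 //.
  by have := sqr_ge0 (t n); lra.
have Ct : 0 <= C * t n by rewrite mulr_ge0 // ltW.
by rewrite subr0 ler_norml -/(t n); lra.
Qed.

(** The integral tends to pi / 2, that is sqrt pi times sqrt pi / 2. Its prefactor is h 2 pi / s =
    pi^2 / (2 t), and [Pb] equals e^(- Lam), with [Lam] replaced by [main_term] up to a factor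
    tending to 1. So sigmaMex(N) ~ (t / pi) e^(t N) e^(main_term t). *)
Lemma sigmaMex_saddle :
  (fun n => (sigmaMex (N n))%:R * (pi / t n) * expR (- (t n * (N n)%:R)) * expR (- main_term (t n)))
    @ \oo --> (1 : R).
Proof.
have p0 := pi_gt0 R.
rewrite [X in _ --> X](_ : 1 = 2 / pi * (pi / 2) * 1); last first.
  by move: (pi : R) p0 => p p0; field; rewrite gt_eqF.
have H : (fun n => 2 / pi * (\int[mu]_u density n u) * expR (Lam (N n) (t n) - main_term (t n)))
   @ \oo --> 2 / pi * (pi / 2) * 1.
  by apply: cvgM; [apply: cvgM; [exact: cvg_cst | exact: integral_cvg] | exact: Lam_main_cvg].
apply: cvg_trans H; apply: near_eq_cvg; apply: nearW => n.
rewrite Rintegral_density /q (Pb_Lam _ _ (t_gt0 n)) -expRM_natl.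
rewrite expRD expRN (expRN (main_term _)).
rewrite (_ : (N n)%:R * - t n = - (t n * (N n)%:R)); last by ring.
move: (expR (- _)) (expR (Lam _ _)) (expR_gt0 (Lam (N n) (t n))) => E L L0.
move: (expR (main_term _)) (expR_gt0 (main_term (t n))) => M M0.
rewrite /h /s /t; move: (pi : R) p0 (sigmaMex _)%:R => p p0 S.
by field; rewrite !gt_eqF.
Qed.

End Saddle.

Section Final.
Context {R : realType}.

(** The saddle argument requires t <= 1 / 4, that is sqrt n >= 2 pi at every index; the shift by
    20^2 ensures this with room to spare. *)
Lemma sqrt_shift_ge n : 20 <= Num.sqrt ((n + 20 ^ 2)%:R : R).
Proof.
rewrite -[leLHS]ger0_norm // -sqrtr_sqr ler_sqrt // -natrX ler_nat; exact: leq_addl.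
Qed.

Lemma powR_quarter (x : R) : 0 < x -> x `^ (- (3 / 4)) = (Num.sqrt (Num.sqrt x) ^+ 3)^-1.
Proof.
move=> x0; have Q0 : 0 < Num.sqrt (Num.sqrt x) by rewrite !sqrtr_gt0.
have {1}-> : x = Num.sqrt (Num.sqrt x) `^ 4.
  by rewrite (powR_mulrn 4 (ltW Q0)) (exprM _ 2 2) !sqr_sqrtr ?sqrtr_ge0 // ltW.
rewrite -powRrM -(powR_mulrn 3 (ltW Q0)) -powRN //; congr (_ `^ _); by field.
Qed.

(** With Q = n^(1/4), t / pi is 1 / (2 Q^2) and the logarithm in [main_term] contributes sqrt(t / (4
    pi)) = 1 / (2 sqrt 2 Q). Their product is 1 / (4 sqrt 2 Q^3) = (sqrt 2 / 8) n^(-3/4). *)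
Lemma sigmaMex_shift_cvg :
  (fun n : nat =>
     (sigmaMex (n + 20 ^ 2))%:R /
       (Num.sqrt 2 / 8 * (n + 20 ^ 2)%:R `^ (- (3 / 4)) * expR (pi * Num.sqrt (n + 20 ^ 2)%:R)) : R)
    @ \oo --> (1 : R).
Proof.
have p0 := pi_gt0 R.
pose t n : R := pi / (2 * Num.sqrt (n + 20 ^ 2)%:R).
have S0 n : 0 < Num.sqrt (n + 20 ^ 2)%:R :> R by apply: lt_le_trans (sqrt_shift_ge n).
have t0 n : 0 < t n by rewrite divr_gt0 ?mulr_gt0.
have rt n : Num.sqrt (t n) ^+ 2 = t n by rewrite sqr_sqrtr // ltW.
have r01 n : 0 < Num.sqrt (t n) <= 2^-1.
  rewrite sqrtr_gt0 t0 /= -(@ler_pXn2r _ 2) ?nnegrE ?sqrtr_ge0 // rt /t.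
  rewrite ler_pdivrMr ?mulr_gt0 //; have := sqrt_shift_ge n; have := @pi_le4 R; lra.
have r_cvg : (fun n => Num.sqrt (t n)) @ \oo --> (0 : R).
  rewrite -sqrtr0; apply: continuous_cvg; first exact: sqrt_continuous.
  rewrite -(mulr0 (pi / 2)).
  rewrite (_ : t = fun n => pi / 2 * (Num.sqrt (n + 20 ^ 2)%:R)^-1); last first.
    by apply/funext => n; rewrite /t invfM mulrA.
  apply: cvgM; first exact: cvg_cst.
  apply: sqrtV_cvg; exact: cvg_comp (cvg_addnr _) cvgr_idn.
have NE n : (n + 20 ^ 2)%:R = pi ^+ 2 / (4 * Num.sqrt (t n) ^+ 4).
  rewrite (exprM _ 2 2) rt /t -[LHS]sqr_sqrtr ?ler0n //.
  by move: (pi : R) (Num.sqrt _) p0 (S0 n) => p S p0 {}S0; field; rewrite !gt_eqF.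
have H := sigmaMex_saddle (fun n => Num.sqrt (t n)) (fun n => (n + 20 ^ 2)%N) r01 r_cvg NE.
apply: cvg_trans H; apply: near_eq_cvg; apply: nearW => n.
rewrite rt powR_quarter; last by rewrite ltr0n; lia.
have E : (n + 20 ^ 2)%:R = Num.sqrt (n + 20 ^ 2)%:R ^+ 2 :> R by rewrite sqr_sqrtr ?ler0n.
rewrite [t n * _](_ : _ = t n * Num.sqrt (n + 20 ^ 2)%:R ^+ 2); last by rewrite -E.
set Q := Num.sqrt (Num.sqrt _).
have Q0 : 0 < Q by rewrite sqrtr_gt0.
have SQ : Num.sqrt (n + 20 ^ 2)%:R = Q ^+ 2 :> R by rewrite sqr_sqrtr // ltW.
rewrite /main_term; have w0 : 0 < Num.sqrt 2 :> R by rewrite sqrtr_gt0.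
have w2 : Num.sqrt 2 ^+ 2 = 2 :> R by rewrite sqr_sqrtr.
rewrite -ln_sqrt; last by rewrite divr_gt0 ?mulr_gt0.
have -> : Num.sqrt (t n / (4 * pi)) = (2 * Num.sqrt 2 * Q)^-1.
  have -> : t n / (4 * pi) = (2 * Num.sqrt 2 * Q)^-1 ^+ 2.
    rewrite exprVn !exprMn w2 /t SQ; move: (pi : R) p0 => p p0.
    by field; rewrite !gt_eqF.
  by rewrite sqrtr_sqr ger0_norm // invr_ge0 ltW // !mulr_gt0.
rewrite opprD expRD (expRN (ln _)) lnK ?posrE ?invr_gt0 ?mulr_gt0 // invrK.
rewrite /t SQ; have -> : pi * Q ^+ 2 = pi / (2 * Q ^+ 2) * (Q ^+ 2) ^+ 2 + pi ^+ 2 / (4 * (pi / (2 * Q ^+ 2))).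
  by move: (pi : R) p0 => p p0; field; rewrite !gt_eqF.
rewrite expRD !expRN.
move: (expR _) (expR_gt0 (pi / (2 * Q ^+ 2) * (Q ^+ 2) ^+ 2)) => A A0.
move: (expR _) (expR_gt0 (pi ^+ 2 / (4 * (pi / (2 * Q ^+ 2))))) => B B0.
move: (pi : R) (sigmaMex _)%:R (Num.sqrt 2) p0 w0 w2 => p S w {}p0 w0 w2.
have -> : w / 8 = (4 * w)^-1 by rewrite -[8](_ : 4 * w ^+ 2 = 8); [field; rewrite gt_eqF | rewrite w2; ring].
by field; rewrite !gt_eqF.
Qed.

End Final.

Theorem theorem1p11 (R : realType) :
  (fun n : nat =>
     (sigmaMex n)%:R /
       (Num.sqrt 2 / 8 * n%:R `^ (- (3 / 4)) * expR (pi * Num.sqrt n%:R)) : R)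
    @ \oo --> (1 : R).
Proof. by rewrite -(@cvg_shiftn (20 ^ 2)); exact: sigmaMex_shift_cvg. Qed.
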